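(* Fix $\beta>0$, $a>-1$ and let $B$ be standard Brownian motion. Let $y(t)=e^{\frac2{\sqrt\beta}B(2t)+(2a+1)t}$ and define $\tilde y(t)=y(-\log(1-t))$, $t\in[0,1)$. Then the operator $$\mathtt{Bessel}_{\beta,a}=\mathtt{Dir}(i\tilde y,0,\infty)$$ on the interval $[0,1)$ satisfies (almost surely) the conditions (A)–(C) of the context and hence it is self-adjoint on the domain given there. The operator is limit circle near $1$ for $-1<a<0$ and limit point for $a\ge0$. It is a.s. invertible and the inverse is a.s. Hilbert–Schmidt. Moreover, we have the equality of spectra $$\operatorname{spec}\mathtt{Bessel}_{\beta,a}=4\sqrt{\operatorname{spec}\mathfrak G_{\beta,a}}\cup\left(-4\sqrt{\operatorname{spec}\mathfrak G_{\beta,a}}\right),$$ where $\mathfrak G_{\beta,a}$ is the Sturm–Liouville operator $$\mathfrak G_{\beta,a}f(x)=-\frac1{m(x)}\partial_x\left(\frac1{s(x)}\partial_xf(x)\right),\qquad m(x)=e^{-(a+1)x-\frac2{\sqrt\beta}B(x)},\quad s(x)=e^{ax+\frac2{\sqrt\beta}B(x)},$$ built from the same $B$, acting on functions $[0,\infty)\to\mathbb R$ with Dirichlet boundary condition at $0$ and Neumann boundary condition at $\infty$.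
   Context: Dirac operators: let $J=\begin{pmatrix}0&-1\\1&0\end{pmatrix}$. For a path $x+iy:[0,T)\to\{\Im z>0\}$ and boundary points $u_0,u_1\in\mathbb R\cup\{\infty\}$, identified with directions of nonzero vectors via $(a,b)^t\leftrightarrow a/b$ (so $0\leftrightarrow(0,1)^t$, $\infty\leftrightarrow(1,0)^t$), $\mathtt{Dir}(x+iy,u_0,u_1)$ denotes the operator $\tau v=R^{-1}Jv'$, $R=\frac1{2y}\begin{pmatrix}1&-x\\-x&x^2+y^2\end{pmatrix}$, on functions $v:[0,T)\to\mathbb R^2$. Here $T=1$. Conditions: (A) $R(t)$ is positive definite for all $t\in[0,T)$; (B) $R$ is measurable and $\|R\|,\|R^{-1}\|$ are locally bounded on $[0,T)$; (C) there is a nonzero $u_*\in\mathbb R^2$ with $\int_0^Tu_*^tRu_*\,ds<\infty$. $L^2_R$ is the Hilbert space with $\langle v,w\rangle_R=\int_0^Tv^tRw\,dt$. The operator is limit circle (at $T$) if $\|R\|$ is integrable on $[0,T)$, limit point otherwise. The domain consists of the locally absolutely continuous $v\in L^2_R$ with $\tau v\in L^2_R$, $v(0)^tJu_0=0$, and in the limit circle case also $\lim_{s\to T}v(s)^tJu_1=0$; in the limit point case $u_1$ is (parallel to) $u_*$. Self-adjointness and Hilbert–Schmidt are with respect to $L^2_R$; the spectrum is that of the complexified operator. The operator $\mathfrak G_{\beta,a}$ is self-adjoint in $L^2_m=L^2(\mathbb R_+,m\,dx)$ with domain $\{f:\ f,\ s^{-1}f'\text{ locally absolutely continuous on }[0,\infty),\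 f,\mathfrak G_{\beta,a}f\in L^2_m,\ f(0)=0,\ \lim_{x\to\infty}s^{-1}(x)f'(x)=0\}$; its spectrum is discrete and positive. For a set $S\subset(0,\infty)$, $\sqrt S=\{\sqrt\lambda:\lambda\in S\}$. *)

(* Defs.v *)
From HB Require Import structures.
From mathcomp Require Import all_boot all_order all_algebra.
From mathcomp Require Import complex.
From mathcomp Require Import all_classical all_reals all_analysis.

Set Implicit Arguments.
Unset Strict Implicit.
Unset Printing Implicit Defensive.

Import Order.TTheory GRing.Theory Num.Theory.
Import numFieldNormedType.Exports.

Local Open Scope classical_set_scope.
Local Open Scope ring_scope.
Local Open Scope complex_scope.

(** A Hilbert space of functions is given by the vector space [V] of all
    functions, the subspace [hmem] of functions of finite norm, and the form
    [ip] on it.  Vectors are functions up to [hequiv] (norm-zero difference); no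
    quotient is formed. *)

Record hilb (R : realType) (V : lmodType R) := Hilb {
  hmem : set V;
  ip : V -> V -> R
}.

Definition hnorm (R : realType) (V : lmodType R) (H : hilb V) (v : V) : R :=
  Num.sqrt (ip H v v).

Definition hequiv (R : realType) (V : lmodType R) (H : hilb V) (v w : V) : Prop :=
  hnorm H (v - w) = 0.

(** An (unbounded) operator is given by its graph: [A v w] says that the
    representative [v] lies in the domain and that [w] represents [A v]. *)
Definition oper (R : realType) (V : lmodType R) := V -> V -> Prop.

Definition dense_dom (R : realType) (V : lmodType R) (H : hilb V) (A : oper V) :
    Prop :=
  forall f, hmem H f -> forall e : R, 0 < e ->
    exists v w, A v w /\ hnorm H (f - v) < e.

(** [A = A^*] as graphs; [(f, g)] is in the graph of [A^*] iff
    [<A v, f> = <v, g>] for all [v] in the domain. *)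
Definition self_adjoint (R : realType) (V : lmodType R) (H : hilb V)
    (A : oper V) : Prop :=
  [/\ forall v w, A v w -> hmem H v /\ hmem H w,
      dense_dom H A &
      forall f g, hmem H f -> hmem H g ->
        ((forall v w, A v w -> ip H w f = ip H v g) <->
         (exists v w, [/\ A v w, hequiv H f v & hequiv H g w]))].

(** [K] is an everywhere defined bounded two-sided inverse of [A].  Linearity
    and compatibility with [hequiv] follow from those of [A]. *)
Definition bounded_inverse (R : realType) (V : lmodType R) (H : hilb V)
    (A : oper V) (K : V -> V) : Prop :=
  [/\ forall f, hmem H f -> hmem H (K f),
      exists C : R, forall f, hmem H f -> hnorm H (K f) <= C * hnorm H f,
      forall f, hmem H f -> exists v w, [/\ A v w, hequiv H (K f) v & hequiv H f w] &
      forall v w, A v w -> hequiv H (K w) v].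

Definition orthonormal_basis (R : realType) (V : lmodType R) (H : hilb V)
    (E : set V) : Prop :=
  [/\ E `<=` hmem H,
      forall e e', E e -> E e' -> ip H e e' = (e == e')%:R &
      forall v, hmem H v -> (forall e, E e -> ip H v e = 0) -> hnorm H v = 0].

Definition hilbert_schmidt (R : realType) (V : lmodType R) (H : hilb V)
    (K : V -> V) : Prop :=
  exists2 E : set V, orthonormal_basis H E &
    (\esum_(e in E) ((hnorm H (K e)) ^+ 2)%:E < +oo)%E.

(** The complexification: the pair [(v1, v2)] stands for [v1 + i v2], and [ip]
    is the real part of the complex inner product, which has the same norm. *)
Definition complexify (R : realType) (V : lmodType R) (H : hilb V) :
    hilb (V * V)%type :=
  Hilb [set v | hmem H v.1 /\ hmem H v.2]
       (fun v w => ip H v.1 w.1 + ip H v.2 w.2).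

(** [A_C - z], where [A_C (v1 + i v2) = A v1 + i A v2]. *)
Definition op_shift (R : realType) (V : lmodType R) (A : oper V) (z : R[i]) :
    oper (V * V)%type :=
  fun v u => exists w1 w2,
    [/\ A v.1 w1, A v.2 w2 &
        u = (w1 - (complex.Re z *: v.1 - complex.Im z *: v.2),
             w2 - (complex.Re z *: v.2 + complex.Im z *: v.1))].

Definition spec (R : realType) (V : lmodType R) (H : hilb V) (A : oper V) :
    set R[i] :=
  [set z | ~ exists K, bounded_inverse (complexify H) (op_shift A z) K].

Definition abs_cont (R : realType) (V : normedModType R) (a b : R)
    (f : R -> V) : Prop :=
  forall e : R, 0 < e -> exists2 d : R, 0 < d &
    forall (n : nat) (l r : 'I_n -> R),
      (forall i, a <= l i /\ l i <= r i /\ r i <= b) ->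
      trivIset setT (fun i => `]l i, r i[%classic) ->
      \sum_(i < n) (r i - l i) < d ->
      \sum_(i < n) `|f (r i) - f (l i)| < e.

Definition loc_abs_cont (R : realType) (V : normedModType R) (I : set R)
    (f : R -> V) : Prop :=
  forall a b : R, `[a, b] `<=` I -> abs_cont a b f.

Definition mx2 (R : realType) (a b c d : R) : 'M[R]_2 :=
  \matrix_(i, j) if i == 0 then (if j == 0 then a else b)
                 else (if j == 0 then c else d).

Definition cv2 (R : realType) (a b : R) : 'cV[R]_2 :=
  \col_i if i == 0 then a else b.

Definition Jmx (R : realType) : 'M[R]_2 := mx2 0 (-1) 1 0.

(** [u^t W v] *)
Definition wform (R : realType) (W : 'M[R]_2) (u v : 'cV[R]_2) : R :=
  (u^T *m W *m v) 0 0.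

(** A boundary point in [R U {oo}] ([None] being [oo]) as a direction. *)
Definition dirvec (R : realType) (u : option R) : 'cV[R]_2 :=
  if u is Some r then cv2 r 1 else cv2 1 0.

Record dirac_data (R : realType) := Dir {
  dir_T : R;
  dir_path : R -> R[i];   (* only its values on [0, T) matter *)
  dir_u0 : option R;
  dir_u1 : option R
}.

Definition dir_dom (R : realType) (D : dirac_data R) : set R := `[0, dir_T D[.

Definition dir_R (R : realType) (D : dirac_data R) (t : R) : 'M[R]_2 :=
  let x := complex.Re (dir_path D t) in
  let y := complex.Im (dir_path D t) in
  (2 * y)^-1 *: mx2 1 (- x) (- x) (x ^+ 2 + y ^+ 2).

Definition condA (R : realType) (D : dirac_data R) : Prop :=
  forall t, dir_dom D t ->
    (dir_R D t)^T = dir_R D t /\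
    forall u : 'cV[R]_2, u != 0 -> 0 < wform (dir_R D t) u u.

(** The norm on matrices is the library's (largest absolute value of an entry);
    all norms are equivalent here. *)
Definition condB (R : realType) (D : dirac_data R) : Prop :=
  (forall i j, measurable_fun (dir_dom D) (fun t => dir_R D t i j)) /\
  (forall t, dir_dom D t -> exists M : R, forall s, 0 <= s <= t ->
     `|dir_R D s| <= M /\ `|invmx (dir_R D s)| <= M).

Definition ustar (R : realType) (D : dirac_data R) (u : 'cV[R]_2) : Prop :=
  u != 0 /\
  (\int[@lebesgue_measure R]_(s in dir_dom D) (wform (dir_R D s) u u)%:E < +oo)%E.

Definition condC (R : realType) (D : dirac_data R) : Prop := exists u, ustar D u.

Definition limit_circle_case (R : realType) (D : dirac_data R) : Prop :=
  (@lebesgue_measure R).-integrable (dir_dom D) (fun t => (`|dir_R D t|)%:E).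

Definition limit_point_case (R : realType) (D : dirac_data R) : Prop := ~ limit_circle_case D.

(** In the limit point case [u_1] is required to be parallel to a [u_*]. *)
Definition u1_admissible (R : realType) (D : dirac_data R) : Prop :=
  limit_point_case D ->
  exists2 u, ustar D u & exists c : R, dirvec (dir_u1 D) = c *: u.

Definition L2R (R : realType) (D : dirac_data R) : hilb (R -> 'cV[R]_2) :=
  Hilb
    [set v : R -> 'cV[R]_2 |
       (forall i, measurable_fun (dir_dom D) (fun t => v t i 0)) /\
       (\int[@lebesgue_measure R]_(t in dir_dom D)
           (wform (dir_R D t) (v t) (v t))%:E < +oo)%E]
    (fun v w => (\int[@lebesgue_measure R]_(t in dir_dom D)
                   wform (dir_R D t) (v t) (w t))%R).

(** The graph of [tau v = R^{-1} J v'] on its domain.  The derivative [derive1 v] of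
    a locally absolutely continuous [v] is meaningful almost everywhere. *)
Definition dirac_op (R : realType) (D : dirac_data R) : oper (R -> 'cV[R]_2) :=
  fun v w =>
    [/\ loc_abs_cont (dir_dom D) v,
        hmem (L2R D) v /\ hmem (L2R D) w,
        {ae @lebesgue_measure R, forall t, dir_dom D t ->
           w t = invmx (dir_R D t) *m Jmx R *m derive1 v t},
        wform (Jmx R) (v 0) (dirvec (dir_u0 D)) = 0 &
        limit_circle_case D ->
          wform (Jmx R) (v s) (dirvec (dir_u1 D)) @[s --> (dir_T D)^'-] --> (0 : R)].

Definition mutually_independent (R : realType) (d : measure_display)
    (Omega : measurableType d) (P : probability Omega R) (n : nat)
    (X : 'I_n -> Omega -> R) : Prop :=
  forall A : 'I_n -> set R, (forall i, measurable (A i)) ->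
    P (\bigcap_(i in [set: 'I_n]) (X i @^-1` A i)) =
    (\big[*%E/1%E]_(i < n) P (X i @^-1` A i))%E.

(** Only the values of [B t] for [t >= 0] matter. *)
Record brownian_motion (R : realType) (d : measure_display)
    (Omega : measurableType d) (P : probability Omega R) (B : R -> Omega -> R) :
    Prop := BrownianMotion {
  bm_measurable : forall t, 0 <= t -> measurable_fun setT (B t);
  bm_start : {ae P, forall w, B 0 w = 0};
  bm_continuous : {ae P, forall w,
    {within `[0, +oo[, continuous (fun t => B t w)}};
  bm_gaussian : forall s t, 0 <= s -> s < t ->
    forall A : set R, measurable A ->
      P ((fun w => B t w - B s w) @^-1` A) = normal_prob 0 (Num.sqrt (t - s)) A;
  bm_independent : forall (n : nat) (t : nat -> R),
    0 <= t 0%N -> (forall i, (i < n)%N -> t i <= t i.+1) ->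
    mutually_independent P (fun (i : 'I_n) w => B (t i.+1) w - B (t i) w)
}.

(** Below, [b] is a sample path of Brownian motion. *)

Definition bessel_y (R : realType) (beta a : R) (b : R -> R) (t : R) : R :=
  expR (2 / Num.sqrt beta * b (2 * t) + (2 * a + 1) * t).

Definition bessel_ytilde (R : realType) (beta a : R) (b : R -> R) (t : R) : R :=
  bessel_y beta a b (- ln (1 - t)).

Definition bessel (R : realType) (beta a : R) (b : R -> R) : dirac_data R :=
  Dir 1 (fun t => 0 +i* bessel_ytilde beta a b t) (Some 0) None.

Definition sl_m (R : realType) (beta a : R) (b : R -> R) (x : R) : R :=
  expR (- (a + 1) * x - 2 / Num.sqrt beta * b x).

Definition sl_s (R : realType) (beta a : R) (b : R -> R) (x : R) : R :=
  expR (a * x + 2 / Num.sqrt beta * b x).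

Definition halfline {R : realType} : set R := `[0, +oo[.

Definition L2m (R : realType) (m : R -> R) : hilb (R -> R) :=
  Hilb
    [set f : R -> R |
       measurable_fun halfline f /\
       (\int[@lebesgue_measure R]_(x in halfline) (f x ^+ 2 * m x)%:E < +oo)%E]
    (fun f g => (\int[@lebesgue_measure R]_(x in halfline) (f x * g x * m x))%R).

(** The graph of [f |-> - m^{-1} (s^{-1} f')'] on its domain.  The function [h]
    is [s^{-1} f'], extended by continuity to [0], where only the one-sided
    derivative of [f] is meaningful. *)
Definition sturm_liouville (R : realType) (m s : R -> R) : oper (R -> R) :=
  fun f g =>
    [/\ loc_abs_cont halfline (f : R -> R^o),
        hmem (L2m m) f /\ hmem (L2m m) g,
        f 0 = 0 &
        exists h : R -> R,
          [/\ loc_abs_cont halfline (h : R -> R^o),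
              forall x, 0 < x -> h x = (s x)^-1 * derive1 f x,
              {ae @lebesgue_measure R, forall x, halfline x ->
                 g x = - ((m x)^-1 * derive1 h x)} &
              h x @[x --> +oo] --> (0 : R)]].

Definition sl_space (R : realType) (beta a : R) (b : R -> R) : hilb (R -> R) :=
  L2m (sl_m beta a b).

Definition sl_op (R : realType) (beta a : R) (b : R -> R) : oper (R -> R) :=
  sturm_liouville (sl_m beta a b) (sl_s beta a b).

(** [sqrtc] is the principal square root, the nonnegative one on [0, oo). *)
Definition sqrt_set (R : realType) (S : set R[i]) : set R[i] :=
  [set sqrtc z | z in S].

(* Main.v *)
(** Write [R = diag(p, q)] with [p = 1/(2 ytilde)] and [q = ytilde/2].  The inverse
    of the Dirac operator is [K (v1, v2) = (A v2, A^* v1)], where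
    [A f (t) = int_0^t q f] and [A^* g (t) = int_t^1 p g] are adjoint to each
    other between [L^2_q] and [L^2_p].  It is Hilbert-Schmidt as soon as
    [int_0^1 q(t) (int_t^1 p) dt] is finite, and the domain of the operator is
    exactly the range of [K], whence self-adjointness.  Eliminating one component,
    [z] is in the spectrum iff [1 - z^2 A A^*] is not invertible on [L^2_p].
    The substitution [x = - 2 ln (1 - t)] turns [p dt] and [q dt] into [m dx / 4]
    and [s dx / 4], hence carries [A A^*] to [G^-1 / 16]; so [spec Bessel] is the set
    of [w] with [w^2 / 16] in [spec G].

    On the path side this needs only [B(x) = o(x)], for the integrability conditions
    and the limit circle case, and [int_0^oo exp(c B) = oo] for [c > 0], for the
    limit point case.  Both follow from Borel-Cantelli: oscillations of [B] over an
    interval are bounded by dyadic chaining, and by independence the increments over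
    [[2^2^k, 2^2^(k+1)]] infinitely often exceed their standard deviation. *)

Require Import Defs.
From HB Require Import structures.
From mathcomp Require Import all_boot all_order all_algebra.
From mathcomp Require Import complex ring lra.
From mathcomp Require Import all_classical all_reals all_analysis.
From mathcomp Require Import measurable_realfun.

Set Implicit Arguments.
Unset Strict Implicit.
Unset Printing Implicit Defensive.

Import Order.TTheory GRing.Theory Num.Theory.
Import numFieldNormedType.Exports.

Local Open Scope classical_set_scope.
Local Open Scope ring_scope.
Local Open Scope complex_scope.

(** * Absolutely continuous functions *)

(** The domains are phrased by epsilon-delta absolute continuity, so they can be compared with the
    range of [K] only through both halves of the fundamental theorem for such functions; the hard
    half comes from Radon-Nikodym applied to Stieltjes measures. Integrating [tau v = w] then
    determines the first component of [v] by its value at 0, and the second up to a constant. A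
    nonzero constant is excluded by the boundary condition at 1 in the limit circle case and by [q]
    not being integrable in the limit point case, so one inverse serves both. Spectra are compared
    through bounded invertibility of [1 - z K], expressed as surjectivity with a lower bound. This
    passes through block elimination and change of variables without any eigenvalue, and without
    knowing beforehand that the spectra are real. The product [p q = 1/4] is constant, so dividing
    by one weight is multiplying by the other; this makes the range of [K] dense. The substitution
    in the integrals rests on a fact about laws: if [X] is exponential of rate 1/2, then
    [1 - exp (- X / 2)] is uniform on [[0, 1]]. *)

Definition disj_itv (R : realType) (i j : R * R) : bool :=
  (i.2 <= j.1) || (j.2 <= i.1).

Definition itv_in (R : realType) (a b : R) (i : R * R) : bool :=
  [&& a <= i.1, i.1 <= i.2 & i.2 <= b].

Definition itv_sum (R : realType) (s : seq (R * R)) : R :=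
  \sum_(i <- s) (i.2 - i.1).

Definition var_sum (R : realType) (F : R -> R) (s : seq (R * R)) : R :=
  \sum_(i <- s) `|F i.2 - F i.1|.

(** Lists of intervals, which may share endpoints, in place of indexed families: the proofs below
    concatenate and refine them. *)
Definition abs_cont_seq (R : realType) (a b : R) (F : R -> R) : Prop :=
  forall e : R, 0 < e -> exists2 d : R, 0 < d &
    forall s : seq (R * R), all (itv_in a b) s ->
      pairwise (@disj_itv R) s -> itv_sum s < d -> var_sum F s < e.

Lemma abs_cont_seqP (R : realType) (a b : R) (F : R -> R) :
  abs_cont a b (F : R -> R^o) -> abs_cont_seq a b F.
Proof.
move=> acF e e0; have [d d0 H] := acF e e0; exists d => // s sab /(pairwiseP (0, 0)) sd slt.
have := H (size s) (fun i => (nth (0, 0) s i).1) (fun i => (nth (0, 0) s i).2).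
rewrite /itv_sum /var_sum !(big_nth (0, 0)) !big_mkord in slt *.
apply => //.
  by move=> i; have /(all_nthP (0, 0))/(_ i (ltn_ord i))/and3P[] := sab.
apply/trivIsetP => i j _ _ ij.
have nj (u v : R * R) : disj_itv u v ->
    `]u.1, u.2[%classic `&` `]v.1, v.2[%classic = set0.
  move=> uv; rewrite -subset0 => x /=; rewrite !in_itv/= => -[/andP[h1 h2] /andP[h3 h4]].
  by case/orP: uv => uv; lra.
have [ij'|ji'|/val_inj eij] := ltngtP i j; last by rewrite eij eqxx in ij.
- by apply: nj; apply: sd; rewrite // inE.
- by rewrite setIC; apply: nj; apply: sd; rewrite // inE.
Qed.

(** [total_variation] runs over increasing lists of points, absolute continuity over lists of
    intervals; this converts the first into the second. *)
Lemma zip_partition (R : realType) (a : R) (s : seq R) : path <=%O a s ->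
  let t := [seq (x.2, x.1) | x <- zip s (a :: s)] in
  [/\ all (itv_in a (last a s)) t, pairwise (@disj_itv R) t &
      itv_sum t = last a s - a].
Proof.
elim: s a => [|x s ih] a /=; first by rewrite /itv_sum big_nil subrr.
move=> /andP[ax xs]; have [h1 h2 h3] := ih x xs.
have xl : x <= last x s.
  have /allP H := order_path_min le_trans xs.
  by have := mem_last x s; rewrite inE => /predU1P[->//|/H].
split.
- rewrite /itv_in/= lexx ax xl/=; apply: sub_all h1 => i /and3P[h4 h5 h6].
  by rewrite /itv_in (le_trans ax h4) h5 h6.
- rewrite h2 andbT; apply: sub_all h1 => i /and3P[h4 h5 h6].
  by rewrite /disj_itv /= h4.
- by rewrite /itv_sum big_cons/=; move: h3; rewrite /itv_sum => ->; ring.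
Qed.

Lemma itv_sum_cat (R : realType) (s t : seq (R * R)) :
  itv_sum (s ++ t) = itv_sum s + itv_sum t.
Proof. by rewrite /itv_sum big_cat. Qed.

Lemma var_sum_cat (R : realType) (F : R -> R) (s t : seq (R * R)) :
  var_sum F (s ++ t) = var_sum F s + var_sum F t.
Proof. by rewrite /var_sum big_cat. Qed.

Lemma disj_itv_sub (R : realType) (i j i' j' : R * R) : disj_itv i j ->
  i.1 <= i'.1 -> i'.2 <= i.2 -> j.1 <= j'.1 -> j'.2 <= j.2 -> disj_itv i' j'.
Proof. rewrite /disj_itv => /orP[] h h1 h2 h3 h4; apply/orP; [left|right]; lra. Qed.

Lemma bounded_variationS (R : realType) (a b c d : R) (F : R -> R) :
  bounded_variation a b F -> a <= c -> c <= d -> d <= b -> bounded_variation c d F.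
Proof.
move=> h ac cd db.
exact: (bounded_variationl cd db (bounded_variationr ac (le_trans cd db) h)).
Qed.

Definition TVf (R : realType) (c d : R) (F : R -> R) : R := fine (total_variation c d F).

Lemma TVfE (R : realType) (a b c d : R) (F : R -> R) : bounded_variation a b F ->
  a <= c -> c <= d -> d <= b -> (TVf c d F)%:E = total_variation c d F.
Proof.
move=> bv ac cd db; rewrite /TVf fineK//.
by apply/bounded_variationP => //; exact: bounded_variationS bv _ _ _.
Qed.

Lemma TVf_approx (R : realType) (a b c d e : R) (F : R -> R) :
  bounded_variation a b F -> a <= c -> c <= d -> d <= b -> 0 < e ->
  exists t, [/\ all (itv_in c d) t, pairwise (@disj_itv R) t, itv_sum t = d - c &
    TVf c d F <= var_sum F t + e].
Proof.
move=> bv ac cd db e0; have TE := TVfE bv ac cd db.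
have : ((TVf c d F - e)%:E < total_variation c d F)%E by rewrite -TE lte_fin; lra.
move=> /ereal_sup_gt[_ [_ [s [cs /eqP ls] <-] <-]]; rewrite lte_fin => hs.
exists [seq (x.2, x.1) | x <- zip s (c :: s)].
have cs' : path <=%O c s by apply: sub_path cs => x y /ltW.
have [h1 h2 h3] := zip_partition cs'; rewrite ls in h1 h2 h3.
split => //; rewrite variation_zip in hs; last by split => //; apply/eqP.
rewrite /var_sum big_map; lra.
Qed.

(** Replacing every interval of [s] by a nearly optimal partition keeps the total length, so the
    modulus of absolute continuity of [F] applies to the refined list [t]. *)
Lemma TVf_seq_approx (R : realType) (a b e : R) (F : R -> R) (s : seq (R * R)) :
  bounded_variation a b F -> all (itv_in a b) s -> pairwise (@disj_itv R) s -> 0 < e ->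
  exists t, [/\ all (itv_in a b) t, pairwise (@disj_itv R) t, itv_sum t = itv_sum s &
    \sum_(i <- s) TVf i.1 i.2 F <= var_sum F t + e *+ size s].
Proof.
move=> bv sab sd e0.
(* The extra clause, that every interval of [t] lies in one of [s], makes the new pieces disjoint
   from the old ones in the induction. *)
suff [t [h1 h2 h3 h4 h5]] : exists t, [/\ all (itv_in a b) t, pairwise (@disj_itv R) t,
    itv_sum t = itv_sum s, \sum_(i <- s) TVf i.1 i.2 F <= var_sum F t + e *+ size s &
    all (fun j => has (fun i => (i.1 <= j.1) && (j.2 <= i.2)) s) t].
  by exists t.
elim: s sab sd => [|i s ih] /=.
  by exists [::]; rewrite /itv_sum /var_sum !big_nil addr0.
move=> /andP[/and3P[h1 h2 h3] sab] /andP[is' sd].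
have [t [k1 k2 k3 k4 k5]] := ih sab sd.
have [u [l1 l2 l3 l4]] := TVf_approx bv h1 h2 h3 e0.
exists (u ++ t); split.
- rewrite all_cat k1 andbT; apply: sub_all l1 => j /and3P[j1 j2 j3].
  by rewrite /itv_in j2 (le_trans h1 j1) (le_trans j3 h3).
- rewrite pairwise_cat l2 k2 !andbT; apply/allrelP => j k ju kt.
  have /and3P[j1 j2 j3] := allP l1 j ju.
  have /hasP[m ms /andP[m1 m2]] := allP k5 k kt.
  exact: disj_itv_sub (allP is' m ms) _ _ _ _.
- by rewrite itv_sum_cat l3 k3 /itv_sum big_cons.
- by rewrite big_cons var_sum_cat mulrS; lra.
- rewrite all_cat; apply/andP; split.
    by apply: sub_all l1 => j /and3P[j1 j2 j3]; rewrite j1 j3.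
  by apply: sub_all k5 => j ->; rewrite orbT.
Qed.

Lemma TVfD (R : realType) (a b c d e : R) (F : R -> R) : bounded_variation a b F ->
  a <= c -> c <= d -> d <= e -> e <= b -> TVf c e F = TVf c d F + TVf d e F.
Proof.
move=> bv ac cd de eb; apply: EFin_inj.
have ce := le_trans cd de; have ad := le_trans ac cd; have db := le_trans de eb.
by rewrite EFinD !(TVfE bv)// (total_variationD _ cd de).
Qed.

(** On an interval shorter than the [d] that belongs to [e = 1], every partition sum is below 1;
    finitely many steps of length [d / 2] cover [[a, b]]. *)
Lemma abs_cont_bounded_variation (R : realType) (a b : R) (F : R -> R) : a <= b ->
  abs_cont_seq a b F -> bounded_variation a b F.
Proof.
move=> ab acF; have [d d0 H] := acF 1 ltr01.
have step c e : a <= c -> c <= e -> e <= b -> e - c < d -> bounded_variation c e F.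
  move=> ac ce eb ecd; exists 1 => _ [s [cs /eqP ls] <-].
  rewrite variation_zip; last by split => //; apply/eqP.
  have cs' : path <=%O c s by apply: sub_path cs => x y /ltW.
  have [h1 h2 h3] := zip_partition cs'; rewrite ls in h1 h2 h3.
  have := H _ _ h2; rewrite h3 => /(_ _ ecd)/ltW.
  rewrite /var_sum big_map; apply.
  apply: sub_all h1 => j /and3P[j1 j2 j3].
  by rewrite /itv_in j2 (le_trans ac j1) (le_trans j3 eb).
have step2 n : forall x, a <= x -> x <= b -> x - a < d / 2 *+ n -> bounded_variation a x F.
  elim: n => [|n ih] x ax xb; first by rewrite mulr0n; lra.
  rewrite mulrS => h.
  have [hx|hx] := leP (x - d / 2) a; first by apply: step => //; lra.
  have xx : x - d / 2 <= x by lra.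
  apply/bounded_variationP => //; rewrite (total_variationD _ (ltW hx) xx).
  rewrite fin_numD; apply/andP; split; apply/bounded_variationP => //; rewrite ?(ltW hx)//.
    apply: ih; lra.
  by apply: step => //; lra.
apply: (step2 (Num.bound ((b - a) / (d / 2)))) => //.
have : (b - a) / (d / 2) < (Num.bound ((b - a) / (d / 2)))%:R.
  by apply: archi_boundP; rewrite divr_ge0 ?divr_ge0 ?subr_ge0// ltW.
by rewrite ltr_pdivrMr ?divr_gt0// => h; rewrite -mulr_natl.
Qed.

Lemma abs_cont_seq_TVf (R : realType) (a b : R) (F : R -> R) :
  abs_cont_seq a b F -> abs_cont_seq a b (fun x => TVf a x F).
Proof.
move=> acF.
have [ab|ba] := leP a b; last first.
  move=> e e0; exists 1 => // -[|i s] /=; first by rewrite /var_sum big_nil.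
  by move=> /andP[/and3P[h1 h2 h3]]; lra.
have bv := abs_cont_bounded_variation ab acF.
move=> e e0; have [|d d0 H] := acF (e / 2); first by lra.
exists d => // s sab sd slt.
(* The error allowed on each interval; the successor in the denominator covers the empty list. *)
have d1 : 0 < e / 2 / (size s).+1%:R by rewrite divr_gt0// divr_gt0.
have [t [h1 h2 h3 h4]] := TVf_seq_approx bv sab sd d1.
have h5 : var_sum F t < e / 2 by apply: H => //; rewrite h3.
have -> : var_sum (fun x => TVf a x F) s = \sum_(i <- s) TVf i.1 i.2 F.
  rewrite /var_sum !big_seq; apply: eq_bigr => i /(allP sab)/and3P[i1 i2 i3].
  rewrite (TVfD bv (lexx a) i1 i2 i3) addrAC subrr add0r ger0_norm//.
  by rewrite /TVf fine_ge0// total_variation_ge0.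
have : e / 2 / (size s).+1%:R *+ size s <= e / 2.
  rewrite -mulr_natr -mulrA ler_piMr//; first lra.
  by rewrite mulrC ler_pdivrMr// mul1r ler_nat.
by move=> h6; apply: le_lt_trans h4 _; rewrite [ltRHS]splitr; exact: (ltr_leD h5 h6).
Qed.

(** Used to extend a function on [[a, b]] by its end values, so that a monotone one becomes a
    cumulative function on the whole line. *)
Definition clamp (R : realType) (a b x : R) : R := Num.max a (Num.min x b).

Lemma clamp_id (R : realType) (a b x : R) : a <= x -> x <= b -> clamp a b x = x.
Proof. by move=> ax xb; rewrite /clamp (min_idPl xb) (max_idPr ax). Qed.

Lemma clamp_itv (R : realType) (a b x : R) : a <= b ->
  a <= clamp a b x /\ clamp a b x <= b.
Proof.
by move=> ab; rewrite /clamp le_max lexx ge_max ab ge_min lexx orbT.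
Qed.

Lemma clamp_homo (R : realType) (a b : R) : {homo clamp a b : x y / x <= y}.
Proof.
move=> x y xy; rewrite /clamp ge_max !le_max lexx/= le_min !ge_min xy lexx !orbT.
by [].
Qed.

Lemma clamp_lip (R : realType) (a b x y : R) : x <= y ->
  clamp a b y - clamp a b x <= y - x.
Proof. by rewrite /clamp => xy; case: (leP x b); case: (leP y b); case: (leP a x); case: (leP a y); case: (leP a b); lra. Qed.

Lemma open_interval_itv (R : realType) (X : set R) (l r : R) : X !=set0 ->
  open X -> is_interval X -> X `<=` `]l, r[%classic ->
  exists u v, u < v /\ X = `]u, v[%classic.
Proof.
move=> [x Xx] oX iX Xlr.
have ubX : has_ubound X by exists r => y /Xlr; rewrite /= in_itv/= => /andP[_ /ltW].
have lbX : has_lbound X by exists l => y /Xlr; rewrite /= in_itv/= => /andP[/ltW].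
have XE : X = `]inf X, sup X[%classic.
  have := interval_bounded_interior iX lbX ubX.
  have /interior_id -> := oX; move=> {1}->.
  by apply/seteqP; split => y /=; rewrite in_itv.
exists (inf X), (sup X); split => //.
by move: Xx; rewrite {1}XE /= in_itv/= => /andP[/lt_trans]; apply.
Qed.

Lemma lebesgue_stieltjes_oc (R : realType) (F : cumulative R R) (l r : R) : l <= r ->
  lebesgue_stieltjes_measure F `]l, r]%classic = (F r - F l)%:E.
Proof.
move=> lr; rewrite /lebesgue_stieltjes_measure/= /measure_extension/=.
rewrite measurable_mu_extE/=; last exact: is_ocitv.
by rewrite wlength_itv_bnd.
Qed.

Lemma disj_itv_oo (R : realType) (i j : R * R) : i.1 < i.2 -> j.1 < j.2 ->
  `]i.1, i.2[%classic `&` `]j.1, j.2[%classic = set0 -> disj_itv i j.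
Proof.
move=> i12 j12 ij; rewrite /disj_itv; apply: contraT; rewrite negb_or -!ltNge => /andP[h1 h2].
have : set0 ((Num.max i.1 j.1 + Num.min i.2 j.2) / 2).
  rewrite -ij /= !in_itv/=.
  by case: (leP i.1 j.1); case: (leP i.2 j.2) => ? ?; split; apply/andP; split; lra.
by [].
Qed.

(** * Nondecreasing absolutely continuous functions as integrals *)

Section abs_cont_nondecreasing.
Variables (R : realType) (a b : R) (T : R -> R).
Hypotheses (ab : a <= b) (ndT : {in `[a, b] &, {homo T : x y / x <= y}})
  (acT : abs_cont_seq a b T).
Let F x := T (clamp a b x).
Let mu := @lebesgue_measure R.

Let F_nd : {homo F : x y / x <= y}.
Proof.
move=> x y xy; apply: ndT; rewrite ?in_itv/=; last exact: clamp_homo.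
- by apply/andP; exact: clamp_itv.
- by apply/andP; exact: clamp_itv.
Qed.

Let acF (e : R) : 0 < e -> exists2 d : R, 0 < d &
    forall s : seq (R * R), all (fun i => i.1 <= i.2) s ->
      pairwise (@disj_itv R) s -> itv_sum s < d -> var_sum F s < e.
Proof.
move=> e0; have [d d0 H] := acT e0; exists d => // s sle sd slt.
pose c (i : R * R) := (clamp a b i.1, clamp a b i.2).
have -> : var_sum F s = var_sum T (map c s) by rewrite /var_sum big_map.
apply: H.
- rewrite all_map; apply: sub_all sle => i i12; rewrite /itv_in/= (clamp_homo a b i12) /=.
  by have [-> _] := clamp_itv i.1 ab; have [_ ->] := clamp_itv i.2 ab.
- rewrite pairwise_map; apply: sub_pairwise sd => i j /orP[h|h]; rewrite /disj_itv/=;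
  by rewrite (clamp_homo a b h) ?orbT.
- apply: le_lt_trans slt; rewrite /itv_sum big_map !big_seq.
  by apply: ler_sum => i /(allP sle) h; exact: clamp_lip.
Qed.

Let F_rc : right_continuous F.
Proof.
apply: right_continuousW => x; apply/cvgrPdist_lt => e e0.
have [d d0 H] := acF e0.
near=> y.
have yd : `|x - y| < d by near: y; exact: cvgr_dist_lt.
have [xy|/ltW yx] := leP x y.
- have := H [:: (x, y)]; rewrite /= xy/= /itv_sum /var_sum !big_seq1/= distrC.
  by move=> ->//; rewrite -(ger0_norm (_ : 0 <= y - x)) ?subr_ge0// distrC.
- have := H [:: (y, x)]; rewrite /= yx/= /itv_sum /var_sum !big_seq1/=.
  by move=> ->//; rewrite -(ger0_norm (_ : 0 <= x - y)) ?subr_ge0.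
Unshelve. all: by end_near. Qed.

HB.instance Definition _ := isCumulative.Build R _ R F F_nd F_rc.

Let nu := lebesgue_stieltjes_measure F.

(** Absolute continuity speaks of finitely many intervals only. An open set is the countable union
    of its component intervals; every finite part has small [nu]-mass, hence so has the sum.
    Boundedness of [U] gives the components real endpoints. *)
Let nu_oo (e : R) : 0 < e -> exists2 d : R, 0 < d &
  forall (U : set R) (l r : R), open U -> U `<=` `]l, r[%classic -> (mu U < d%:E)%E ->
  (nu U <= e%:E)%E.
Proof.
move=> e0; have [d d0 H] := acF e0; exists d => // U l r oU Ulr Ud.
pose I := open_disjoint_itv oU.
have UI : U = \bigcup_q I q := open_disjoint_itv_bigcup oU.
have IU q : I q `<=` U by move=> x Ix; rewrite UI; exists q.
have tI : trivIset setT I := open_disjoint_itv_trivIset (oU := oU).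
have mI q : measurable (I q) by apply: open_measurable; exact: open_disjoint_itv_open.
have /choice[j Hj] q : exists j : R * R, I q !=set0 ->
    j.1 < j.2 /\ I q = `]j.1, j.2[%classic.
  have [Iq0|nIq] := pselect (I q !=set0); last by exists (0, 0).
  have [u [v [uv E]]] := open_interval_itv Iq0 (@open_disjoint_itv_open _ _ oU q)
    (@open_disjoint_itv_is_interval _ _ oU q) (subset_trans (IU q) Ulr).
  by exists (u, v).
have sumI (m : {measure set (measurableTypeR R) -> \bar R}) :
    (m U = \sum_(q <oo) m (I q))%E.
  by rewrite [in LHS]UI measure_semi_bigcup//; exact: bigcupT_measurable.
have -> : (nu U = \sum_(q <oo) nu (I q))%E by exact: (sumI (lebesgue_stieltjes_measure F)).
apply: lime_le; first exact: is_cvg_nneseries.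
apply: nearW => n /=.
(* Empty components are left out, since [j] says nothing about them. *)
pose s := [seq j q | q <- iota 0 n & `[< I q !=set0 >]].
have Ss G : (G set0 = 0)%E -> (\sum_(0 <= q < n) G (I q) =
    \sum_(q <- iota 0 n | `[< I q !=set0 >]) G (I q) :> \bar R)%E.
  move=> G0; rewrite /index_iota subn0 [RHS]big_mkcond/=; apply: eq_bigr => q _.
  by case: asboolP => // /set0P/negP/negPn/eqP ->.
have sle : all (fun i : R * R => i.1 <= i.2) s.
  apply/allP => _ /mapP[q + ->]; rewrite mem_filter => /andP[/asboolP/Hj[/ltW]] //.
have sd : pairwise (@disj_itv R) s.
  rewrite pairwise_map; apply/(pairwiseP 0%N) => x y; rewrite !inE => xs ys xy /=.
  set q := nth _ _ x; set q' := nth _ _ y.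
  have uf : uniq [seq q <- iota 0 n | `[< I q !=set0 >]] by rewrite filter_uniq// iota_uniq.
  have qq' : q != q' by rewrite nth_uniq// neq_ltn xy.
  have : q \in [seq q <- iota 0 n | `[< I q !=set0 >]] by exact: mem_nth.
  rewrite mem_filter => /andP[/asboolP/Hj[q12 qE] _].
  have : q' \in [seq q <- iota 0 n | `[< I q !=set0 >]] by exact: mem_nth.
  rewrite mem_filter => /andP[/asboolP/Hj[q12' qE'] _].
  apply: disj_itv_oo => //; rewrite -qE -qE'.
  by move/trivIsetP: tI; exact.
have slt : itv_sum s < d.
  rewrite -lte_fin; apply: le_lt_trans Ud.
  rewrite /itv_sum big_map big_filter -sumEFin.
  have -> : (mu U = \sum_(q <oo) mu (I q))%E by exact: (sumI (@lebesgue_measure R)).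
  apply: le_trans (nneseries_lim_ge n _); last by [].
  rewrite (Ss mu); last exact: measure0.
  apply: lee_sum => q /asboolP/Hj[q12 ->].
  by rewrite /mu lebesgue_measure_itv/= lte_fin q12 EFinB.
have := ltW (H s sle sd slt); rewrite -lee_fin; apply: le_trans.
rewrite (Ss nu); last exact: measure0.
rewrite /var_sum big_map big_filter -sumEFin; apply: lee_sum => q /asboolP/Hj[q12 ->].
apply: (@le_trans _ _ (nu `]((j q).1), ((j q).2)]%classic)).
  by apply: le_measure; rewrite ?inE//; apply: subset_itvl; rewrite bnd_simp.
have -> : nu `]((j q).1), ((j q).2)]%classic = (F (j q).2 - F (j q).1)%:E.
  exact: lebesgue_stieltjes_oc (ltW q12).
by rewrite lee_fin ler_norm.
Qed.

Let D : set (measurableTypeR R) := `]a, b]%classic.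
Let mD : measurable D. Proof. exact: measurable_itv. Qed.
Let nuD : (nu D < +oo)%E.
Proof. by rewrite /nu lebesgue_stieltjes_oc// ltry. Qed.

(** Outer regularity encloses a Lebesgue null set in an open set of small length; intersecting with
    []a - 1, b + 1[] makes that set bounded, as [nu_oo] requires. *)
Let nuD_dom : mfrestr mD nuD `<< mu.
Proof.
apply/null_content_dominatesP => A mA muA.
apply/eqP; rewrite eq_le measure_ge0 andbT /mfrestr/= /mrestr/=.
apply/lee_addgt0Pr => e e0; rewrite add0e.
have [d d0 H] := nu_oo e0.
have mAD : measurable (A `&` D) by exact: measurableI.
have muAD : mu (A `&` D) = 0%E.
  by apply/eqP; rewrite eq_le measure_ge0 andbT -muA le_measure ?inE//; exact: subIsetl.
have [|//|U [oU ADU Ud]] := @lebesgue_regularity_outer R (A `&` D) d mAD.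
  by rewrite [X in (X < _)%E]muAD.
have oV : open (U `&` `]a - 1, b + 1[%classic).
  by apply: openI => //; exact: interval_open.
apply: (@le_trans _ _ (nu (U `&` `]a - 1, b + 1[%classic))).
  apply: le_measure; rewrite ?inE//; first exact: open_measurable.
  move=> x [Ax Dx]; split; first exact: ADU.
  by move: Dx; rewrite /D /= !in_itv/= => /andP[? ?]; apply/andP; split; lra.
apply: (H _ (a - 1) (b + 1)) => //.
have mU : measurable U by exact: open_measurable.
apply: (@le_lt_trans _ _ (mu U)).
  by apply: le_measure; rewrite ?inE//; exact: open_measurable.
have -> : U = (U `\` (A `&` D)) `|` (A `&` D).
  by rewrite setUC setDUK.
apply: le_lt_trans (measureU2 _ _ _) _ => //; first exact: measurableD.
by rewrite [X in (_ + X < _)%E]muAD adde0.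
Qed.

(** [h] is the Radon-Nikodym density of the Stieltjes measure of [T], restricted to []a, b]] so as
    to be finite. *)
Lemma nondecreasing_abs_cont_integral : exists h : R -> R,
  mu.-integrable setT (EFin \o h) /\
  forall x, a <= x <= b -> T x = T a + \int[mu]_(t in `[a, x]) h t.
Proof.
have [f [f0 ffin fint fE]] := @radon_nikodym_sigma_finite _ _ _ mu (mfrestr mD nuD : {finite_measure set (measurableTypeR R) -> \bar R}) nuD_dom.
have intf : mu.-integrable setT (EFin \o (fine \o f)).
  by apply: eq_integrable fint => //= x _; rewrite fineK.
exists (fine \o f); split => //.
move=> x /andP[ax xb].
rewrite -Rintegral_itv_obnd_cbnd; last first.
  exact: integrableS intf.
rewrite /Rintegral (_ : \int[mu]_(t in `]a, x]) (((fine \o f) t)%:E) = nu `]a, x]%classic)%E; last first.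
  under eq_integral do rewrite /= fineK//.
  rewrite -fE//= /mfrestr/= /mrestr/= setIidl//.
  by apply: subset_itvl; rewrite bnd_simp.
rewrite /nu lebesgue_stieltjes_oc//= /F !clamp_id//; first ring.
Qed.

End abs_cont_nondecreasing.

(** Jordan decomposition: [F] is its variation function [TVf a x F] minus [TVf a x F - F x], and
    both are nondecreasing and absolutely continuous. *)
Lemma abs_cont_integral (R : realType) (a b : R) (F : R -> R) : a <= b ->
  abs_cont a b (F : R -> R^o) -> exists h : R -> R,
  (@lebesgue_measure R).-integrable setT (EFin \o h) /\
  forall x, a <= x <= b -> F x = F a + \int[@lebesgue_measure R]_(t in `[a, x]) h t.
Proof.
move=> ab /abs_cont_seqP acF.
have bv := abs_cont_bounded_variation ab acF.
have acT := abs_cont_seq_TVf acF.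
pose T2 x := TVf a x F - F x.
have TVge x y : a <= x -> x <= y -> y <= b -> `|F y - F x| <= TVf a y F - TVf a x F.
  move=> ax xy yb; rewrite (TVfD bv (lexx a) ax xy yb) addrAC subrr add0r -lee_fin.
  by rewrite (TVfE bv ax xy yb) total_variation_ge.
have acT2 : abs_cont_seq a b T2.
  move=> e e0.
  have [|d1 d10 H1] := acF (e / 2); first by lra.
  have [|d2 d20 H2] := acT (e / 2); first by lra.
  exists (Num.min d1 d2) => [|s sab sd]; first by rewrite lt_min d10.
  rewrite lt_min => /andP[/(H1 _ sab sd) h1 /(H2 _ sab sd) h2].
  rewrite (splitr e); apply: le_lt_trans (ltrD h1 h2).
  rewrite /var_sum -big_split/=; apply: ler_sum => i _.
  rewrite /T2; apply: le_trans (ler_normB _ _); rewrite le_eqVlt; apply/orP; left.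
  by rewrite distrC; apply/eqP; congr (`| _ |); ring.
have [|h1 [ih1 E1]] := nondecreasing_abs_cont_integral ab _ acT.
  move=> x y; rewrite !in_itv/= => /andP[ax xb] /andP[ay yb] xy.
  by rewrite -subr_ge0; apply: le_trans (TVge _ _ ax xy yb).
have [|h2 [ih2 E2]] := nondecreasing_abs_cont_integral ab _ acT2.
  move=> x y; rewrite !in_itv/= => /andP[ax xb] /andP[ay yb] xy.
  rewrite -subr_ge0 /T2; have := TVge _ _ ax xy yb; have := ler_norm (F y - F x); lra.
exists (h1 \- h2); split.
  by apply: eq_integrable (integrableB measurableT ih1 ih2).
move=> x axb; rewrite RintegralB//; [|exact: integrableS ih1|exact: integrableS ih2].
have := E1 x axb; have := E2 x axb; rewrite /T2; lra.
Qed.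

Lemma integral_derive1_ae (R : realType) (a b : R) (h F : R -> R) :
  (@lebesgue_measure R).-integrable setT (EFin \o h) ->
  (forall x, a <= x <= b -> F x = F a + \int[@lebesgue_measure R]_(t in `[a, x]) h t) ->
  {ae @lebesgue_measure R, forall x, x \in `]a, b[ -> derivable F x 1 /\ derive1 F x = h x}.
Proof.
move=> ih FE.
have ih' (y : R) : (@lebesgue_measure R).-integrable [set` Interval (BLeft a) (BRight y)] (EFin \o h).
  exact: integrableS ih.
have lh : locally_integrable setT h by apply: open_integrable_locally => //; exact: openT.
have := FTC1 ih' lh; apply: filterS; first exact: (ae_filter_ringOfSetsType (@lebesgue_measure R)).
move=> x H; rewrite in_itv/= => /andP[ax xb].
move: H; rewrite (@lte_fin R) => /(_ ax)[].
set G := (fun x : R => _) => dG GE.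
have nearE : {near x, (G + cst (F a)) =1 F}.
  near=> y; rewrite fctE/= (FE y) 1?addrC//.
  have : y \in `]a, b[ by near: y; apply: near_in_itvoo; rewrite in_itv/= ax.
  by rewrite in_itv/= => /andP[/ltW -> /ltW ->].
clearbody G; have isG : is_derive x (1 : R) G (h x) by apply: DeriveDef => //; rewrite -derive1E.
have isF : is_derive x (1 : R) F (h x + 0).
  by apply: near_eq_is_derive nearE _; exact: is_deriveD.
by split; [exact: ex_derive|rewrite derive1E derive_val addr0].
Unshelve. all: by end_near. Qed.

(** Uniform integrability: the part of [|h|] above a suitable level [N] has integral below [e / 2],
    and the part below that level contributes at most [N] times the total length. *)
Lemma integral_abs_cont (R : realType) (a b : R) (h F : R -> R) :
  (@lebesgue_measure R).-integrable `[a, b] (EFin \o h) ->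
  (forall x, a <= x <= b -> F x = F a + \int[@lebesgue_measure R]_(t in `[a, x]) h t) ->
  abs_cont a b (F : R -> R^o).
Proof.
set mu := @lebesgue_measure R => ih FE e e0.
have mh : measurable_fun `[a, b] h by apply/measurable_EFinP; exact: measurable_int ih.
have mah : measurable_fun `[a, b] (fun x => `|h x|%:E).
  by apply/measurable_EFinP; exact: measurableT_comp.
pose f_ (n : nat) (x : R) : \bar R := (`|h x| - Num.min `|h x| n%:R)%:E.
have mf n : measurable_fun `[a, b] (f_ n).
  apply/measurable_EFinP; apply: measurable_funB; first exact: measurableT_comp.
  by apply: measurable_minr => //; exact: measurableT_comp.
have f0 n x : (0 <= f_ n x)%E by rewrite lee_fin subr_ge0 ge_min lexx.
have [||||_ _] := @dominated_convergence _ _ _ mu `[a, b]%classic (measurable_itv _) f_ (cst 0%E)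
  (fun x => `|h x|%:E) mf.
- exact: measurable_cst.
- apply: aeW => x _; apply: cvg_near_cst; near=> n.
  rewrite /f_ (min_idPl _) ?subrr//; near: n; exact: nbhs_infty_ger.
- exact: integrable_norm ih.
- apply: aeW => x n _; rewrite gee0_abs// lee_fin gerBl le_min normr_ge0 ler0n//.
rewrite integral0 => /fine_cvgP[_].
move=> /cvgrPdist_lt/(_ (e / 2))[|N _ /(_ N (leqnn N))]; first by lra.
rewrite /= sub0r normrN => fN.
have {fN} fN : (\int[mu]_(x in `[a, b]) f_ N x < (e / 2)%:E)%E.
  rewrite -(@fineK _ (\int[mu]_(x in _) _)%E) ?lte_fin; first exact: le_lt_trans (ler_norm _) fN.
  rewrite ge0_fin_numE; last exact: integral_ge0.
  have /integrableP[_] := ih; apply: le_lt_trans.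
  apply: ge0_le_integral => //; first exact: (mf N).
  by move=> x _; rewrite lee_fin gerBl le_min normr_ge0 ler0n.
exists (e / 2 / N.+1%:R); first by rewrite !divr_gt0.
move=> n l r lr tI slt.
have lrS i : `]l i, r i[ `<=` `[a, b].
  have [al [_ rb]] := lr i.
  by move=> x /=; rewrite !in_itv/= => /andP[/ltW h1 /ltW h2]; rewrite (le_trans al h1) (le_trans h2 rb).
have step i : (`|F (r i) - F (l i)|%:E <= (N%:R * (r i - l i))%:E + \int[mu]_(x in `]l i, r i[) f_ N x)%E.
  have [al [lr' rb]] := lr i.
  rewrite (FE (r i)) ?rb ?(le_trans al lr')// (FE (l i)) ?al ?(le_trans lr' rb)//.
  rewrite opprD addrACA subrr add0r Rintegral_itvB//; last first.
    by apply: integrableS ih => //; apply: subset_itvl; rewrite bnd_simp.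
  rewrite -Rintegral_itv_bndo_bndc; last first.
    by apply: integrableS ih => //; apply: subset_itv; rewrite bnd_simp.
  have ihi : mu.-integrable `]l i, r i[ (EFin \o h) by exact: integrableS ih.
  apply: le_trans (_ : (\int[mu]_(x in `]l i, r i[) `|h x|%:E <= _)%E).
    rewrite EFin_normr_Rintegral//; apply: le_trans (le_abse_integral _ _ _) _ => //.
    exact: measurable_int ihi.
  rewrite -[X in (X + _)%E](_ : (\int[mu]_(x in `]l i, r i[) (N%:R)%:E = _)%E); last first.
    rewrite integral_cst//= lebesgue_measure_itv/= lte_fin.
    case: ltP => [_|rl]; first by rewrite -EFinB EFinM.
    by rewrite mule0 (_ : r i = l i) ?subrr ?mulr0//; lra.
  rewrite -ge0_integralD//; last exact: measurable_funS (mf N).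
  apply: ge0_le_integral => //.
  - by apply/measurable_EFinP; apply: measurableT_comp => //; exact: measurable_funS mh.
  - apply: emeasurable_funD => //; exact: measurable_funS (mf N).
  - move=> x _; rewrite -EFinD lee_fin; have : Num.min `|h x| N%:R <= N%:R by rewrite ge_min lexx orbT.
    by lra.
rewrite -lte_fin -sumEFin; apply: le_lt_trans (lee_sum _ (fun i _ => step i)) _.
rewrite big_split/= sumEFin -mulr_sumr (splitr e) EFinD; apply: lee_ltD => //.
- rewrite lee_fin; apply: le_trans (_ : N%:R * (e / 2 / N.+1%:R) <= _).
    by rewrite ler_wpM2l// ltW.
  rewrite mulrCA ler_piMr//; first by lra.
  by rewrite ler_pdivrMr// mul1r ler_nat.
- apply: le_lt_trans fN.
  pose I (i : 'I_n) : set (measurableTypeR R) := `]l i, r i[%classic.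
  have IS : \big[setU/set0]_(i < n) I i `<=` `[a, b].
    by rewrite -bigcup_seq => x [i _ /lrS].
  have mI i : measurable (I i) by exact: measurable_itv.
  have := @ge0_integral_bigsetU _ _ _ mu 'I_n I (f_ N) (index_enum _) mI (index_enum_uniq _).
  move=> /(_ _ _ (fun x _ => f0 N x)) <-.
  + by apply: ge0_subset_integral => //; [exact: bigsetU_measurable|exact: (mf N)].
  + exact: sub_trivIset tI.
  + exact: measurable_funS (mf N).
Unshelve. all: by end_near. Qed.

(** * Operators with a bounded symmetric inverse *)

(** The record [hilb] carries no axioms; this is a symmetric semidefinite form. Linearity is
    confined to members, because the integral of a sum splits only for integrable terms. *)
Record prehilbert (R : realType) (V : lmodType R) (H : hilb V) : Prop := Prehilbert {
  hmem0 : hmem H 0;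
  hmemP : forall a u v, hmem H u -> hmem H v -> hmem H (a *: u + v);
  ipC : forall u v, ip H u v = ip H v u;
  ipP : forall a u v w, hmem H u -> hmem H v -> hmem H w ->
    ip H (a *: u + v) w = a * ip H u w + ip H v w;
  ip_ge0 : forall u, hmem H u -> 0 <= ip H u u
}.

Section prehilbert_theory.
Variables (R : realType) (V : lmodType R) (H : hilb V).
Hypothesis gH : prehilbert H.
Implicit Types (a : R) (u v w : V).

Lemma hmemD u v : hmem H u -> hmem H v -> hmem H (u + v).
Proof. by move=> hu hv; have := hmemP gH 1 hu hv; rewrite scale1r. Qed.

Lemma hmemZ a u : hmem H u -> hmem H (a *: u).
Proof. by move=> hu; have := hmemP gH a hu (hmem0 gH); rewrite addr0. Qed.

Lemma hmemN u : hmem H u -> hmem H (- u).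
Proof. by move=> hu; rewrite -scaleN1r; exact: hmemZ. Qed.

Lemma hmemB u v : hmem H u -> hmem H v -> hmem H (u - v).
Proof. by move=> hu hv; apply: hmemD => //; exact: hmemN. Qed.

Lemma hmem_sum (I : Type) (s : seq I) (P : pred I) (F : I -> V) :
  (forall i, P i -> hmem H (F i)) -> hmem H (\sum_(i <- s | P i) F i).
Proof.
move=> h; elim/big_ind: _ => //; first exact: hmem0.
exact: hmemD.
Qed.

Lemma ipDl u v w : hmem H u -> hmem H v -> hmem H w ->
  ip H (u + v) w = ip H u w + ip H v w.
Proof. by move=> hu hv hw; have := ipP gH 1 hu hv hw; rewrite scale1r mul1r. Qed.

Lemma ip0l w : hmem H w -> ip H 0 w = 0.
Proof.
move=> hw; have := ipDl (hmem0 gH) (hmem0 gH) hw.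
by rewrite addr0 => h; apply: (addrI (ip H 0 w)); rewrite addr0 -h.
Qed.

Lemma ipZl a u w : hmem H u -> hmem H w -> ip H (a *: u) w = a * ip H u w.
Proof.
by move=> hu hw; have := ipP gH a hu (hmem0 gH) hw; rewrite !addr0 ip0l// addr0.
Qed.

Lemma ipNl u w : hmem H u -> hmem H w -> ip H (- u) w = - ip H u w.
Proof. by move=> hu hw; rewrite -scaleN1r ipZl// mulN1r. Qed.

Lemma ipBl u v w : hmem H u -> hmem H v -> hmem H w ->
  ip H (u - v) w = ip H u w - ip H v w.
Proof. by move=> hu hv hw; rewrite ipDl ?ipNl//; exact: hmemN. Qed.

Lemma ipDr u v w : hmem H u -> hmem H v -> hmem H w ->
  ip H w (u + v) = ip H w u + ip H w v.
Proof. by move=> *; rewrite ipC// ipDl// ipC// [in X in _ + X]ipC. Qed.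

Lemma ipZr a u w : hmem H u -> hmem H w -> ip H w (a *: u) = a * ip H w u.
Proof. by move=> *; rewrite ipC// ipZl// ipC. Qed.

Lemma ipBr u v w : hmem H u -> hmem H v -> hmem H w ->
  ip H w (u - v) = ip H w u - ip H w v.
Proof. by move=> *; rewrite ipC// ipBl// ipC// [in X in _ - X]ipC. Qed.

Lemma ip_suml (I : Type) (s : seq I) (F : I -> V) w :
  (forall i, hmem H (F i)) -> hmem H w ->
  ip H (\sum_(i <- s) F i) w = \sum_(i <- s) ip H (F i) w.
Proof.
move=> hF hw; elim: s => [|i s ih]; first by rewrite !big_nil ip0l.
by rewrite !big_cons ipDl ?ih//; exact: hmem_sum.
Qed.

Lemma hnorm_ge0 u : 0 <= hnorm H u. Proof. exact: sqrtr_ge0. Qed.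

Lemma hnorm_sqr u : hmem H u -> hnorm H u ^+ 2 = ip H u u.
Proof. by move=> hu; rewrite sqr_sqrtr// ip_ge0. Qed.

Lemma hnorm0 : hnorm H 0 = 0.
Proof. by rewrite /hnorm ip0l ?sqrtr0//; exact: hmem0. Qed.

Lemma hnormZ a u : hmem H u -> hnorm H (a *: u) = `|a| * hnorm H u.
Proof.
move=> hu; rewrite /hnorm ipZl ?ipZr//; last exact: hmemZ.
by rewrite mulrA -expr2 sqrtrM ?sqr_ge0// sqrtr_sqr.
Qed.

Lemma hnormN u : hmem H u -> hnorm H (- u) = hnorm H u.
Proof. by move=> hu; rewrite -scaleN1r hnormZ// normrN1 mul1r. Qed.

Lemma hnormB u v : hmem H u -> hmem H v -> hnorm H (u - v) = hnorm H (v - u).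
Proof. by move=> hu hv; rewrite -opprB hnormN//; exact: hmemB. Qed.

Lemma ip_le u v : hmem H u -> hmem H v -> `|ip H u v| <= hnorm H u * hnorm H v.
Proof.
move=> hu hv; rewrite -(@ler_pXn2r _ 2)// ?nnegrE ?mulr_ge0 ?hnorm_ge0//.
rewrite real_normK ?num_real// exprMn !hnorm_sqr//.
have P t : 0 <= ip H u u - 2 * t * ip H u v + t ^+ 2 * ip H v v.
  have hw : hmem H (u - t *: v) by apply: hmemB => //; exact: hmemZ.
  have := ip_ge0 gH hw; have htv : hmem H (t *: v) by exact: hmemZ.
  rewrite ipBl// !ipBr// !ipZl// !ipZr// (ipC gH v u); congr (0 <= _); ring.
have := ip_ge0 gH hv; rewrite le_eqVlt => /predU1P[v0|v0].
  rewrite -v0 mulr0; have [->|nuv] := eqVneq (ip H u v) 0; first by rewrite expr0n.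
  (* For [v] of norm 0 the quadratic is affine in [t], and this [t] gives it the value -1. *)
  have := P ((ip H u u + 1) / (2 * ip H u v)); rewrite -v0 mulr0 addr0.
  rewrite (_ : 2 * _ * _ = ip H u u + 1); last by field.
  by lra.
have := P (ip H u v / ip H v v).
rewrite (_ : _ + _ = ip H u u - (ip H u v) ^+ 2 / ip H v v); last first.
  by field; rewrite gt_eqF.
by rewrite subr_ge0 ler_pdivrMr.
Qed.

Lemma hnorm_tri u v : hmem H u -> hmem H v -> hnorm H (u + v) <= hnorm H u + hnorm H v.
Proof.
move=> hu hv; rewrite -(@ler_pXn2r _ 2)// ?nnegrE ?addr_ge0 ?hnorm_ge0//.
have huv := hmemD hu hv.
rewrite hnorm_sqr// ipDl// !ipDr// sqrrD !hnorm_sqr// (ipC gH v u).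
have := le_trans (ler_norm _) (ip_le hu hv); lra.
Qed.

Lemma hnorm_le_dist u v : hmem H u -> hmem H v -> hnorm H u <= hnorm H v + hnorm H (u - v).
Proof.
move=> hu hv; rewrite -{1}(subrK v u) addrC; apply: hnorm_tri => //.
exact: hmemB.
Qed.

Lemma hequiv_refl u : hequiv H u u.
Proof. by rewrite /hequiv subrr hnorm0. Qed.

Lemma hequiv_sym u v : hmem H u -> hmem H v -> hequiv H u v -> hequiv H v u.
Proof. by move=> hu hv; rewrite /hequiv hnormB. Qed.

Lemma hequiv_trans v u w : hmem H u -> hmem H v -> hmem H w ->
  hequiv H u v -> hequiv H v w -> hequiv H u w.
Proof.
move=> hu hv hw; rewrite /hequiv => uv vw; apply/eqP; rewrite eq_le hnorm_ge0 andbT.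
rewrite (_ : u - w = (u - v) + (v - w)); last by rewrite addrA subrK.
apply: le_trans (hnorm_tri _ _) _; [exact: hmemB..|].
by rewrite uv vw addr0.
Qed.

Lemma hequiv_hnorm u v : hmem H u -> hmem H v -> hequiv H u v -> hnorm H u = hnorm H v.
Proof.
move=> hu hv uv; apply/eqP; rewrite eq_le; apply/andP; split.
  by have := hnorm_le_dist hu hv; rewrite uv addr0.
by have := hnorm_le_dist hv hu; rewrite hnormB// uv addr0.
Qed.

Lemma hequivP a u u' v v' : hmem H u -> hmem H u' -> hmem H v -> hmem H v' ->
  hequiv H u u' -> hequiv H v v' -> hequiv H (a *: u + v) (a *: u' + v').
Proof.
move=> hu hu' hv hv' uu vv; rewrite /hequiv opprD addrACA -scalerBr.
have h1 := hmemB hu hu'; have h2 := hmemB hv hv'.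
apply/eqP; rewrite eq_le hnorm_ge0 andbT.
apply: le_trans (hnorm_tri (hmemZ _ h1) h2) _.
by rewrite hnormZ// uu vv mulr0 addr0.
Qed.

Lemma hequivD u u' v v' : hmem H u -> hmem H u' -> hmem H v -> hmem H v' ->
  hequiv H u u' -> hequiv H v v' -> hequiv H (u + v) (u' + v').
Proof. by move=> h1 h2 h3 h4 e1 e2; have := hequivP 1 h1 h2 h3 h4 e1 e2; rewrite !scale1r. Qed.

Lemma hequivB u u' v v' : hmem H u -> hmem H u' -> hmem H v -> hmem H v' ->
  hequiv H u u' -> hequiv H v v' -> hequiv H (u - v) (u' - v').
Proof.
move=> h1 h2 h3 h4 e1 e2; have := hequivP (-1) h3 h4 h1 h2 e2 e1.
by rewrite !scaleN1r addrC [X in hequiv _ _ X]addrC.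
Qed.

Lemma hequiv_ip u u' w : hmem H u -> hmem H u' -> hmem H w -> hequiv H u u' ->
  ip H u w = ip H u' w.
Proof.
move=> hu hu' hw uu'; apply/eqP; rewrite -subr_eq0 -ipBl// -normr_le0.
have := ip_le (hmemB hu hu') hw; rewrite /hequiv in uu'; by rewrite uu' mul0r.
Qed.

Lemma bessel_inequality (s : seq V) u : uniq s -> hmem H u ->
  (forall e, e \in s -> hmem H e) ->
  (forall e e', e \in s -> e' \in s -> ip H e e' = (e == e')%:R) ->
  \sum_(e <- s) ip H u e ^+ 2 <= ip H u u.
Proof.
move=> us hu hs os.
(* The guard makes every summand a member of [H], whatever the index, as [ip_suml] demands. *)
pose p := \sum_(e <- s) (if e \in s then ip H u e *: e else 0).
have hpe e : hmem H (if e \in s then ip H u e *: e else 0).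
  by case: ifP => [/hs he|_]; [exact: hmemZ|exact: hmem0].
have hp : hmem H p by exact: hmem_sum.
have pE e : e \in s -> ip H p e = ip H u e.
  move=> es; have he := hs _ es.
  rewrite ip_suml// (bigD1_seq e)//= [X in _ + X]big1_seq.
    by rewrite es ipZl// (os e e)// eqxx mulr1 addr0.
  by move=> e' /andP[ne e's]; have he' := hs _ e's; rewrite e's ipZl// (os e' e)// (negbTE ne) mulr0.
have S : ip H p u = \sum_(e <- s) ip H u e ^+ 2.
  rewrite ip_suml//; apply: eq_big_seq => e es; rewrite es ipZl//; last exact: hs.
  by rewrite (ipC gH e) expr2.
have pp : ip H p p = \sum_(e <- s) ip H u e ^+ 2.
  rewrite {1}/p ip_suml//; apply: eq_big_seq => e es; rewrite es ipZl//; last exact: hs.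
  by rewrite (ipC gH e) pE// expr2.
have := ip_ge0 gH (hmemB hu hp); rewrite ipBl//; last exact: hmemB.
by rewrite !ipBr// (ipC gH u p) S pp subrr subr0 subr_ge0.
Qed.

End prehilbert_theory.

(** Zorn's lemma on orthonormal sets: a vector of nonzero norm orthogonal to a maximal one could be
    normalised and added to it. *)
Lemma exists_orthonormal_basis (R : realType) (V : lmodType R) (H : hilb V) :
  prehilbert H -> exists E, orthonormal_basis H E.
Proof.
move=> gH.
pose on (E : set V) := E `<=` hmem H /\
  forall e e', E e -> E e' -> ip H e e' = (e == e')%:R.
have [F onF totF|E [[E1 E2] Emax]] := @Zorn_bigcup _ on.
  split=> [x [E /onF[/(_ x)]]//|e e' [E FE Ee] [G FG Ge']].
  have [EG|GE] := totF _ _ FE FG.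
    by apply: (onF G FG).2 => //; exact: EG.
  by apply: (onF E FE).2 => //; exact: GE.
exists E; split => // v hv vE.
apply: contrapT => v0.
have n0 : 0 < hnorm H v by rewrite lt_neqAle sqrtr_ge0 andbT eq_sym; apply/eqP.
pose w := (hnorm H v)^-1 *: v.
have hw : hmem H w by exact: hmemZ.
have ww : ip H w w = 1.
  by rewrite ipZl// ipZr// -hnorm_sqr// expr2; field; rewrite gt_eqF.
have wE e : E e -> ip H w e = 0 by move=> Ee; rewrite ipZl ?vE ?mulr0//; exact: E1.
have nwE : ~ E w by move=> /wE; rewrite ww => /eqP; rewrite oner_eq0.
have onw : on (E `|` [set w]).
  split=> [x [/E1//|->//]|e e' [Ee|->] [Ee'|->]]; first exact: E2.
  - rewrite ipC// wE//; case: eqP => // ew; by rewrite ew in Ee.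
  - rewrite wE//; case: eqP => // ew; by rewrite -ew in Ee'.
  - by rewrite eqxx ww.
apply: (Emax _ _ onw); split; first by move=> x Ex; left.
by move=> /(_ w (or_intror erefl)).
Qed.

(** An equality of vectors, stronger than one up to [hequiv]; it lets compositions and
    complexifications be computed by rewriting. *)
Definition linear_on (R : realType) (V W : lmodType R) (H : hilb V) (K : V -> W) : Prop :=
  forall a u v, hmem H u -> hmem H v -> K (a *: u + v) = a *: K u + K v.

Record bounded_op (R : realType) (V W : lmodType R) (H : hilb V) (G : hilb W)
    (K : V -> W) : Prop := BoundedOp {
  bop_linear : linear_on H K;
  bop_hmem : forall u, hmem H u -> hmem G (K u);
  bop_bound : exists2 C : R, 0 <= C & forall u, hmem H u -> hnorm G (K u) <= C * hnorm H u
}.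

Section bounded_op_theory.
Variables (R : realType) (V W : lmodType R) (H : hilb V) (G : hilb W).
Hypotheses (gH : prehilbert H) (gG : prehilbert G).
Variable K : V -> W.
Hypothesis bK : bounded_op H G K.

Lemma bopD u v : hmem H u -> hmem H v -> K (u + v) = K u + K v.
Proof. by move=> hu hv; have := bop_linear bK 1 hu hv; rewrite !scale1r. Qed.

Lemma bopB u v : hmem H u -> hmem H v -> K (u - v) = K u - K v.
Proof.
move=> hu hv; have := bop_linear bK (-1) hv hu; rewrite !scaleN1r addrC => ->.
by rewrite addrC.
Qed.

Lemma bopZ a u : hmem H u -> K (a *: u) = a *: K u.
Proof.
move=> hu; have := bop_linear bK a hu (hmem0 gH); rewrite addr0 => ->.
have := bopB hu hu; rewrite !subrr => ->; by rewrite addr0.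
Qed.

Lemma bop_hequiv u v : hmem H u -> hmem H v -> hequiv H u v -> hequiv G (K u) (K v).
Proof.
move=> hu hv uv; rewrite /hequiv -bopB//; have [C C0 h] := bop_bound bK.
apply/eqP; rewrite eq_le hnorm_ge0 andbT; apply: le_trans (h _ (hmemB gH hu hv)) _.
by rewrite uv mulr0.
Qed.

End bounded_op_theory.

Lemma subrACA (V : zmodType) (x y z t : V) : x - y - (z - t) = x - z - (y - t).
Proof. by rewrite !opprB (addrACA x (- y)) (addrACA x (- z)) (addrC (- y) (- z)). Qed.

(** * Complexification of real spaces and operators *)

Section complexification.
Variables (R : realType).

(** Multiplication of [v1 + i v2] by [z], in the form in which [op_shift] subtracts it. *)
Definition cscale (V : lmodType R) (z : R[i]) (v : V * V) : V * V :=
  (complex.Re z *: v.1 - complex.Im z *: v.2, complex.Re z *: v.2 + complex.Im z *: v.1).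

Definition cop (V W : lmodType R) (K : V -> W) (v : V * V) : W * W := (K v.1, K v.2).

Lemma cscaleD (V : lmodType R) z (u v : V * V) : cscale z (u + v) = cscale z u + cscale z v.
Proof.
rewrite /cscale; congr (_, _); rewrite /= !scalerDr; last by rewrite addrACA.
by rewrite opprD addrACA.
Qed.

Lemma cscaleM (V : lmodType R) z w (v : V * V) : cscale z (cscale w v) = cscale (z * w) v.
Proof.
case: z => a b; case: w => c d; rewrite /cscale/=; congr (_, _);
  rewrite ?scalerBr ?scalerDr ?scalerBl ?scalerDl !scalerA ?opprD ?opprB.
  by rewrite -!addrA; congr (_ + _); rewrite [RHS]addrC -!addrA.
by rewrite -!addrA; congr (_ + _); rewrite [RHS]addrC -!addrA.
Qed.

Lemma prehilbert_complexify (V : lmodType R) (H : hilb V) :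
  prehilbert H -> prehilbert (complexify H).
Proof.
move=> gH; split.
- by split; exact: hmem0.
- by move=> a u v [u1 u2] [v1 v2]; split; exact: hmemP.
- by move=> u v; rewrite /= (ipC gH u.1) (ipC gH u.2).
- by move=> a u v w [u1 u2] [v1 v2] [w1 w2]; rewrite /= !ipP//; ring.
- by move=> u [u1 u2]; rewrite addr_ge0//; exact: ip_ge0.
Qed.

Section over_H.
Variables (V : lmodType R) (H : hilb V).
Hypothesis gH : prehilbert H.

Lemma hmem_cscale z v : hmem (complexify H) v -> hmem (complexify H) (cscale z v).
Proof.
by move=> [v1 v2]; split; [apply: hmemB => //; exact: hmemZ|apply: hmemD => //; exact: hmemZ].
Qed.

Lemma hnorm_cscale z v : hmem (complexify H) v ->
  hnorm (complexify H) (cscale z v) =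
  Num.sqrt (complex.Re z ^+ 2 + complex.Im z ^+ 2) * hnorm (complexify H) v.
Proof.
move=> [v1 v2]; rewrite /hnorm -sqrtrM ?addr_ge0 ?sqr_ge0//; congr (Num.sqrt _).
have h a u : hmem H u -> hmem H (a *: u) by exact: hmemZ.
rewrite /cscale /=.
have k1 := hmemB gH (h (complex.Re z) _ v1) (h (complex.Im z) _ v2).
have k2 := hmemD gH (h (complex.Re z) _ v2) (h (complex.Im z) _ v1).
rewrite (ipBl gH)// ?(ipDl gH)// ?(ipBr gH)// ?(ipDr gH)//; try exact: h.
by rewrite !ipZl ?ipZr//; try (exact: h); rewrite (ipC gH v.2 v.1); ring.
Qed.

Lemma hequiv_complexify u v : hmem (complexify H) u -> hmem (complexify H) v ->
  hequiv (complexify H) u v <-> hequiv H u.1 v.1 /\ hequiv H u.2 v.2.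
Proof.
move=> [u1 u2] [v1 v2]; rewrite /hequiv /hnorm /=.
have h1 := ip_ge0 gH (hmemB gH u1 v1); have h2 := ip_ge0 gH (hmemB gH u2 v2).
split=> [/eqP|[]].
  rewrite sqrtr_eq0 => h.
  by split; apply/eqP; rewrite sqrtr_eq0; lra.
move=> /eqP; rewrite sqrtr_eq0 => h3 /eqP; rewrite sqrtr_eq0 => h4.
by apply/eqP; rewrite sqrtr_eq0; lra.
Qed.

Lemma bounded_cscale z : bounded_op (complexify H) (complexify H) (cscale z).
Proof.
split.
- move=> a u v _ _; rewrite cscaleD; congr (_ + _); rewrite /cscale; congr (_, _) => /=.
    by rewrite scalerBr !scalerA mulrC (mulrC a (complex.Im z)).
  by rewrite scalerDr !scalerA mulrC (mulrC a (complex.Im z)).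
- exact: hmem_cscale.
- exists (Num.sqrt (complex.Re z ^+ 2 + complex.Im z ^+ 2)); first exact: sqrtr_ge0.
  by move=> u hu; rewrite hnorm_cscale.
Qed.

Lemma hequiv_cscale z u v : hmem (complexify H) u -> hmem (complexify H) v ->
  hequiv (complexify H) u v -> hequiv (complexify H) (cscale z u) (cscale z v).
Proof. have gC := prehilbert_complexify gH.
by move=> hu hv; exact: (bop_hequiv gC (bounded_cscale z)). Qed.

End over_H.

Lemma bounded_cop (V W : lmodType R) (H : hilb V) (G : hilb W) (K : V -> W) :
  prehilbert H -> prehilbert G ->
  bounded_op H G K -> bounded_op (complexify H) (complexify G) (cop K).
Proof.
move=> gH gG bK; split.
- by move=> a u v [u1 u2] [v1 v2]; rewrite /cop /= !(bop_linear bK).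
- by move=> u [u1 u2]; split; exact: (bop_hmem bK).
- have [C C0 h] := bop_bound bK; exists C => // u [u1 u2].
  rewrite -(@ler_pXn2r _ 2)// ?nnegrE ?mulr_ge0 ?hnorm_ge0//.
  rewrite exprMn !hnorm_sqr//=; try exact: prehilbert_complexify.
  2: by split; exact: (bop_hmem bK).
  rewrite mulrDr -!hnorm_sqr//; try exact: (bop_hmem bK).
  by rewrite -!exprMn lerD// lerXn2r// ?nnegrE ?mulr_ge0 ?hnorm_ge0//; exact: h.
Qed.

Lemma cop_cscale (V W : lmodType R) (H : hilb V) (G : hilb W) (K : V -> W) z v :
  prehilbert H -> bounded_op H G K -> hmem (complexify H) v ->
  cop K (cscale z v) = cscale z (cop K v).
Proof.
move=> gH bK [v1 v2]; have h a u : hmem H u -> hmem H (a *: u) by exact: hmemZ.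
rewrite /cop /cscale /= (bopB bK)//; try exact: h.
by rewrite (bopD bK)//; try (exact: h); rewrite !(bopZ gH bK).
Qed.

End complexification.

(** Bounded invertibility of [1 - z K] on the complexification, as surjectivity with a lower bound.
    No inverse map is named, so the condition moves easily between spaces whose vectors match only
    up to [hequiv]. *)
Definition solvable_at (R : realType) (V : lmodType R) (H : hilb V) (K : V -> V)
    (z : R[i]) : Prop :=
  exists C : R,
    (forall f, hmem (complexify H) f -> exists2 u, hmem (complexify H) u &
       hequiv (complexify H) (u - cscale z (cop K u)) f) /\
    (forall u, hmem (complexify H) u ->
       hnorm (complexify H) u <= C * hnorm (complexify H) (u - cscale z (cop K u))).

(** [K w] is itself a representative in the domain, whereas a general [v] of the domain agrees with
    [K w] only up to norm 0: for the operators below its values off the interval are free. *)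
Record inverse_of (R : realType) (V : lmodType R) (H : hilb V) (A : oper V)
    (K : V -> V) : Prop := InverseOf {
  inv_bounded : bounded_op H H K;
  inv_left : forall v w, A v w -> [/\ hmem H v, hmem H w & hequiv H v (K w)];
  inv_right : forall w, hmem H w -> A (K w) w
}.

Section inverse_theory.
Variables (R : realType) (V : lmodType R) (H : hilb V).
Hypothesis gH : prehilbert H.
Variables (A : oper V) (K : V -> V).
Hypothesis AK : inverse_of H A K.

Let bK := inv_bounded AK.
Let hK u : hmem H u -> hmem H (K u). Proof. exact: bop_hmem bK u. Qed.

Lemma inverse_bounded_inverse : bounded_inverse H A K.
Proof.
split.
- exact: hK.
- by have [C C0 h] := bop_bound bK; exists C.
- by move=> f hf; exists (K f), f; split; [exact: (inv_right AK)|exact: hequiv_refl|exact: hequiv_refl].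
- by move=> v w /(inv_left AK)[hv hw e]; apply: hequiv_sym => //; exact: hK.
Qed.

(** Testing a pair [(f, g)] of the adjoint graph on [v = K w] shows that [f - K g] is orthogonal to
    every [w], hence to itself. *)
Lemma inverse_self_adjoint :
  (forall u v, hmem H u -> hmem H v -> ip H (K u) v = ip H u (K v)) ->
  dense_dom H A -> self_adjoint H A.
Proof.
move=> sK dA; split => //.
  by move=> v w /(inv_left AK)[].
move=> f g hf hg; split=> [h|[v [w [Avw fv gw]]] v' w' Avw'].
- have E w : hmem H w -> ip H w (f - K g) = 0.
    move=> hw; rewrite ipBr//; last exact: hK.
    by rewrite (h _ _ (inv_right AK hw)) sK// subrr.
  exists (K g), g; split; [exact: (inv_right AK)| |exact: hequiv_refl].
  rewrite /hequiv /hnorm E ?sqrtr0//; apply: hmemB => //; exact: hK.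
- have [hv hw vK] := inv_left AK Avw; have [hv' hw' vK'] := inv_left AK Avw'.
  rewrite (ipC gH w' f) (hequiv_ip gH hf hv hw' fv) (hequiv_ip gH hv (hK hw) hw' vK).
  rewrite sK// (hequiv_ip gH hv' (hK hw') hg vK') (ipC gH _ g).
  rewrite (hequiv_ip gH hg hw (hK hw') gw); by [].
Qed.

(** On the domain [A - z = (1 - z K) A], so the resolvent is [K (1 - z K)^-1]; conversely
    [(1 - z K)^-1 = 1 + z (A - z)^-1]. *)
Lemma spec_solvable_at z : spec H A z <-> ~ solvable_at H K z.
Proof.
have gC := prehilbert_complexify gH.
have bC := bounded_cop gH gH bK.
have bZ := bounded_cscale gH z.
have hC := bop_hmem bC; have hZ := bop_hmem bZ.
have eC := bop_hequiv gC bC; have eZ := bop_hequiv gC bZ.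
have shiftP v u : op_shift A z v u -> exists w, [/\ hmem (complexify H) v,
    hmem (complexify H) w, hequiv (complexify H) v (cop K w) & u = w - cscale z v].
  move=> [w1 [w2 [/(inv_left AK)[h1 h2 h3] /(inv_left AK)[h4 h5 h6] ->]]].
  exists (w1, w2); split => //; apply/hequiv_complexify => //.
  by split; exact: hK.
have shiftI u : hmem (complexify H) u -> op_shift A z (cop K u) (u - cscale z (cop K u)).
  by case: u => u1 u2 [h1 h2]; exists u1, u2; split => //; exact: (inv_right AK).
rewrite /spec /=; split; apply: contra_not.
- move=> [C [ex bd]].
  pose Cm := Num.max C 0.
  have {}bd u : hmem (complexify H) u ->
      hnorm (complexify H) u <= Cm * hnorm (complexify H) (u - cscale z (cop K u)).
    move=> hu; apply: le_trans (bd u hu) _; rewrite ler_wpM2r ?hnorm_ge0//.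
    by rewrite le_max lexx.
  have uniq u v : hmem (complexify H) u -> hmem (complexify H) v ->
      hequiv (complexify H) (u - cscale z (cop K u)) (v - cscale z (cop K v)) ->
      hequiv (complexify H) u v.
    move=> hu hv e; have huv := hmemB gC hu hv.
    apply/eqP; rewrite eq_le hnorm_ge0 andbT; apply: le_trans (bd _ huv) _.
    rewrite (bopB bC)// (bopB bZ); [|exact: hC|exact: hC].
    by rewrite subrACA e mulr0.
  have /choice[T HT] f : exists Tf, hmem (complexify H) f -> hmem (complexify H) Tf /\
      hequiv (complexify H) (Tf - cscale z (cop K Tf)) f.
    have [hf|nf] := pselect (hmem (complexify H) f); last by exists 0.
    by have [u hu e] := ex f hf; exists u.
  exists (cop K \o T); split => /=.
  + by move=> f /HT[hT _]; exact: hC.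
  + have [D D0 hD] := bop_bound bC; exists (D * Cm) => f hf; have [hT e] := HT f hf.
    apply: le_trans (hD _ hT) _; rewrite -mulrA ler_wpM2l//.
    apply: le_trans (bd _ hT) _; rewrite (hequiv_hnorm gC _ hf e)//.
    by apply: hmemB => //; apply: hZ; exact: hC.
  + move=> f hf; have [hT e] := HT f hf.
    exists (cop K (T f)), (T f - cscale z (cop K (T f))); split.
    * exact: shiftI.
    * exact: hequiv_refl.
    * by apply: hequiv_sym => //; apply: hmemB => //; apply: hZ; exact: hC.
  + move=> v u /shiftP[w [hv hw vw uE]].
    have hu : hmem (complexify H) u by rewrite uE; apply: hmemB => //; exact: hZ.
    have [hT e] := HT u hu.
    have hKw := hC _ hw.
    have Tw : hequiv (complexify H) (T u) w.
      apply: uniq => //; apply: (hequiv_trans gC _ hu) => //.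
      * by apply: hmemB => //; apply: hZ; exact: hC.
      * by apply: hmemB => //; apply: hZ.
      * rewrite uE; apply: hequivB => //; try exact: hZ.
        - exact: hequiv_refl.
        - exact: eZ.
    apply: (hequiv_trans gC _ hKw hv) => //; first exact: hC.
    - exact: eC.
    - exact: hequiv_sym.
- move=> [T [T1 [C T2] T3 T4]].
  have C' f : hmem (complexify H) f -> hnorm (complexify H) (T f) <= Num.max C 0 * hnorm (complexify H) f.
    move=> hf; apply: le_trans (T2 f hf) _; rewrite ler_wpM2r ?hnorm_ge0//.
    by rewrite le_max lexx.
  have [D D0 hD] := bop_bound bZ.
  exists (1 + D * Num.max C 0); split=> [f hf|u hu].
  + have hT := T1 f hf; have hu : hmem (complexify H) (f + cscale z (T f)).
      by apply: hmemD => //; exact: hZ.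
    exists (f + cscale z (T f)) => //.
    have [v [w [/shiftP[g [hv hg vg wE]] Tv fw]]] := T3 f hf.
    have hw : hmem (complexify H) w by rewrite wE; apply: hmemB => //; exact: hZ.
    have ug : hequiv (complexify H) (f + cscale z (T f)) g.
      rewrite -(subrK (cscale z v) g) -wE; apply: hequivD => //; try exact: hZ.
      exact: eZ.
    have hCg := hC _ hg; have hCu := hC _ hu.
    apply: (hequiv_trans gC _ hw) => //.
      by apply: hmemB => //; exact: hZ.
      rewrite wE; apply: hequivB => //; try exact: hZ.
      apply: eZ => //; apply: (hequiv_trans gC _ hCg) => //; first exact: eC.
      exact: hequiv_sym.
    exact: hequiv_sym.
  + pose f := u - cscale z (cop K u).
    have hKu := hC _ hu.
    have hf : hmem (complexify H) f by apply: hmemB => //; exact: hZ.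
    have sh : op_shift A z (cop K u) f by exact: shiftI.
    have e := T4 _ _ sh.
    have uE : u = f + cscale z (cop K u) by rewrite subrK.
    rewrite [in leLHS]uE; apply: le_trans (hnorm_tri gC hf (hZ _ hKu)) _.
    rewrite -/f mulrDl mul1r lerD2l; apply: le_trans (hD _ hKu) _.
    rewrite -mulrA ler_wpM2l// -(hequiv_hnorm gC (T1 _ hf) hKu e).
    exact: C'.
Qed.

End inverse_theory.

(** [solvable_at H K z] is by conversion this property for the operator [z K] on [complexify H]. *)
Definition invertible_1B (R : realType) (V : lmodType R) (H : hilb V) (L : V -> V) : Prop :=
  exists C : R,
    (forall f, hmem H f -> exists2 u, hmem H u & hequiv H (u - L u) f) /\
    (forall u, hmem H u -> hnorm H u <= C * hnorm H (u - L u)).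

Lemma invertible_1B_bound (R : realType) (V : lmodType R) (H : hilb V) (L : V -> V) :
  invertible_1B H L -> exists2 C : R, 0 <= C &
    (forall f, hmem H f -> exists2 u, hmem H u & hequiv H (u - L u) f) /\
    (forall u, hmem H u -> hnorm H u <= C * hnorm H (u - L u)).
Proof.
move=> [C [ex bd]]; exists (Num.max C 0); first by rewrite le_max lexx orbT.
split => // u hu; apply: le_trans (bd u hu) _; rewrite ler_wpM2r ?sqrtr_ge0//.
by rewrite le_max lexx.
Qed.

(** An orthogonal sum given by maps, since column-valued functions are not literally pairs of
    functions. *)
Record hilb_split (R : realType) (V V1 V2 : lmodType R) (H : hilb V) (H1 : hilb V1)
    (H2 : hilb V2) (pr1 : V -> V1) (pr2 : V -> V2) (mk : V1 -> V2 -> V) : Prop :=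
  HilbSplit {
  pr1P : forall a u v, pr1 (a *: u + v) = a *: pr1 u + pr1 v;
  pr2P : forall a u v, pr2 (a *: u + v) = a *: pr2 u + pr2 v;
  pr1K : forall u v, pr1 (mk u v) = u;
  pr2K : forall u v, pr2 (mk u v) = v;
  hmem_split : forall v, hmem H v <-> hmem H1 (pr1 v) /\ hmem H2 (pr2 v);
  ip_split : forall u v, hmem H u -> hmem H v ->
    ip H u v = ip H1 (pr1 u) (pr1 v) + ip H2 (pr2 u) (pr2 v)
}.

Lemma hilb_split_complexify (R : realType) (V V1 V2 : lmodType R) (H : hilb V)
    (H1 : hilb V1) (H2 : hilb V2) (pr1 : V -> V1) (pr2 : V -> V2) (mk : V1 -> V2 -> V) :
  hilb_split H H1 H2 pr1 pr2 mk ->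
  hilb_split (complexify H) (complexify H1) (complexify H2) (cop pr1) (cop pr2)
    (fun u v => (mk u.1 v.1, mk u.2 v.2)).
Proof.
move=> sp; split.
- by move=> a u v; rewrite /cop /= !(pr1P sp).
- by move=> a u v; rewrite /cop /= !(pr2P sp).
- by move=> [u1 u2] v; rewrite /cop /= !(pr1K sp).
- by move=> u [v1 v2]; rewrite /cop /= !(pr2K sp).
- move=> [v1 v2]; split=> [[/=/(hmem_split sp)[? ?] /(hmem_split sp)[? ?]]|[[/= ? ?] [/= ? ?]]] //.
  by split; apply/(hmem_split sp).
- by move=> u v [u1 u2] [v1 v2]; rewrite /= !(ip_split sp)//; ring.
Qed.

(** * Elimination of one component *)

Section block.
Variables (R : realType) (V V1 V2 : lmodType R) (H : hilb V) (H1 : hilb V1)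
  (H2 : hilb V2) (pr1 : V -> V1) (pr2 : V -> V2) (mk : V1 -> V2 -> V).
Hypotheses (gH : prehilbert H) (gH1 : prehilbert H1) (gH2 : prehilbert H2).
Hypothesis sp : hilb_split H H1 H2 pr1 pr2 mk.

Lemma pr1B u v : pr1 (u - v) = pr1 u - pr1 v.
Proof. by have := pr1P sp (-1) v u; rewrite !scaleN1r addrC => ->; rewrite addrC. Qed.

Lemma pr2B u v : pr2 (u - v) = pr2 u - pr2 v.
Proof. by have := pr2P sp (-1) v u; rewrite !scaleN1r addrC => ->; rewrite addrC. Qed.

Lemma hnorm_split v : hmem H v -> hnorm H v ^+ 2 = hnorm H1 (pr1 v) ^+ 2 + hnorm H2 (pr2 v) ^+ 2.
Proof.
move=> hv; have [h1 h2] := (hmem_split sp v).1 hv.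
by rewrite !hnorm_sqr// (ip_split sp).
Qed.

Lemma hnorm_pr1 v : hmem H v -> hnorm H1 (pr1 v) <= hnorm H v.
Proof.
move=> hv; rewrite -(@ler_pXn2r _ 2)// ?nnegrE ?hnorm_ge0//.
by rewrite hnorm_split// lerDl sqr_ge0.
Qed.

Lemma hnorm_pr2 v : hmem H v -> hnorm H2 (pr2 v) <= hnorm H v.
Proof.
move=> hv; rewrite -(@ler_pXn2r _ 2)// ?nnegrE ?hnorm_ge0//.
by rewrite hnorm_split// lerDr sqr_ge0.
Qed.

Lemma hnorm_le_split v : hmem H v -> hnorm H v <= hnorm H1 (pr1 v) + hnorm H2 (pr2 v).
Proof.
move=> hv; rewrite -(@ler_pXn2r _ 2)// ?nnegrE ?addr_ge0 ?hnorm_ge0//.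
rewrite hnorm_split// sqrrD.
have := mulr_ge0 (hnorm_ge0 H1 (pr1 v)) (hnorm_ge0 H2 (pr2 v)); lra.
Qed.

Lemma hequiv_split u v : hmem H u -> hmem H v ->
  hequiv H u v <-> hequiv H1 (pr1 u) (pr1 v) /\ hequiv H2 (pr2 u) (pr2 v).
Proof.
move=> hu hv; have hw := hmemB gH hu hv; rewrite /hequiv -pr1B -pr2B; split=> [h|[h1 h2]].
  split; apply/eqP; rewrite eq_le hnorm_ge0 andbT -h; [exact: hnorm_pr1|exact: hnorm_pr2].
apply/eqP; rewrite eq_le hnorm_ge0 andbT; apply: le_trans (hnorm_le_split hw) _.
by rewrite h1 h2 addr0.
Qed.

Variables (L : V -> V) (L12 : V2 -> V1) (L21 : V1 -> V2).
Hypotheses (bL12 : bounded_op H2 H1 L12) (bL21 : bounded_op H1 H2 L21).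
Hypotheses (L1 : forall v, hmem H v -> pr1 (L v) = L12 (pr2 v))
  (L2 : forall v, hmem H v -> pr2 (L v) = L21 (pr1 v)).

Let hL12 u : hmem H2 u -> hmem H1 (L12 u). Proof. exact: bop_hmem bL12 u. Qed.
Let hL21 u : hmem H1 u -> hmem H2 (L21 u). Proof. exact: bop_hmem bL21 u. Qed.

Let hmk u v : hmem H1 u -> hmem H2 v -> hmem H (mk u v).
Proof. by move=> hu hv; apply/(hmem_split sp); rewrite (pr1K sp) (pr2K sp). Qed.

Let hL u : hmem H u -> hmem H (L u).
Proof.
move=> hu; have [h1 h2] := (hmem_split sp u).1 hu; apply/(hmem_split sp).
by rewrite L1// L2//; split; [exact: hL12|exact: hL21].
Qed.

Let p1 u : hmem H u -> pr1 (u - L u) = pr1 u - L12 (pr2 u).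
Proof. by move=> hu; rewrite pr1B L1. Qed.

Let p2 u : hmem H u -> pr2 (u - L u) = pr2 u - L21 (pr1 u).
Proof. by move=> hu; rewrite pr2B L2. Qed.

(** Schur complement: [1 - L] maps [(u1, u2)] to [(u1 - L12 u2, u2 - L21 u1)], and eliminating [u2]
    leaves [(1 - L12 L21) u1 = f1 + L12 f2]. *)
Lemma block_invertible : invertible_1B H L <-> invertible_1B H1 (L12 \o L21).
Proof.
have h0 := hmem0 gH2.
split=> /invertible_1B_bound[C C0 [ex bd]].
- exists C; split=> [f hf|u hu] /=.
  (* With right-hand side [(f, 0)] the second component forces [u2 = L21 u1]. *)
  + have [u hu e] := ex _ (hmk hf h0); have [h1 h2] := (hmem_split sp u).1 hu.
    move: e => /(hequiv_split (hmemB gH hu (hL hu)) (hmk hf h0))[].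
    rewrite p1// p2// (pr1K sp) (pr2K sp) => e1 e2; exists (pr1 u) => //.
    have e3 : hequiv H2 (L21 (pr1 u)) (pr2 u).
      apply: hequiv_sym => //; first exact: hL21.
      by move: e2; rewrite /hequiv subr0.
    apply: (hequiv_trans gH1 _ (hmemB gH1 h1 (hL12 h2))) => //.
      by apply: hmemB => //; apply: hL12; exact: hL21.
    apply: hequivB => //; try exact: hL12; try (apply: hL12; exact: hL21).
      exact: hequiv_refl.
    by apply: (bop_hequiv gH2 bL12) => //; exact: hL21.
  (* [1 - L] sends [(u, L21 u)] to [(u - L12 L21 u, 0)], so its lower bound restricts to that of the
     Schur complement. *)
  + have hm := hmk hu (hL21 hu); have := bd _ hm.
    have hLm := hL hm.
    have := hnorm_le_split (hmemB gH hm hLm); rewrite p1// p2// (pr1K sp) (pr2K sp).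
    rewrite subrr (hnorm0 gH2) addr0 => h1 h2.
    have := hnorm_pr1 hm; rewrite (pr1K sp) => h3.
    by apply: le_trans h3 (le_trans h2 _); rewrite ler_wpM2l.
- have [D D0 hD] := bop_bound bL12; have [E E0 hE] := bop_bound bL21.
  (* [C * (1 + D)] bounds the first component of the solution, the remaining terms bound the second,
     which is recovered as [f2 + L21 u1]. *)
  exists (C * (1 + D) + 1 + E * (C * (1 + D))); split=> [f hf|u hu].
  + have [f1 f2] := (hmem_split sp f).1 hf.
    have [u hu /= e] := ex _ (hmemD gH1 f1 (hL12 f2)).
    have hv := hmemD gH2 f2 (hL21 hu).
    exists (mk u (pr2 f + L21 u)); first exact: hmk.
    have hm := hmk hu hv.
    apply/hequiv_split => //; first by apply: hmemB => //; exact: hL.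
    rewrite p1// p2// !(pr1K sp) !(pr2K sp); split; last first.
      by rewrite addrK; exact: hequiv_refl.
    rewrite (bopD bL12)//; last exact: hL21.
    rewrite opprD addrA addrAC.
    have hLL := hL12 (hL21 hu); have hLf := hL12 f2.
    rewrite -[X in hequiv _ _ X](addrK (L12 (pr2 f))); apply: hequivB => //.
    * exact: hmemB.
    * exact: hmemD.
    * exact: hequiv_refl.
  + have [u1 u2] := (hmem_split sp u).1 hu.
    set f := u - L u; have hf : hmem H f by apply: hmemB => //; exact: hL.
    have [f1 f2] := (hmem_split sp f).1 hf.
    have hLf := hL12 f2.
    have uE : pr1 u - (L12 \o L21) (pr1 u) = pr1 f + L12 (pr2 f).
      rewrite /f p1// p2//= (bopB bL12)//; last exact: hL21.
      by rewrite addrA subrK.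
    have := bd _ u1; rewrite uE => h1.
    have h2 := hnorm_tri gH1 f1 hLf.
    have h3 := hD _ f2.
    have h4 := hnorm_pr1 hf; have h5 := hnorm_pr2 hf.
    have n1 : hnorm H1 (pr1 u) <= C * (1 + D) * hnorm H f.
      apply: le_trans h1 _; rewrite -mulrA ler_wpM2l//; apply: le_trans h2 _.
      rewrite mulrDl mul1r lerD//; apply: le_trans h3 _; by rewrite ler_wpM2l.
    have u2E : pr2 u = pr2 f + L21 (pr1 u) by rewrite /f p2// subrK.
    have n2 : hnorm H2 (pr2 u) <= hnorm H f + E * (C * (1 + D) * hnorm H f).
      rewrite u2E; apply: le_trans (hnorm_tri gH2 f2 (hL21 u1)) _.
      rewrite lerD//; apply: le_trans (hE _ u1) _; by rewrite ler_wpM2l.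
    apply: le_trans (hnorm_le_split hu) _; apply: le_trans (lerD n1 n2) _.
    by rewrite le_eqVlt; apply/orP; left; apply/eqP; ring.
Qed.

End block.

(** The blocks are [z K12] and [z K21], whose product is [z ^ 2] times [K12 K21]. *)
Lemma block_solvable_at (R : realType) (V V1 V2 : lmodType R) (H : hilb V) (H1 : hilb V1)
    (H2 : hilb V2) (pr1 : V -> V1) (pr2 : V -> V2) (mk : V1 -> V2 -> V)
    (K : V -> V) (K12 : V2 -> V1) (K21 : V1 -> V2) (z : R[i]) :
  prehilbert H -> prehilbert H1 -> prehilbert H2 ->
  hilb_split H H1 H2 pr1 pr2 mk ->
  bounded_op H2 H1 K12 -> bounded_op H1 H2 K21 ->
  (forall v, hmem H v -> pr1 (K v) = K12 (pr2 v)) ->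
  (forall v, hmem H v -> pr2 (K v) = K21 (pr1 v)) ->
  solvable_at H K z <-> solvable_at H1 (K12 \o K21) (z * z).
Proof.
move=> gH gH1 gH2 sp b12 b21 k1 k2.
have spC := hilb_split_complexify sp.
have gC := prehilbert_complexify gH; have gC1 := prehilbert_complexify gH1.
have gC2 := prehilbert_complexify gH2.
have c12 := bounded_cop gH2 gH1 b12; have c21 := bounded_cop gH1 gH2 b21.
have comp (W1 W2 W3 : lmodType R) (G1 : hilb W1) (G2 : hilb W2) (G3 : hilb W3) A B :
    bounded_op G1 G2 A -> bounded_op G2 G3 B -> bounded_op G1 G3 (B \o A).
  move=> bA bB; split.
  - move=> a u v hu hv; rewrite /= (bop_linear bA)// (bop_linear bB)//; exact: (bop_hmem bA).
  - by move=> u hu; apply: (bop_hmem bB); exact: (bop_hmem bA).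
  - have [C C0 hC] := bop_bound bA; have [D D0 hD] := bop_bound bB.
    exists (D * C); first exact: mulr_ge0.
    move=> u hu; apply: le_trans (hD _ (bop_hmem bA hu)) _.
    by rewrite -mulrA ler_wpM2l//; exact: hC.
have d12 := comp _ _ _ _ _ _ _ _ c12 (bounded_cscale gH1 z).
have d21 := comp _ _ _ _ _ _ _ _ c21 (bounded_cscale gH2 z).
have pr1Z a u : pr1 (a *: u) = a *: pr1 u.
  have p0 : pr1 0 = 0 by have := pr1B sp 0 0; rewrite !subrr.
  by have := pr1P sp a u 0; rewrite p0 !addr0.
have pr2Z a u : pr2 (a *: u) = a *: pr2 u.
  have p0 : pr2 0 = 0 by have := pr2B sp 0 0; rewrite !subrr.
  by have := pr2P sp a u 0; rewrite p0 !addr0.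
have pr1D u v : pr1 (u + v) = pr1 u + pr1 v by have := pr1P sp 1 u v; rewrite !scale1r.
have pr2D u v : pr2 (u + v) = pr2 u + pr2 v by have := pr2P sp 1 u v; rewrite !scale1r.
have l1 v : hmem (complexify H) v ->
    cop pr1 (cscale z (cop K v)) = (cscale z \o cop K12) (cop pr2 v).
  move=> [v1 v2]; rewrite /cop /cscale /= (pr1B sp) pr1D !pr1Z !k1//.
have l2 v : hmem (complexify H) v ->
    cop pr2 (cscale z (cop K v)) = (cscale z \o cop K21) (cop pr1 v).
  move=> [v1 v2]; rewrite /cop /cscale /= (pr2B sp) pr2D !pr2Z !k2//.
have [h1 h2] := block_invertible gC gC1 gC2 spC d12 d21 l1 l2.
have E u : hmem (complexify H1) u ->
  ((cscale z \o cop K12) \o (cscale z \o cop K21)) u = cscale (z * z) (cop (K12 \o K21) u).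
  move=> hu /=; rewrite (cop_cscale _ gH2 b12) ?cscaleM//; exact: (bop_hmem c21).
split=> [/h1|] [C [ex bd]].
- exists C; split=> [f hf|u hu]; last by rewrite -E//; exact: bd.
  by have [u hu e] := ex f hf; exists u => //; rewrite -E.
- apply: h2; exists C; split=> [f hf|u hu]; last by rewrite E//; exact: bd.
  by have [u hu e] := ex f hf; exists u => //; rewrite E.
Qed.

(** * Transport along a map that scales the inner product *)

Section transport.
Variables (R : realType) (V V' : lmodType R) (H : hilb V) (H' : hilb V').
Hypotheses (gH : prehilbert H) (gH' : prehilbert H').
Variables (c : R) (U : V -> V') (W : V' -> V).
Hypotheses (c0 : 0 < c) (UP : forall a u v, U (a *: u + v) = a *: U u + U v)
  (hU : forall v, hmem H v <-> hmem H' (U v))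
  (ipU : forall u v, hmem H u -> hmem H v -> ip H u v = c * ip H' (U u) (U v))
  (UW : forall u, hmem H' u -> hmem H (W u) /\ hequiv H' (U (W u)) u).

Let UB u v : U (u - v) = U u - U v.
Proof. by have := UP (-1) v u; rewrite !scaleN1r addrC => ->; rewrite addrC. Qed.

Let hnU u : hmem H u -> hnorm H u = Num.sqrt c * hnorm H' (U u).
Proof. by move=> hu; rewrite /hnorm ipU// sqrtrM// ltW. Qed.

Lemma hequiv_transport u v : hmem H u -> hmem H v ->
  hequiv H u v <-> hequiv H' (U u) (U v).
Proof.
move=> hu hv; rewrite /hequiv hnU; last exact: hmemB.
rewrite UB; split=> [/eqP|->]; last by rewrite mulr0.
by rewrite mulf_eq0 sqrtr_eq0 leNgt c0 => /eqP.
Qed.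

(** Both sides of the lower bound scale by the same [sqrt c], so the constant [C] carries over
    unchanged. *)
Lemma transport_invertible (L : V -> V) (L' : V' -> V') :
  bounded_op H H L -> bounded_op H' H' L' ->
  (forall v, hmem H v -> hequiv H' (U (L v)) (L' (U v))) ->
  invertible_1B H L <-> invertible_1B H' L'.
Proof.
move=> bL bL' LU.
have hL u : hmem H u -> hmem H (L u) by exact: (bop_hmem bL).
have hL' u : hmem H' u -> hmem H' (L' u) by exact: (bop_hmem bL').
have hUi u : hmem H u -> hmem H' (U u) by move/hU.
have e1 u : hmem H u -> hequiv H' (U (u - L u)) (U u - L' (U u)).
  move=> hu; rewrite UB; apply: hequivB => //; try (by [apply: hUi|apply: hL'; apply: hUi|apply: hUi; apply: hL]).
    exact: hequiv_refl.
  exact: LU.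
have h1 u : hmem H u -> hmem H (u - L u) by move=> hu; apply: hmemB => //; exact: hL.
have h1' u : hmem H' u -> hmem H' (u - L' u) by move=> hu; apply: hmemB => //; exact: hL'.
have e2 u v : hmem H' u -> hmem H' v -> hequiv H' u v -> hequiv H' (u - L' u) (v - L' v).
  move=> hu hv uv; apply: hequivB => //; try exact: hL'.
  exact: (bop_hequiv gH' bL').
have sc0 : 0 < Num.sqrt c by rewrite sqrtr_gt0.
split=> -[C [ex bd]]; exists C; split.
- move=> f hf; have [hWf eWf] := UW hf; have [u hu e] := ex _ hWf.
  exists (U u); first exact: hUi.
  have hUu := hUi _ hu.
  apply: (hequiv_trans gH' _ (hUi _ (h1 _ hu))) => //; first exact: h1'.
    apply: hequiv_sym => //; [exact: hUi (h1 _ hu)|exact: h1'|exact: e1].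
  apply: (hequiv_trans gH' _ (hUi _ hWf)) => //; first exact: hUi (h1 _ hu).
  by apply/hequiv_transport => //; exact: h1.
- move=> u' hu'; have [hu e] := UW hu'; have hUu := hUi _ hu.
  have := bd _ hu; rewrite !hnU//; last exact: h1.
  rewrite mulrCA ler_pM2l//.
  rewrite (hequiv_hnorm gH' hUu hu' e) (hequiv_hnorm gH' (hUi _ (h1 _ hu)) (h1' _ hUu) (e1 _ hu)).
  by rewrite (hequiv_hnorm gH' (h1' _ hUu) (h1' _ hu') (e2 _ _ hUu hu' e)).
- move=> f hf; have [u' hu' e] := ex _ (hUi _ hf); have [hu eu] := UW hu'.
  exists (W u') => //; apply/hequiv_transport => //; first exact: h1.
  have hUu := hUi _ hu.
  apply: (hequiv_trans gH' _ (h1' _ hUu)) => //; [exact: hUi (h1 _ hu)|exact: hUi|exact: e1|].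
  apply: (hequiv_trans gH' _ (h1' _ hu')) => //; [exact: h1'|exact: hUi|exact: e2].
- move=> u hu; have hUu := hUi _ hu; rewrite !hnU//; last exact: h1.
  rewrite mulrCA ler_pM2l//.
  by rewrite (hequiv_hnorm gH' (hUi _ (h1 _ hu)) (h1' _ hUu) (e1 _ hu)); exact: bd.
Qed.

End transport.

(** [K] corresponds to [c' K'] rather than to [K']; the factor [c'] is absorbed into the spectral
    parameter. *)
Lemma transport_solvable_at (R : realType) (V V' : lmodType R) (H : hilb V) (H' : hilb V')
    (c c' : R) (U : V -> V') (W : V' -> V) (K : V -> V) (K' : V' -> V') (z : R[i]) :
  prehilbert H -> prehilbert H' -> 0 < c ->
  (forall a u v, U (a *: u + v) = a *: U u + U v) ->
  (forall v, hmem H v <-> hmem H' (U v)) ->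
  (forall u v, hmem H u -> hmem H v -> ip H u v = c * ip H' (U u) (U v)) ->
  (forall u, hmem H' u -> hmem H (W u) /\ hequiv H' (U (W u)) u) ->
  bounded_op H H K -> bounded_op H' H' K' ->
  (forall v, hmem H v -> hequiv H' (U (K v)) (c' *: K' (U v))) ->
  solvable_at H K z <-> solvable_at H' K' (z * c'%:C).
Proof.
move=> gH gH' c0 UP hU ipU UW bK bK' KU.
have gC := prehilbert_complexify gH; have gC' := prehilbert_complexify gH'.
have comp (V0 : lmodType R) (G : hilb V0) A y : prehilbert G -> bounded_op G G A ->
    bounded_op (complexify G) (complexify G) (fun u => cscale y (cop A u)).
  move=> gG bA; have cA := bounded_cop gG gG bA; have cy := bounded_cscale gG y; split.
  - by move=> a u v hu hv; rewrite (bop_linear cA)// (bop_linear cy)//; exact: (bop_hmem cA).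
  - by move=> u hu; apply: (bop_hmem cy); exact: (bop_hmem cA).
  - have [C C0 hC] := bop_bound cA; have [D D0 hD] := bop_bound cy.
    exists (D * C); first exact: mulr_ge0.
    move=> u hu; apply: le_trans (hD _ (bop_hmem cA hu)) _.
    by rewrite -mulrA ler_wpM2l//; exact: hC.
have UB u v : U (u - v) = U u - U v.
  by have := UP (-1) v u; rewrite !scaleN1r addrC => ->; rewrite addrC.
have UZ a u : U (a *: u) = a *: U u.
  have U0 : U 0 = 0 by have := UB 0 0; rewrite !subrr.
  by have := UP a u 0; rewrite U0 !addr0.
have UD u v : U (u + v) = U u + U v by have := UP 1 u v; rewrite !scale1r.
apply: (@transport_invertible _ _ _ (complexify H) (complexify H') gC gC' c (cop U) (cop W) c0).
- by move=> a u v; rewrite /cop /= !UP.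
- by move=> [v1 v2]; split=> -[/= /hU h1 /hU h2]; split.
- by move=> u v [u1 u2] [v1 v2]; rewrite /= !ipU// mulrDr.
- move=> u hu; have [u1 u2] := hu; have [w1 e1] := UW _ u1; have [w2 e2] := UW _ u2.
  by split => //; apply/hequiv_complexify => //; split; exact/hU.
- exact: comp.
- exact: comp.
- move=> v hv; have [v1 v2] := hv.
  have hK u : hmem H u -> hmem H' (U (K u)) by move=> hu; apply/hU; exact: (bop_hmem bK).
  have hK' u : hmem H u -> hmem H' (c' *: K' (U u)).
    by move=> hu; apply: hmemZ => //; apply: (bop_hmem bK'); exact/hU.
  have -> : cop U (cscale z (cop K v)) = cscale z (cop U (cop K v)).
    by rewrite /cop /cscale /= UB UD !UZ.
  have -> : cscale (z * c'%:C) (cop K' (cop U v)) =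
      cscale z (c' *: K' (U v.1), c' *: K' (U v.2)).
    rewrite -cscaleM; congr cscale.
    by rewrite /cscale /cop /= !scale0r subr0 addr0.
  apply: hequiv_cscale => //; [by split; exact: hK|by split; exact: hK'|].
  by apply/hequiv_complexify => //; [by split; exact: hK|by split; exact: hK'|split; exact: KU].
Qed.

(** * Weighted spaces of square integrable functions *)

Section lebesgue_ext.
Variable R : realType.
Implicit Types D : set R.

Lemma eq_lint D (f g : R -> \bar R) : (forall x, D x -> f x = g x) ->
  (\int[@lebesgue_measure R]_(x in D) f x = \int[@lebesgue_measure R]_(x in D) g x)%E.
Proof. by move=> fg; apply: eq_integral => x /set_mem/fg. Qed.

Lemma eq_lRint D (f g : R -> R) : (forall x, D x -> f x = g x) ->
  \int[@lebesgue_measure R]_(x in D) f x = \int[@lebesgue_measure R]_(x in D) g x.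
Proof. by move=> fg; apply: eq_Rintegral => x /set_mem/fg. Qed.

Lemma eq_lintegrable D (f g : R -> R) : measurable D -> (forall x, D x -> f x = g x) ->
  (@lebesgue_measure R).-integrable D (EFin \o f) ->
  (@lebesgue_measure R).-integrable D (EFin \o g).
Proof. by move=> mD fg; apply: eq_integrable => // x /set_mem/fg /= ->. Qed.

Lemma lint_lty D (f : R -> R) : measurable D ->
  (@lebesgue_measure R).-integrable D (EFin \o f) ->
  (\int[@lebesgue_measure R]_(x in D) (f x)%:E < +oo)%E.
Proof. move=> mD; exact: (@integrable_lty _ (measurableTypeR R) R (@lebesgue_measure R) D mD). Qed.

Lemma lintegrableD D (f g : R -> R) : measurable D ->
  (@lebesgue_measure R).-integrable D (EFin \o f) ->
  (@lebesgue_measure R).-integrable D (EFin \o g) ->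
  (@lebesgue_measure R).-integrable D (EFin \o (fun x => f x + g x)).
Proof. move=> mD; exact: (@integrableD _ (measurableTypeR R) R (@lebesgue_measure R) D mD). Qed.

Lemma lintegrableZ D (a : R) (f : R -> R) : measurable D ->
  (@lebesgue_measure R).-integrable D (EFin \o f) ->
  (@lebesgue_measure R).-integrable D (EFin \o (fun x => a * f x)).
Proof. move=> mD; exact: (@integrableZl _ (measurableTypeR R) R (@lebesgue_measure R) D mD). Qed.

Lemma le_lintegrable D (f g : R -> R) : measurable D -> measurable_fun D f ->
  (forall x, D x -> `|f x| <= g x) ->
  (@lebesgue_measure R).-integrable D (EFin \o g) ->
  (@lebesgue_measure R).-integrable D (EFin \o f).
Proof.
move=> mD mf fg hg; apply: (@le_integrable _ (measurableTypeR R) R (@lebesgue_measure R) D mD) hg.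
  exact/measurable_EFinP.
by move=> x Dx /=; rewrite lee_fin (le_trans (fg x Dx))// ler_norm.
Qed.

Lemma lRintegralD D (f g : R -> R) : measurable D ->
  (@lebesgue_measure R).-integrable D (EFin \o f) ->
  (@lebesgue_measure R).-integrable D (EFin \o g) ->
  \int[@lebesgue_measure R]_(x in D) (f x + g x) =
  \int[@lebesgue_measure R]_(x in D) f x + \int[@lebesgue_measure R]_(x in D) g x.
Proof. move=> mD; exact: (@RintegralD _ (measurableTypeR R) R (@lebesgue_measure R) D f g mD). Qed.

Lemma lRintegralZ D (a : R) (f : R -> R) : measurable D ->
  (@lebesgue_measure R).-integrable D (EFin \o f) ->
  \int[@lebesgue_measure R]_(x in D) (a * f x) =
  a * \int[@lebesgue_measure R]_(x in D) f x.
Proof. move=> mD hf; exact: (@RintegralZl _ (measurableTypeR R) R (@lebesgue_measure R) D f a mD hf). Qed.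

Lemma lRintegral_int D (f : R -> R) :
  measurable D -> (@lebesgue_measure R).-integrable D (EFin \o f) ->
  ((\int[@lebesgue_measure R]_(x in D) f x)%:E =
   \int[@lebesgue_measure R]_(x in D) (f x)%:E)%E.
Proof. by move=> mD hf; rewrite /Rintegral fineK//; exact: (@integrable_fin_num _ (measurableTypeR R) R (@lebesgue_measure R) D mD _ hf). Qed.

Lemma le_lint D (f g : R -> \bar R) : measurable D -> measurable_fun D f ->
  measurable_fun D g -> (forall x, D x -> (0 <= f x)%E) ->
  (forall x, D x -> (f x <= g x)%E) ->
  (\int[@lebesgue_measure R]_(x in D) f x <= \int[@lebesgue_measure R]_(x in D) g x)%E.
Proof.
move=> mD mf mg f0 fg; apply: ge0_le_integral => //.
Qed.

End lebesgue_ext.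

(** [L2m m] is [L2w halfline m] by conversion, and the space of a diagonal Dirac operator is the
    orthogonal sum of two spaces of this kind. *)
Definition L2w (R : realType) (I : set R) (w : R -> R) : hilb (R -> R) :=
  Hilb
    [set f : R -> R | measurable_fun I f /\
       (\int[@lebesgue_measure R]_(x in I) (f x ^+ 2 * w x)%:E < +oo)%E]
    (fun f g => (\int[@lebesgue_measure R]_(x in I) (f x * g x * w x))%R).

Section L2w_theory.
Variables (R : realType) (I : set R) (w : R -> R).
Hypotheses (mI : measurable I) (mw : measurable_fun I w) (w0 : forall x, I x -> 0 <= w x).
Let mu := @lebesgue_measure R.
Implicit Types f g : R -> R.

Lemma integrable_of_ge0 f : measurable_fun I f -> (forall x, I x -> 0 <= f x) ->
  (\int[mu]_(x in I) (f x)%:E < +oo)%E -> mu.-integrable I (EFin \o f).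
Proof.
move=> mf f0 foo; apply/integrableP; split; first exact/measurable_EFinP.
rewrite (eq_lint (g := fun x => (f x)%:E))// => x Ix /=.
by rewrite ger0_norm// f0.
Qed.

Lemma L2w_measurable_sq f g : measurable_fun I f -> measurable_fun I g ->
  measurable_fun I (fun x => f x * g x * w x).
Proof. by move=> mf mg; apply: measurable_funM => //; exact: measurable_funM. Qed.

Lemma L2w_integrable f g : hmem (L2w I w) f -> hmem (L2w I w) g ->
  mu.-integrable I (EFin \o (fun x => f x * g x * w x)).
Proof.
move=> [mf foo] [mg goo].
have sq (h : R -> R) : measurable_fun I h -> (\int[mu]_(x in I) (h x ^+ 2 * w x)%:E < +oo)%E ->
    mu.-integrable I (EFin \o (fun x => h x ^+ 2 * w x)).
  move=> mh hoo; apply: integrable_of_ge0 => //.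
    by apply: measurable_funM => //; exact: measurable_funX.
  by move=> x Ix; rewrite mulr_ge0 ?sqr_ge0// w0.
apply: (le_lintegrable mI (L2w_measurable_sq mf mg) _ (lintegrableD mI (sq f mf foo) (sq g mg goo))).
move=> x Ix /=; rewrite -mulrDl normrM (ger0_norm (w0 Ix)) ler_wpM2r ?w0//.
rewrite ler_norml; apply/andP; split.
  by have := sqr_ge0 (f x + g x); rewrite sqrrD; have := sqr_ge0 (f x); have := sqr_ge0 (g x); lra.
by have := sqr_ge0 (f x - g x); rewrite sqrrB; have := sqr_ge0 (f x); have := sqr_ge0 (g x); lra.
Qed.

Lemma L2w_ip_int f g : hmem (L2w I w) f -> hmem (L2w I w) g ->
  ((ip (L2w I w) f g)%:E = \int[mu]_(x in I) (f x * g x * w x)%:E)%E.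
Proof.
move=> hf hg; rewrite /= lRintegral_int//; exact: L2w_integrable.
Qed.

Lemma prehilbert_L2w : prehilbert (L2w I w).
Proof.
split.
- split; first exact: measurable_cst.
  rewrite integral0_eq ?ltry// => x _ /=; by rewrite /GRing.zero/= expr0n/= mul0r.
- move=> a u v hu hv; have [mu' _] := hu; have [mv' _] := hv; split.
    by apply: measurable_funD => //; apply: measurable_funM => //; exact: measurable_cst.
  have iu := L2w_integrable hu hu; have iv := L2w_integrable hv hv.
  have iuv := L2w_integrable hu hv.
  have : mu.-integrable I (EFin \o (fun x => (a *: u + v) x ^+ 2 * w x)).
    apply: (@eq_lintegrable _ _ (fun x => a ^+ 2 * (u x * u x * w x) +
        (2 * a) * (u x * v x * w x) + v x * v x * w x)) => //; last first.
      exact: (lintegrableD mI (lintegrableD mI (lintegrableZ _ mI iu) (lintegrableZ _ mI iuv)) iv).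
    move=> x _; have -> : (a *: u + v) x = a * u x + v x by [].
    ring.
  exact: lint_lty.
- by move=> u v /=; apply: eq_Rintegral => x _; rewrite (mulrC (u x)).
- move=> a u v z hu hv hz /=.
  have iu := L2w_integrable hu hz; have iv := L2w_integrable hv hz.
  rewrite -lRintegralZ// -lRintegralD//; last exact: lintegrableZ.
  apply: eq_lRint => x _; have -> : (a *: u + v) x = a * u x + v x by [].
  ring.
- move=> u hu /=; apply: Rintegral_ge0 => x Ix.
  by rewrite -expr2 mulr_ge0 ?sqr_ge0// w0.
Qed.

Lemma L2w_norm_int f : hmem (L2w I w) f ->
  (((hnorm (L2w I w) f) ^+ 2)%:E = \int[mu]_(x in I) (f x ^+ 2 * w x)%:E)%E.
Proof.
move=> hf; rewrite hnorm_sqr//; last exact: prehilbert_L2w.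
by rewrite L2w_ip_int//; apply: eq_integral => x _; rewrite expr2.
Qed.

Lemma L2w_norm_le f (C : R) : 0 <= C -> hmem (L2w I w) f ->
  (\int[mu]_(x in I) (f x ^+ 2 * w x)%:E <= (C ^+ 2)%:E)%E -> hnorm (L2w I w) f <= C.
Proof.
move=> C0 hf; rewrite -L2w_norm_int// lee_fin.
by rewrite ler_pXn2r// nnegrE sqrtr_ge0.
Qed.

Lemma eq_hmem_L2w f g : (forall x, I x -> f x = g x) ->
  hmem (L2w I w) f -> hmem (L2w I w) g.
Proof.
move=> fg [mf foo]; split; first by apply: eq_measurable_fun mf => x /set_mem; exact: fg.
by rewrite (eq_lint (g := fun x => (f x ^+ 2 * w x)%:E)) // => x Ix; rewrite fg.
Qed.

Lemma eq_hequiv_L2w f g : (forall x, I x -> f x = g x) -> hequiv (L2w I w) f g.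
Proof.
move=> fg; rewrite /hequiv /hnorm /= /Rintegral integral0_eq ?sqrtr0// => x Ix.
have E : (f - g) x = 0 by rewrite -[LHS]/(f x - g x) fg// subrr.
by rewrite E !mul0r.
Qed.

End L2w_theory.

Lemma hmem_L2wS (R : realType) (I J : set R) (w f : R -> R) :
  measurable I -> measurable J -> J `<=` I -> measurable_fun I w ->
  (forall x, I x -> 0 <= w x) -> hmem (L2w I w) f -> hmem (L2w J w) f.
Proof.
move=> mI mJ JI mw w0 [mf foo]; split; first exact: measurable_funS mf.
apply: le_lt_trans foo; apply: ge0_subset_integral => //.
  by apply/measurable_EFinP; apply: measurable_funM => //; exact: measurable_funX.
by move=> x Ix; rewrite lee_fin mulr_ge0 ?sqr_ge0// w0.
Qed.

Lemma hnorm_L2wS (R : realType) (I J : set R) (w f : R -> R) :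
  measurable I -> measurable J -> J `<=` I -> measurable_fun I w ->
  (forall x, I x -> 0 <= w x) -> hmem (L2w I w) f -> hnorm (L2w J w) f <= hnorm (L2w I w) f.
Proof.
move=> mI mJ JI mw w0 hf; have hJ := hmem_L2wS mI mJ JI mw w0 hf.
have mwJ := measurable_funS mI JI mw.
have w0J x : J x -> 0 <= w x by move/JI; exact: w0.
apply: L2w_norm_le => //; first exact: hnorm_ge0.
rewrite L2w_norm_int//; have [mf _] := hf; apply: ge0_subset_integral => //.
  by apply/measurable_EFinP; apply: measurable_funM => //; exact: measurable_funX.
by move=> x Ix; rewrite lee_fin mulr_ge0 ?sqr_ge0// w0.
Qed.

(** The constant 1 lies in the space because [w] is integrable, and the integral of [w f] is its
    inner product with [f]. *)
Lemma L2w_cauchy_schwarz (R : realType) (I : set R) (w f : R -> R) :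
  measurable I -> measurable_fun I w -> (forall x, I x -> 0 <= w x) ->
  (@lebesgue_measure R).-integrable I (EFin \o w) -> hmem (L2w I w) f ->
  (@lebesgue_measure R).-integrable I (EFin \o (fun x => w x * f x)) /\
  (\int[@lebesgue_measure R]_(x in I) (w x * f x)) ^+ 2 <=
  (\int[@lebesgue_measure R]_(x in I) w x) * hnorm (L2w I w) f ^+ 2.
Proof.
move=> mI mw w0 iw hf.
have h1 : hmem (L2w I w) (cst 1).
  split; first exact: measurable_cst.
  rewrite (eq_lint (g := EFin \o w)); last by move=> x _ /=; rewrite expr1n mul1r.
  exact: lint_lty.
have E : (fun x => cst 1 x * f x * w x) = (fun x => w x * f x).
  by apply/funext => x; rewrite mul1r mulrC.
have gH := prehilbert_L2w mI mw w0.
split; first by have := L2w_integrable mI mw w0 h1 hf; rewrite E.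
have := ip_le gH h1 hf; rewrite /= E => h.
have -> : \int[@lebesgue_measure R]_(x in I) w x = hnorm (L2w I w) (cst 1) ^+ 2.
  by rewrite hnorm_sqr//=; apply: eq_Rintegral => x _; rewrite !mul1r.
rewrite -exprMn -[leLHS]real_normK ?num_real//.
by rewrite ler_pXn2r// nnegrE ?mulr_ge0 ?hnorm_ge0.
Qed.

(** * Exchanging integrals over the triangle [0 <= r <= t < 1] *)

Section triangle.
Variable R : realType.
Notation I := (`[0, 1[%classic : set R).
Let mu := @lebesgue_measure R.
Variables A B : R -> R.
Hypotheses (mA : measurable_fun I A) (mB : measurable_fun I B).

(** The integrand extended by 0 to the whole plane; integrating its horizontal and vertical slices
    gives the two iterated integrals. *)
Let k (z : R * R) : R := (A \_ I) z.1 * (B \_ I) z.2 * (z.2 <= z.1)%R%:R.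

Let mI : measurable I. Proof. exact: measurable_itv. Qed.

Let mA' : measurable_fun setT (A \_ I).
Proof. exact: (measurable_restrictT _ mI).1. Qed.

Let mB' : measurable_fun setT (B \_ I).
Proof. exact: (measurable_restrictT _ mI).1. Qed.

Let mk : measurable_fun setT k.
Proof.
apply: measurable_funM; first apply: measurable_funM.
- exact: measurableT_comp.
- exact: measurableT_comp.
- rewrite (_ : (fun z : R * R => _) = (fun z : R * R => if (z.2 <= z.1)%R then 1 else 0)); last first.
    by apply/funext => z; case: (z.2 <= z.1).
  by apply: measurable_fun_ifT => //; exact: measurable_fun_ler.
Qed.

Let k_slice1 (t r : R) : I t -> k (t, r) = ((fun r => A t * B r) \_ `[0, t]) r.
Proof.
move=> It; rewrite /k /= !patchE mem_set//=.
have It' := It; rewrite /= in_itv/= in It'; case/andP: It' => t0 t1.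
case: ifPn => [/set_mem|/negP nI]; rewrite ?in_itv/=.
  rewrite in_itv/= => /andP[r0 r1]; case: (leP r t) => rt.
    by rewrite mulr1 mem_set//= in_itv/= r0.
  rewrite mulr0 memNset//= in_itv/= r0/= => h; by move: rt; rewrite ltNge h.
rewrite mulr0 mul0r memNset// => /=; rewrite in_itv/= => /andP[r0 rt].
by apply: nI; rewrite mem_set//= in_itv/= r0 (le_lt_trans rt t1).
Qed.

Let k_slice2 (t r : R) : I r -> k (t, r) = ((fun t => B r * A t) \_ `[r, 1[) t.
Proof.
move=> Ir; rewrite /k /= !patchE (mem_set Ir)/=.
have Ir' := Ir; rewrite /= in_itv/= in Ir'; case/andP: Ir' => r0 r1.
case: ifPn => [/set_mem|/negP nI]; rewrite ?in_itv/=.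
  rewrite in_itv/= => /andP[t0 t1]; case: (leP r t) => rt.
    by rewrite mulr1 mem_set//= ?in_itv/= ?rt// mulrC.
  rewrite mulr0 memNset//= in_itv/= t1 andbT => h; by move: rt; rewrite ltNge h.
rewrite !mul0r memNset// => /=; rewrite in_itv/= => /andP[rt t1].
by apply: nI; rewrite mem_set//= in_itv/= t1 (le_trans r0 rt).
Qed.

Let k_out1 (t r : R) : ~ I t -> k (t, r) = 0.
Proof. by move=> nI; rewrite /k /= patchE memNset// !mul0r. Qed.

Let k_out2 (t r : R) : ~ I r -> k (t, r) = 0.
Proof. by move=> nI; rewrite /k /= [(B \_ I) r]patchE memNset// mulr0 mul0r. Qed.

Let int1 (D : set R) (g : R -> R) (c : R) : measurable D -> mu.-integrable D (EFin \o g) ->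
  (\int[mu]_r (((fun r => c * g r) \_ D) r)%:E = (c * \int[mu]_(r in D) g r)%:E)%E.
Proof.
move=> mD ig; rewrite -lRintegralZ// lRintegral_int//; last exact: lintegrableZ.
by rewrite [RHS]integral_mkcond; apply: eq_integral => x _; rewrite restrict_EFin.
Qed.

Lemma triangle_tonelli : (forall t, I t -> 0 <= A t) -> (forall t, I t -> 0 <= B t) ->
  (forall t, I t -> mu.-integrable `[0, t] (EFin \o B)) ->
  (forall t, I t -> mu.-integrable `[t, 1[ (EFin \o A)) ->
  (\int[mu]_(t in I) (A t * \int[mu]_(r in `[0, t]) B r)%:E =
   \int[mu]_(r in I) (B r * \int[mu]_(t in `[r, 1[) A t)%:E)%E.
Proof.
move=> A0 B0 iB iA.
have k0 z : (0 <= (k z)%:E)%E.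
  rewrite lee_fin !mulr_ge0//; rewrite patchE; case: ifPn => // /set_mem; [exact: A0|exact: B0].
have := @fubini_tonelli _ _ (measurableTypeR R) (measurableTypeR R) R mu mu (EFin \o k).
move=> /(_ _ k0) F; rewrite integral_mkcond [RHS]integral_mkcond.
have -> : (\int[mu]_x ((fun t => (A t * \int[mu]_(r in `[0, t]) B r)%:E) \_ I) x =
   \int[mu]_x \int[mu]_y (EFin \o k) (x, y))%E.
  apply: eq_integral => t _; rewrite patchE; case: ifPn => [/set_mem It|/negP nI].
    rewrite -(int1 (A t) (measurable_itv _) (iB t It)).
    by apply: eq_integral => r _ /=; rewrite -k_slice1.
  by rewrite -[LHS]/(0%E : \bar R); symmetry; apply: integral0_eq => r _ /=; rewrite k_out1; [by []|by move=> /mem_set].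
rewrite F; last exact/measurable_EFinP.
apply: eq_integral => r _; rewrite patchE; case: ifPn => [/set_mem Ir|/negP nI].
  rewrite -(int1 (B r) (measurable_itv _) (iA r Ir)).
  by apply: eq_integral => t _ /=; rewrite -k_slice2.
by rewrite -[RHS]/(0%E : \bar R); apply: integral0_eq => t _ /=; rewrite k_out2; [by []|by move=> /mem_set].
Qed.

Lemma triangle_fubini :
  (forall t, I t -> mu.-integrable `[0, t] (EFin \o B)) ->
  (forall t, I t -> mu.-integrable `[t, 1[ (EFin \o A)) ->
  (\int[mu]_(t in I) (`|A t| * \int[mu]_(r in `[0, t]) `|B r|)%:E < +oo)%E ->
  \int[mu]_(t in I) (A t * \int[mu]_(r in `[0, t]) B r) =
  \int[mu]_(r in I) (B r * \int[mu]_(t in `[r, 1[) A t).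
Proof.
move=> iB iA fin.
have ik : (product_measure1 mu mu).-integrable setT (EFin \o k).
  apply/integrable12ltyP; first exact/measurable_EFinP.
  apply: le_lt_trans fin; rewrite [leRHS]integral_mkcond.
  rewrite le_eqVlt; apply/orP; left; apply/eqP.
  apply: eq_integral => t _; rewrite patchE; case: ifPn => [/set_mem It|/negP nI].
    have iB' : mu.-integrable `[0, t] (EFin \o (fun x => `|B x|)).
      by have := integrable_norm (iB t It).
    rewrite -(int1 `|A t| (measurable_itv _) iB').
    apply: eq_integral => r _ /=; rewrite k_slice1// !patchE.
    by case: ifPn; rewrite ?normrM// normr0.
  by rewrite integral0_eq// => r _ /=; rewrite k_out1; [by rewrite normr0|by move=> /mem_set].
have F := Fubini ik.
rewrite /Rintegral; congr fine.
rewrite [LHS]integral_mkcond [RHS]integral_mkcond.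
transitivity (\int[mu]_x \int[mu]_y (EFin \o k) (x, y))%E.
  apply: eq_integral => t _; rewrite patchE; case: ifPn => [/set_mem It|/negP nI].
    rewrite -(int1 (A t) (measurable_itv _) (iB t It)).
    by apply: eq_integral => r _ /=; rewrite -k_slice1.
  by rewrite -[LHS]/(0%E : \bar R); symmetry; apply: integral0_eq => r _ /=; rewrite k_out1; [by []|by move=> /mem_set].
rewrite F.
apply: eq_integral => r _; rewrite patchE; case: ifPn => [/set_mem Ir|/negP nI].
  rewrite -(int1 (B r) (measurable_itv _) (iA r Ir)).
  by apply: eq_integral => t _ /=; rewrite -k_slice2.
by rewrite -[RHS]/(0%E : \bar R); apply: integral0_eq => t _ /=; rewrite k_out2; [by []|by move=> /mem_set].
Qed.

End triangle.

Lemma abs_cont_continuous (R : realType) (a b : R) (F : R -> R) :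
  abs_cont a b (F : R -> R^o) -> {within `[a, b], continuous F}.
Proof.
move=> acF; have /abs_cont_seqP H := acF.
apply/subspace_continuousP => x /=; rewrite in_itv/= => /andP[ax xb].
apply/cvgrPdist_lt => e e0; have [d d0 Hd] := H e e0.
rewrite near_withinE; near=> y => /=; rewrite in_itv/= => /andP[ay yb].
have yd : `|x - y| < d by near: y; exact: cvgr_dist_lt.
have [xy|/ltW yx] := leP x y.
- have := Hd [:: (x, y)]; rewrite /= /itv_in/= ax xy yb /itv_sum /var_sum !big_seq1/= distrC.
  by move=> ->//; rewrite -(ger0_norm (_ : 0 <= y - x)) ?subr_ge0// distrC.
- have := Hd [:: (y, x)]; rewrite /= /itv_in/= ay yx xb /itv_sum /var_sum !big_seq1/=.
  by move=> ->//; rewrite -(ger0_norm (_ : 0 <= x - y)) ?subr_ge0.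
Unshelve. all: by end_near. Qed.

Lemma abs_cont_measurable (R : realType) (a b : R) (F : R -> R) :
  abs_cont a b (F : R -> R^o) -> measurable_fun `[a, b] F.
Proof.
by move=> acF; apply: subspace_continuous_measurable_fun => //; exact: abs_cont_continuous.
Qed.

Lemma loc_abs_cont_measurable01 (R : realType) (F : R -> R) :
  loc_abs_cont (`[0, 1[%classic : set R) (F : R -> R^o) ->
  measurable_fun (`[0, 1[%classic : set R) F.
Proof.
move=> acF; rewrite itv_bnd_open_bigcup.
apply/measurable_fun_bigcup => // n; apply: abs_cont_measurable; apply: acF.
by move=> x /=; rewrite !in_itv/= => /andP[-> xn] /=; apply: le_lt_trans xn _; rewrite ltrBlDr ltrDl invr_gt0.
Qed.

Lemma loc_abs_cont_measurable_halfline (R : realType) (F : R -> R) :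
  loc_abs_cont (@halfline R) (F : R -> R^o) -> measurable_fun (@halfline R) F.
Proof.
move=> acF; rewrite /halfline itv_bndy_bigcup_BRight.
apply/measurable_fun_bigcup => // n; apply: abs_cont_measurable; apply: acF.
by move=> x /=; rewrite /halfline/= !in_itv/= andbT => /andP[].
Qed.

(** * Volterra operators on [[0, 1)] *)

Notation itv01 := (`[0, 1[%classic).

Lemma lintegrable_cst_itv (R : realType) (a b M : R) :
  (@lebesgue_measure R).-integrable `[a, b] (EFin \o cst M).
Proof.
apply: (@measurable_bounded_integrable _ (measurableTypeR R)) => //.
  have h : (lebesgue_measure (`[a, b]%classic : set R) < +oo)%E.
    by rewrite lebesgue_measure_itv/= -EFinB; case: ifP => _; exact: ltry.
  exact: h.
by exists `|M|; split; rewrite ?num_real// => x Mx y _ /=; exact: ltW.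
Qed.

Lemma lRint_split (R : realType) (u a : R) (b : itv_bound R) (f : R -> R) :
  u <= a -> (BRight a <= b)%O ->
  (@lebesgue_measure R).-integrable [set` Interval (BLeft u) b] (EFin \o f) ->
  \int[@lebesgue_measure R]_(x in [set` Interval (BLeft u) b]) f x =
  \int[@lebesgue_measure R]_(x in `[u, a]) f x +
  \int[@lebesgue_measure R]_(x in [set` Interval (BLeft a) b]) f x.
Proof.
move=> ua ab ix; have h := @Rintegral_itvB R f (BLeft u) b a ix.
rewrite -(@Rintegral_itv_obnd_cbnd R a b f); last first.
  apply: integrableS ix => //; apply: subset_itvr.
  by rewrite bnd_simp.
by rewrite -h ?bnd_simp// addrC subrK.
Qed.

Lemma L2w_cauchy_schwarzS (R : realType) (I J : set R) (w f : R -> R) :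
  measurable I -> measurable J -> J `<=` I -> measurable_fun I w ->
  (forall x, I x -> 0 <= w x) -> (@lebesgue_measure R).-integrable J (EFin \o w) ->
  hmem (L2w I w) f ->
  (@lebesgue_measure R).-integrable J (EFin \o (fun x => w x * f x)) /\
  (\int[@lebesgue_measure R]_(x in J) (w x * f x)) ^+ 2 <=
  (\int[@lebesgue_measure R]_(x in J) w x) * hnorm (L2w I w) f ^+ 2.
Proof.
move=> mI mJ JI mw w0 iw hf; have mw' := measurable_funS mI JI mw.
have w0' r : J r -> 0 <= w r by move/JI/w0.
have hf' : hmem (L2w J w) f by exact: hmem_L2wS JI mw w0 hf.
have [h1 h2] := L2w_cauchy_schwarz mJ mw' w0' iw hf'.
split; first exact: h1.
apply: (le_trans h2); apply: ler_wpM2l.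
  by apply: Rintegral_ge0 => x; exact: w0'.
have := hnorm_L2wS mI mJ JI mw w0 hf.
have := hnorm_ge0 (L2w J w) f; have := hnorm_ge0 (L2w I w) f.
by move=> a0 b0 ab; rewrite lerXn2r.
Qed.

(** The operator [A] of the overview, set to 0 off [[0, 1)] so that it is linear as a map on
    functions. *)
Definition volterra (R : realType) (q f : R -> R) : R -> R :=
  (fun t => \int[@lebesgue_measure R]_(r in `[0, t]) (q r * f r)) \_ itv01.

Definition volterra_adj (R : realType) (p g : R -> R) : R -> R :=
  (fun t => \int[@lebesgue_measure R]_(r in `[t, 1[) (p r * g r)) \_ itv01.

(** Only [p] is asked to be integrable up to 1; [q] is merely bounded on every [[0, b]] with
    [b < 1]. The pointwise bound [vw_hs] is stronger than square integrability of the kernel, but it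
    is what exponential weights provide. *)
Record volterra_weights (R : realType) (p q : R -> R) : Prop := VolterraWeights {
  vw_mp : measurable_fun (itv01 : set R) p;
  vw_mq : measurable_fun (itv01 : set R) q;
  vw_p0 : forall t, (itv01 : set R) t -> 0 < p t;
  vw_q0 : forall t, (itv01 : set R) t -> 0 < q t;
  vw_bound : forall b : R, b < 1 -> exists M, forall t, 0 <= t <= b -> p t <= M /\ q t <= M;
  vw_ip : (@lebesgue_measure R).-integrable itv01 (EFin \o p);
  vw_hs : exists2 C, 0 <= C &
    forall t, (itv01 : set R) t -> q t * \int[@lebesgue_measure R]_(r in `[t, 1[) p r <= C
}.

Section volterra_theory.
Variables (R : realType) (p q : R -> R).
Hypothesis vw : volterra_weights p q.
Notation I := (itv01 : set R).
Let mu := @lebesgue_measure R.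
Let mI : measurable I. Proof. exact: measurable_itv. Qed.
Let mp := vw_mp vw.
Let mq := vw_mq vw.
Let p0 t : I t -> 0 <= p t. Proof. by move/(vw_p0 vw)/ltW. Qed.
Let q0 t : I t -> 0 <= q t. Proof. by move/(vw_q0 vw)/ltW. Qed.
Notation Lp := (L2w I p).
Notation Lq := (L2w I q).

Let sub0 t : I t -> `[0, t] `<=` I.
Proof.
rewrite /= in_itv/= => /andP[t0 t1] r /=; rewrite !in_itv/= => /andP[-> rt].
exact: le_lt_trans t1.
Qed.

Let sub1 t : I t -> `[t, 1[ `<=` I.
Proof.
rewrite /= in_itv/= => /andP[t0 t1] r /=; rewrite !in_itv/= => /andP[tr ->].
by rewrite (le_trans t0 tr).
Qed.

Lemma volterra_q_integrable t : I t -> mu.-integrable `[0, t] (EFin \o q).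
Proof.
move=> It; have It' := It; rewrite /= in_itv/= in It'; have [t0 t1] := andP It'.
have [M HM] := vw_bound vw t1.
apply: (@le_lintegrable _ _ _ (cst M)) => //.
- exact: measurable_funS (sub0 It) mq.
- move=> r rt; rewrite ger0_norm; last by apply: q0; exact: sub0 rt.
  by move: rt; rewrite /= in_itv/= => /HM[].
- exact: lintegrable_cst_itv.
Qed.

(** Cauchy-Schwarz on [[0, t]], where [q] is bounded and hence integrable. The pointwise estimate
    also yields the operator norm in [volterra_bounded]. *)
Lemma volterra_cs f t : hmem Lq f -> I t ->
  mu.-integrable `[0, t] (EFin \o (fun r => q r * f r)) /\
  (\int[mu]_(r in `[0, t]) (q r * f r)) ^+ 2 <=
  (\int[mu]_(r in `[0, t]) q r) * hnorm Lq f ^+ 2.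
Proof.
move=> hf It.
exact: (L2w_cauchy_schwarzS mI (measurable_itv _) (sub0 It) mq q0 (volterra_q_integrable It) hf).
Qed.

Lemma volterra_adj_integrable g : hmem Lp g -> mu.-integrable I (EFin \o (fun r => p r * g r)).
Proof. by move=> hg; have [] := L2w_cauchy_schwarz mI mp p0 (vw_ip vw) hg. Qed.

Lemma volterra_adj_cs g t : hmem Lp g -> I t ->
  mu.-integrable `[t, 1[ (EFin \o (fun r => p r * g r)) /\
  (\int[mu]_(r in `[t, 1[) (p r * g r)) ^+ 2 <=
  (\int[mu]_(r in `[t, 1[) p r) * hnorm Lp g ^+ 2.
Proof.
move=> hg It.
have ip' : mu.-integrable `[t, 1[ (EFin \o p).
  by apply: integrableS (vw_ip vw) => //; exact: sub1.
exact: (L2w_cauchy_schwarzS mI (measurable_itv _) (sub1 It) mp p0 ip' hg).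
Qed.

Lemma volterraE f t : I t -> volterra q f t = \int[mu]_(r in `[0, t]) (q r * f r).
Proof. by move=> It; rewrite /volterra patchE mem_set. Qed.

Lemma volterra_adjE g t : I t -> volterra_adj p g t = \int[mu]_(r in `[t, 1[) (p r * g r).
Proof. by move=> It; rewrite /volterra_adj patchE mem_set. Qed.

Lemma volterra_out f t : ~ I t -> volterra q f t = 0.
Proof. by move=> It; rewrite /volterra patchE memNset. Qed.

Lemma volterra_adj_out g t : ~ I t -> volterra_adj p g t = 0.
Proof. by move=> It; rewrite /volterra_adj patchE memNset. Qed.

Let in_I a b x : `[a, b] `<=` I -> a <= x <= b -> I x.
Proof. by move=> sab axb; apply: sab; rewrite /= in_itv. Qed.

Lemma volterra_loc_abs_cont f : hmem Lq f -> loc_abs_cont I (volterra q f : R -> R^o).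
Proof.
move=> hf a b sab; apply: (@integral_abs_cont _ a b (fun r => q r * f r)).
  have [ba|ab] := ltP b a; first by rewrite set_itv_ge ?bnd_simp -?ltNge//; exact: integrable_set0.
  have Ib : I b by apply: sab; rewrite /= in_itv/= ab lexx.
  have Ia : I a by apply: sab; rewrite /= in_itv/= ab lexx.
  apply: integrableS (volterra_cs hf Ib).1 => //.
  by apply: subset_itvr; rewrite bnd_simp; move: Ia; rewrite /= in_itv/= => /andP[].
move=> x axb; have [ax xb] := andP axb.
have Ix := in_I sab axb.
have Ia : I a by apply: (in_I sab); rewrite lexx (le_trans ax xb).
have a0 : 0 <= a by move: Ia; rewrite /= in_itv/= => /andP[].
have ix := (volterra_cs hf Ix).1.
rewrite !volterraE//.
by rewrite (@lRint_split _ 0 a (BRight x)).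
Qed.

Lemma volterra_adj_split g t : hmem Lp g -> I t ->
  volterra_adj p g 0 = \int[mu]_(r in `[0, t]) (p r * g r) + volterra_adj p g t.
Proof.
move=> hg It; have It' := It; rewrite /= in_itv/= in It'; have [t0 t1] := andP It'.
rewrite !volterra_adjE//; last by rewrite /= in_itv/= lexx ltr01.
apply: lRint_split => //; exact: volterra_adj_integrable.
Qed.

Lemma volterra_adj_loc_abs_cont g : hmem Lp g -> loc_abs_cont I (volterra_adj p g : R -> R^o).
Proof.
move=> hg a b sab; apply: (@integral_abs_cont _ a b (fun r => - (p r * g r))).
  have [ba|ab] := ltP b a; first by rewrite set_itv_ge ?bnd_simp -?ltNge//; exact: integrable_set0.
  apply: (@eq_lintegrable _ _ (fun r => -1 * (p r * g r))) => // [r _|]; first by rewrite mulN1r.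
  by apply: lintegrableZ => //; apply: integrableS (volterra_adj_integrable hg).
move=> x axb; have [ax xb] := andP axb.
have Ix := in_I sab axb.
have Ia : I a by apply: (in_I sab); rewrite lexx (le_trans ax xb).
rewrite !volterra_adjE//.
have Ia' := Ia; rewrite /= in_itv/= in Ia'; have [a0 a1] := andP Ia'.
have Ix' := Ix; rewrite /= in_itv/= in Ix'; have [x0 x1] := andP Ix'.
have ia := (volterra_adj_cs hg Ia).1.
rewrite (@lRint_split _ a x (BLeft 1) _ ax _ ia) ?bnd_simp//.
have -> : \int[mu]_(t in `[a, x]) - (p t * g t) = - \int[mu]_(t in `[a, x]) (p t * g t).
  rewrite -[RHS]mulN1r -lRintegralZ//; last first.
    by apply: integrableS ia => //; apply: subset_itvl; rewrite bnd_simp.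
  by apply: eq_lRint => r _; rewrite mulN1r.
by rewrite addrC addrA addNr add0r.
Qed.

Lemma volterra_measurable f : hmem Lq f -> measurable_fun I (volterra q f).
Proof. by move=> hf; apply: loc_abs_cont_measurable01; exact: volterra_loc_abs_cont. Qed.

Lemma volterra_adj_measurable g : hmem Lp g -> measurable_fun I (volterra_adj p g).
Proof. by move=> hf; apply: loc_abs_cont_measurable01; exact: volterra_adj_loc_abs_cont. Qed.

Let Q t := \int[mu]_(r in `[0, t]) q r.
Let P t := \int[mu]_(r in `[t, 1[) p r.

Let ipt t : I t -> mu.-integrable `[t, 1[ (EFin \o p).
Proof. by move=> It; apply: integrableS (vw_ip vw) => //; exact: sub1. Qed.

Let P0 t : I t -> 0 <= P t.
Proof. by move=> It; apply: Rintegral_ge0 => r /(sub1 It)/p0. Qed.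

Let Q0 t : I t -> 0 <= Q t.
Proof. by move=> It; apply: Rintegral_ge0 => r /(sub0 It)/q0. Qed.

(** The Hilbert-Schmidt norm of [volterra q], whose kernel is the indicator of [r <= t], and equally
    that of its adjoint. *)
Definition volterra_const : R := Num.sqrt (fine (\int[mu]_(t in I) (q t * P t)%:E)%E).

Lemma volterra_p_mass_measurable : measurable_fun I P.
Proof.
apply: loc_abs_cont_measurable01 => a b sab.
apply: (@integral_abs_cont _ a b (fun r => - p r)).
  have [ba|ab] := ltP b a; first by rewrite set_itv_ge ?bnd_simp -?ltNge//; exact: integrable_set0.
  apply: (@eq_lintegrable _ _ (fun r => -1 * p r)) => // [r _|]; first by rewrite mulN1r.
  by apply: lintegrableZ => //; apply: integrableS (vw_ip vw).
move=> x axb; have [ax xb] := andP axb.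
have Ix := in_I sab axb.
have Ia : I a by apply: (in_I sab); rewrite lexx (le_trans ax xb).
have Ix' := Ix; rewrite /= in_itv/= in Ix'; have [x0 x1] := andP Ix'.
rewrite /P (@lRint_split _ a x (BLeft 1) _ ax _ (ipt Ia)) ?bnd_simp//.
have -> : \int[mu]_(t in `[a, x]) - p t = - \int[mu]_(t in `[a, x]) p t.
  rewrite -[RHS]mulN1r -lRintegralZ//; last first.
    by apply: integrableS (ipt Ia) => //; apply: subset_itvl; rewrite bnd_simp.
  by apply: eq_lRint => r _; rewrite mulN1r.
by rewrite addrC addrA addNr add0r.
Qed.

Lemma volterra_q_mass_measurable : measurable_fun I Q.
Proof.
apply: loc_abs_cont_measurable01 => a b sab.
apply: (@integral_abs_cont _ a b q).
  have [ba|ab] := ltP b a; first by rewrite set_itv_ge ?bnd_simp -?ltNge//; exact: integrable_set0.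
  have Ib : I b by apply: sab; rewrite /= in_itv/= ab lexx.
  have Ia : I a by apply: sab; rewrite /= in_itv/= ab lexx.
  apply: integrableS (volterra_q_integrable Ib) => //.
  by apply: subset_itvr; rewrite bnd_simp; move: Ia; rewrite /= in_itv/= => /andP[].
move=> x axb; have [ax xb] := andP axb.
have Ix := in_I sab axb.
have Ia : I a by apply: (in_I sab); rewrite lexx (le_trans ax xb).
have a0 : 0 <= a by move: Ia; rewrite /= in_itv/= => /andP[].
by rewrite /Q (@lRint_split _ 0 a (BRight x)) ?bnd_simp//; exact: volterra_q_integrable.
Qed.

Let mP := volterra_p_mass_measurable.
Let mQ := volterra_q_mass_measurable.

Lemma volterra_hs_integrable : mu.-integrable I (EFin \o (fun t => q t * P t)).
Proof.
have [C C0 HC] := vw_hs vw.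
apply: (@le_lintegrable _ _ _ (cst C)) => //.
- exact: measurable_funM.
- by move=> t It /=; rewrite ger0_norm ?HC// mulr_ge0 ?q0 ?P0.
- apply: integrableS (lintegrable_cst_itv 0 1 C) => //.
  by apply: subset_itvl; rewrite bnd_simp.
Qed.

Lemma volterra_hsE :
  (\int[mu]_(t in I) (p t * Q t)%:E = \int[mu]_(t in I) (q t * P t)%:E)%E.
Proof.
apply: (triangle_tonelli mp mq p0 q0) => t It; [exact: volterra_q_integrable|exact: ipt].
Qed.

Lemma volterra_constE : (\int[mu]_(t in I) (q t * P t)%:E = (volterra_const ^+ 2)%:E)%E.
Proof.
rewrite /volterra_const sqr_sqrtr ?fineK//.
  exact: (@integrable_fin_num _ (measurableTypeR R) R mu I mI _ volterra_hs_integrable).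
by apply/fine_ge0/integral_ge0 => t It; rewrite lee_fin mulr_ge0 ?q0 ?P0.
Qed.

Let const0 : 0 <= volterra_const. Proof. exact: sqrtr_ge0. Qed.

(** Passes from a Cauchy-Schwarz estimate at each [t] to the norm; [S t] stands for the mass of the
    weight over the range of integration at [t]. *)
Let bnd (w F S : R -> R) (n : R) : measurable_fun I w -> (forall t, I t -> 0 <= w t) ->
  measurable_fun I F -> measurable_fun I S -> (forall t, I t -> 0 <= S t) -> 0 <= n ->
  (forall t, I t -> F t ^+ 2 <= S t * n ^+ 2) ->
  (\int[mu]_(t in I) (w t * S t)%:E = (volterra_const ^+ 2)%:E)%E ->
  hmem (L2w I w) F /\ hnorm (L2w I w) F <= volterra_const * n.
Proof.
move=> mw w0 mF mS S0 n0 FS wS.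
have h : (\int[mu]_(t in I) (F t ^+ 2 * w t)%:E <= ((volterra_const * n) ^+ 2)%:E)%E.
  rewrite exprMn mulrC EFinM -wS -ge0_integralZl_EFin ?sqr_ge0//; last 2 first.
  - by move=> t It; rewrite lee_fin mulr_ge0 ?w0 ?S0.
  - by apply/measurable_EFinP; exact: measurable_funM.
  apply: le_lint => //.
  - by apply/measurable_EFinP; apply: measurable_funM => //; exact: measurable_funX.
  - apply/measurable_EFinP; apply: measurable_funM; first exact: measurable_cst.
    exact: measurable_funM.
  - by move=> t It; rewrite lee_fin mulr_ge0 ?sqr_ge0// w0.
  - move=> t It; rewrite -EFinM lee_fin mulrCA (mulrC (F t ^+ 2)); apply: ler_wpM2l; first exact: w0.
    by rewrite mulrC; exact: FS.
have hF : hmem (L2w I w) F by split => //; apply: (le_lt_trans h); exact: ltry.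
by split => //; apply: L2w_norm_le => //; rewrite mulr_ge0.
Qed.

Lemma volterra_bounded : bounded_op Lq Lp (volterra q).
Proof.
have B f : hmem Lq f -> hmem Lp (volterra q f) /\
    hnorm Lp (volterra q f) <= volterra_const * hnorm Lq f.
  move=> hf; apply: (@bnd p _ Q) => //.
  - exact: volterra_measurable.
  - exact: hnorm_ge0.
  - by move=> t It; rewrite volterraE//; exact: (volterra_cs hf It).2.
  - by rewrite -volterra_constE; exact: volterra_hsE.
split.
- move=> a u v hu hv; apply/funext => t.
  rewrite -[RHS]/(a * volterra q u t + volterra q v t).
  have [It|nI] := pselect (I t); last by rewrite !volterra_out// mulr0 addr0.
  rewrite !volterraE//.
  have iu := (volterra_cs hu It).1; have iv := (volterra_cs hv It).1.
  rewrite -lRintegralZ// -lRintegralD//; last exact: lintegrableZ.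
  by apply: eq_lRint => r _; rewrite -[(a *: u + v) r]/(a * u r + v r); ring.
- by move=> f /B[].
- by exists volterra_const => // f /B[].
Qed.

Lemma volterra_adj_bounded : bounded_op Lp Lq (volterra_adj p).
Proof.
have B g : hmem Lp g -> hmem Lq (volterra_adj p g) /\
    hnorm Lq (volterra_adj p g) <= volterra_const * hnorm Lp g.
  move=> hg; apply: (@bnd q _ P) => //.
  - exact: volterra_adj_measurable.
  - exact: hnorm_ge0.
  - by move=> t It; rewrite volterra_adjE//; exact: (volterra_adj_cs hg It).2.
  - exact: volterra_constE.
split.
- move=> a u v hu hv; apply/funext => t.
  rewrite -[RHS]/(a * volterra_adj p u t + volterra_adj p v t).
  have [It|nI] := pselect (I t); last by rewrite !volterra_adj_out// mulr0 addr0.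
  rewrite !volterra_adjE//.
  have iu := (volterra_adj_cs hu It).1; have iv := (volterra_adj_cs hv It).1.
  rewrite -lRintegralZ// -lRintegralD//; last exact: lintegrableZ.
  by apply: eq_lRint => r _; rewrite -[(a *: u + v) r]/(a * u r + v r); ring.
- by move=> f /B[].
- by exists volterra_const => // f /B[].
Qed.

Lemma hmem_norm (w f : R -> R) : hmem (L2w I w) f -> hmem (L2w I w) (fun t => `|f t|).
Proof.
move=> [mf foo]; split; first exact: measurableT_comp.
by rewrite (eq_lint (g := fun x => (f x ^+ 2 * w x)%:E)) // => x _; rewrite real_normK ?num_real.
Qed.

(** Fubini's theorem on the triangle. Its finiteness condition is the inner product of [|g|] with
    the image of [|f|], finite because the operator is bounded. *)
Lemma volterra_adjoint f g : hmem Lq f -> hmem Lp g ->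
  ip Lp g (volterra q f) = ip Lq (volterra_adj p g) f.
Proof.
move=> hf hg; have [mf _] := hf; have [mg _] := hg.
have hf' := hmem_norm hf; have hg' := hmem_norm hg.
have hV := bop_hmem volterra_bounded hf'.
have gp := prehilbert_L2w mI mp p0.
rewrite /=.
transitivity (\int[mu]_(t in I) ((p t * g t) * \int[mu]_(r in `[0, t]) (q r * f r))).
  by apply: eq_lRint => t It; rewrite volterraE//; ring.
rewrite triangle_fubini.
- by apply: eq_lRint => r Ir; rewrite volterra_adjE//; ring.
- exact: measurable_funM.
- exact: measurable_funM.
- by move=> t It; exact: (volterra_cs hf It).1.
- by move=> t It; exact: (volterra_adj_cs hg It).1.
- rewrite (eq_lint (g := fun t => (`|g t| * volterra q (fun r => `|f r|) t * p t)%:E)).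
    rewrite -L2w_ip_int ?ltry//.
  move=> t It; rewrite volterraE// normrM (ger0_norm (p0 It)); congr EFin.
  have -> : \int[mu]_(r in `[0, t]) `|q r * f r| = \int[mu]_(r in `[0, t]) (q r * `|f r|).
    by apply: eq_lRint => r rt; rewrite normrM ger0_norm// q0//; exact: sub0 rt.
  by ring.
Qed.

End volterra_theory.

(** * Density of Lipschitz functions *)

Lemma lRint0 (R : realType) (D : set R) (f : R -> R) : (forall x, D x -> f x = 0) ->
  \int[@lebesgue_measure R]_(t in D) f t = 0.
Proof. by move=> f0; rewrite (@eq_lRint _ _ _ (cst 0))// /Rintegral integral0. Qed.

Lemma ae_forall_nat (R : realType) (P : nat -> R -> Prop) :
  (forall n, {ae @lebesgue_measure R, forall x, P n x}) ->
  {ae @lebesgue_measure R, forall x, forall n, P n x}.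
Proof.
move=> H; have := @negligible_bigcup _ _ _ (@lebesgue_measure R) (fun n => ~` [set x | P n x]) H.
apply: negligibleS => x /= /existsNP[n nP]; by exists n.
Qed.

Lemma ae_neq (R : realType) (c : R) : {ae @lebesgue_measure R, forall x, x != c}.
Proof.
exists [set c]; split => //; first exact: lebesgue_measure_set1.
by move=> x /= /negP; rewrite negbK => /eqP.
Qed.

Lemma ae_filterS (R : realType) (P Q : R -> Prop) : (forall x, P x -> Q x) ->
  {ae @lebesgue_measure R, forall x, P x} -> {ae @lebesgue_measure R, forall x, Q x}.
Proof.
by move=> PQ; apply: filterS; first exact: (ae_filter_ringOfSetsType (@lebesgue_measure R)).
Qed.

Lemma ae_filterS2 (R : realType) (P Q S : R -> Prop) : (forall x, P x -> Q x -> S x) ->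
  {ae @lebesgue_measure R, forall x, P x} -> {ae @lebesgue_measure R, forall x, Q x} ->
  {ae @lebesgue_measure R, forall x, S x}.
Proof.
by move=> PQ; apply: filterS2; first exact: (ae_filter_ringOfSetsType (@lebesgue_measure R)).
Qed.

Lemma ae_eq_lint (R : realType) (D : set R) (f g : R -> R) : measurable D ->
  measurable_fun D f -> measurable_fun D g ->
  {ae @lebesgue_measure R, forall x, D x -> f x = g x} ->
  \int[@lebesgue_measure R]_(t in D) f t = \int[@lebesgue_measure R]_(t in D) g t.
Proof.
move=> mD mf mg fg; rewrite /Rintegral; congr fine; apply: ae_eq_integral => //.
- exact/measurable_EFinP.
- exact/measurable_EFinP.
- by apply: ae_filterS fg => x fg Dx; rewrite fg.
Qed.

Lemma lipschitz_derive1 (R : realType) (L : R) (G : R -> R) (y : R) :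
  (forall x y, `|G x - G y| <= L * `|x - y|) -> derivable G y 1 -> `|derive1 G y| <= L.
Proof.
move=> GL dG.
have H : \forall h \near 0^', `|h^-1 *: (G (h *: 1 + y) - G y)| <= L.
  near=> h; have h0 : h != 0 by near: h; exact: nbhs_dnbhs_neq.
  rewrite normrZ normfV ler_pdivrMl ?normr_gt0//.
  apply: le_trans (GL _ _) _.
  by rewrite addrK [h *: 1]mulr1 mulrC.
rewrite derive1E ler_norml; apply/andP; split.
- apply: limr_ge; first exact: dG.
  by apply: filterS H => h; rewrite ler_norml => /andP[].
- apply: limr_le; first exact: dG.
  by apply: filterS H => h; rewrite ler_norml => /andP[].
Unshelve. all: by end_near. Qed.

Lemma lipschitz_abs_cont (R : realType) (L a b : R) (G : R -> R) : 0 <= L ->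
  (forall x y, `|G x - G y| <= L * `|x - y|) -> abs_cont a b (G : R -> R^o).
Proof.
move=> L0 GL e e0; exists (e / (L + 1)); first by rewrite divr_gt0// ltr_wpDl.
move=> n l r lr tI slt.
apply: le_lt_trans (_ : \sum_(i < n) (L * (r i - l i)) < e).
  apply: ler_sum => i _; have [_ [lri _]] := lr i.
  by apply: le_trans (GL _ _) _; rewrite ger0_norm ?subr_ge0.
rewrite -mulr_sumr.
have s0 : 0 <= \sum_(i < n) (r i - l i).
  by apply: sumr_ge0 => i _; rewrite subr_ge0; have [_ []] := lr i.
rewrite ltr_pdivlMr in slt; last by rewrite ltr_wpDl.
apply: le_lt_trans slt; rewrite mulrC; apply: ler_wpM2l => //; lra.
Qed.

Lemma lipschitz_integral (R : realType) (L b : R) (G : R -> R) : 0 <= L -> 0 <= b ->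
  (forall x y, `|G x - G y| <= L * `|x - y|) ->
  exists h : R -> R, [/\ measurable_fun setT h, forall x, `|h x| <= L &
    forall x, 0 <= x <= b -> G x = G 0 + \int[@lebesgue_measure R]_(t in `[0, x]) h t].
Proof.
move=> L0 b0 GL.
have acG := lipschitz_abs_cont 0 b L0 GL.
have [h0 [ih hE]] := abs_cont_integral b0 acG.
have mh0 : measurable_fun setT h0.
  by apply/measurable_EFinP; exact: (@measurable_int _ (measurableTypeR R) _ _ _ _ ih).
have hae := integral_derive1_ae ih hE.
(* The density obeys the bound [L] only almost everywhere; truncating it makes the bound hold at
   every point. *)
pose h x := Num.max (- L) (Num.min L (h0 x)).
have mh : measurable_fun setT h.
  apply: measurable_maxr; first exact: measurable_cst.
  by apply: measurable_minr => //; exact: measurable_cst.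
have hL x : `|h x| <= L.
  rewrite ler_norml /h le_max lexx/= ge_max ge_min lexx/= andbT; lra.
exists h; split => // x xb; rewrite hE//; congr (_ + _).
apply: ae_eq_lint => //.
- exact: measurable_funS mh0.
- exact: measurable_funS mh.
- have := ae_filterS2 _ (ae_neq 0) (ae_filterS2 _ (ae_neq b) hae).
  move=> /(_ (fun y => y != b /\ (y \in `]0, b[ -> derivable G y 1 /\ derive1 G y = h0 y))).
  move=> /(_ (fun y => y != 0 /\ y != b /\ (y \in `]0, b[ -> derivable G y 1 /\ derive1 G y = h0 y))).
  move=> H; have {}H := H (fun _ p q => conj p q) (fun _ p q => conj p q).
  apply: ae_filterS H => y [y0 [yb H]] /=; rewrite in_itv/= => /andP[y0' yx].
  have [_ xb'] := andP xb.
  have [|dG GE] := H; first by rewrite in_itv/= !lt_neqAle eq_sym y0 y0' yb (le_trans yx xb').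
  have := lipschitz_derive1 GL dG; rewrite GE ler_norml => /andP[h1 h2].
  by rewrite /h (min_idPr h2) (max_idPr h1).
Qed.

Lemma lipschitz_integral_supp (R : realType) (L c : R) (G : R -> R) : 0 <= L -> 0 <= c -> c < 1 ->
  (forall x y, `|G x - G y| <= L * `|x - y|) -> (forall x, c <= x -> G x = 0) ->
  exists h : R -> R, [/\ measurable_fun setT h, forall x, `|h x| <= L,
    forall x, c < x -> h x = 0 &
    forall x, 0 <= x -> G x = G 0 + \int[@lebesgue_measure R]_(t in `[0, x]) h t].
Proof.
move=> L0 c0 c1 GL Gc; have [h0 [mh0 h0L hE]] := lipschitz_integral L0 c0 GL.
have mc : measurable (`]-oo, c] : set R) by exact: measurable_itv.
have mh : measurable_fun setT (h0 \_ `]-oo, c]).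
  apply/(measurable_restrictT _ mc); exact: measurable_funS mh0.
have hin x : x <= c -> (h0 \_ `]-oo, c]) x = h0 x.
  by move=> xc; rewrite patchE mem_set//= in_itv.
have hout x : c < x -> (h0 \_ `]-oo, c]) x = 0.
  by move=> xc; rewrite patchE memNset//= in_itv/= leNgt xc.
have hL x : `|(h0 \_ `]-oo, c]) x| <= L.
  by have [/hin ->|/hout ->] := leP x c; rewrite ?normr0.
exists (h0 \_ `]-oo, c]); split => // x x0.
have ih b : (@lebesgue_measure R).-integrable `[0, b] (EFin \o (h0 \_ `]-oo, c])).
  apply: (@le_lintegrable _ _ _ (cst L)) => //; first exact: measurable_funS mh.
  exact: lintegrable_cst_itv.
have small y : 0 <= y -> y <= c -> G y = G 0 + \int[@lebesgue_measure R]_(t in `[0, y]) (h0 \_ `]-oo, c]) t.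
  move=> y0 yc; rewrite hE ?y0//; congr (_ + _); apply: eq_lRint => t /=.
  by rewrite in_itv/= => /andP[_ ty]; rewrite hin// (le_trans ty).
have [xc|cx] := leP x c; first exact: small.
rewrite (@lRint_split _ 0 c (BRight x)) ?bnd_simp ?(ltW cx)//.
have E := small c c0 (lexx c).
rewrite addrA -E (Gc c)// (Gc x (ltW cx)) add0r; apply/esym.
rewrite -(@Rintegral_itv_obnd_cbnd R c (BRight x)); last first.
  by apply: integrableS (ih x) => //; apply: subset_itvr; rewrite bnd_simp.
rewrite (@eq_lRint _ _ _ (cst 0)); first by rewrite /Rintegral integral0.
by move=> t /=; rewrite in_itv/= => /andP[/hout].
Qed.

Section density.
Variables (R : realType) (w : R -> R).
Notation I := (itv01 : set R).
Let mu := @lebesgue_measure R.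
Hypotheses (mw : measurable_fun I w) (w0 : forall t, I t -> 0 <= w t)
  (wb : forall b : R, b < 1 -> exists M, forall t, 0 <= t <= b -> w t <= M).
Let mI : measurable I. Proof. exact: measurable_itv. Qed.
Let gw := prehilbert_L2w mI mw w0.

(** Dominated convergence as convergence in norm; the membership of the difference is supplied by
    the caller once [n] is known. *)
Let dct (f g : R -> R) (F : nat -> R -> R) : measurable_fun I f ->
  (forall n, measurable_fun I (F n)) ->
  {ae mu, forall x, I x -> F ^~ x @ \oo --> f x} ->
  (forall n x, I x -> (F n x - f x) ^+ 2 * w x <= g x) ->
  mu.-integrable I (EFin \o g) ->
  forall e : R, 0 < e -> exists n, forall (hFf : hmem (L2w I w) (F n - f)),
    hnorm (L2w I w) (F n - f) < e.
Proof.
move=> mf mF Ff Fg ig e e0.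
have e20 : 0 < e ^+ 2 by rewrite exprn_gt0.
have := @dominated_convergence _ (measurableTypeR R) R mu I mI
  (fun n x => ((F n x - f x) ^+ 2 * w x)%:E) (cst 0%E) (EFin \o g).
have mFf n : measurable_fun I (fun x => (F n x - f x) ^+ 2 * w x).
  by apply: measurable_funM => //; apply: measurable_funX; exact: measurable_funB.
case.
- move=> n; apply/measurable_EFinP; exact: mFf.
- exact: measurable_cst.
- apply: ae_filterS Ff => x H Ix.
  have := H Ix => /cvgrPdist_lt Hx.
  rewrite (_ : cst 0%E x = (0 : R)%:E)//.
  apply: cvg_EFin; first exact: nearW.
  rewrite (_ : _ \o _ = (fun n => (F n x - f x) ^+ 2 * w x)); last by apply/funext.
  rewrite -(mul0r (w x)); apply: cvgMl.
  rewrite (_ : 0 = (f x - f x) ^+ 2); last by rewrite subrr expr0n.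
  rewrite expr2; under eq_fun do rewrite expr2.
  by apply: cvgM; apply: cvgB => //; [exact: H Ix|exact: cvg_cst|exact: H Ix|exact: cvg_cst].
- exact: ig.
- apply: aeW => x n Ix; rewrite gee0_abs ?lee_fin ?Fg//.
  by rewrite mulr_ge0 ?sqr_ge0// w0.
move=> _ _; rewrite integral0 => /fine_cvgP[finF].
move=> /cvgrPdist_lt/(_ _ e20); move: finF => /[swap] H1 H2.
have [n [Hn1 Hn2]] : exists n, (\int[mu]_(x in I) ((F n x - f x) ^+ 2 * w x)%:E)%E \is a fin_num /\
    `|0 - fine (\int[mu]_(x in I) ((F n x - f x) ^+ 2 * w x)%:E)%E| < e ^+ 2.
  have /filter_ex[n [? ?]] : \forall n \near \oo,
    (\int[mu]_(x in I) ((F n x - f x) ^+ 2 * w x)%:E)%E \is a fin_num /\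
    `|0 - fine (\int[mu]_(x in I) ((F n x - f x) ^+ 2 * w x)%:E)%E| < e ^+ 2.
    by near=> n; split; near: n.
  by exists n.
exists n => hFf; rewrite -(@ltr_pXn2r _ 2)// ?nnegrE ?hnorm_ge0 ?ltW//.
rewrite -lte_fin L2w_norm_int//.
move: Hn2; rewrite sub0r normrN => /(le_lt_trans (ler_norm _)).
by rewrite -lte_fin fineK.
Unshelve. all: by end_near. Qed.

(** Such functions lie in the ranges of both Volterra operators: they vanish at both ends, and their
    derivatives are bounded and vanish near 1, where the weights may be unbounded. *)
Lemma lipschitz_dense (f : R -> R) (e : R) : hmem (L2w I w) f -> 0 < e ->
  exists (G : R -> R) (L c : R), [/\ 0 <= L, 0 <= c < 1,
    (forall x y, `|G x - G y| <= L * `|x - y|) /\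
    (forall x, x <= 0 -> G x = 0) /\ (forall x, c <= x -> G x = 0),
    hmem (L2w I w) G & hnorm (L2w I w) (f - G) < e].
Proof.
move=> hf e0; have e20 : 0 < e / 2 by lra.
have [mf foo] := hf.
have ifw : mu.-integrable I (EFin \o (fun x => f x ^+ 2 * w x)).
  apply: (eq_lintegrable mI _ (L2w_integrable mI mw w0 hf hf)).
  by move=> x _; rewrite expr2.
(* [G] is a difference quotient of the primitive of a truncation of [f]. *)
pose D n : set R := [set x | `|f x| <= n%:R] `&` `[0, 1 - n.+1%:R^-1].
have DI n : D n `<=` I.
  move=> x [_] /=; rewrite !in_itv/= => /andP[-> xn]; apply: (le_lt_trans xn).
  by rewrite ltrBlDr ltrDl invr_gt0.
pose T n : R -> R := f \_ (D n).
have mD n : measurable (I `&` D n).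
  rewrite /D setIA; apply: measurableI => //.
  rewrite -[X in measurable (_ `&` X)]/((fun x => `|f x| <= n%:R) @^-1` [set true]).
  have : measurable_fun I (fun x => `|f x| <= n%:R).
    by apply: measurable_fun_ler => //; exact: measurableT_comp.
  exact.
have mT n : measurable_fun I (T n).
  have mD' : measurable (D n) by rewrite -(setIidr (DI n)).
  apply: ((measurable_restrict f mD' mI).1 _).
  apply: (measurable_funS mI _ mf).
  by move=> x [].
have TE n x : D n x -> T n x = f x by move=> Dx; rewrite /T patchE mem_set.
have T0 n x : ~ D n x -> T n x = 0 by move=> Dx; rewrite /T patchE memNset.
have Tn n x : `|T n x| <= n%:R.
  have [Dx|Dx] := pselect (D n x); last by rewrite T0// normr0.
  by rewrite TE//; case: Dx.
have hT n : hmem (L2w I w) (T n).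
  split => //; apply: le_lt_trans foo; apply: le_lint => //.
  - by apply/measurable_EFinP; apply: measurable_funM => //; exact: measurable_funX.
  - by apply/measurable_EFinP; apply: measurable_funM => //; exact: measurable_funX.
  - by move=> x Ix; rewrite lee_fin mulr_ge0 ?sqr_ge0// w0.
  - move=> x Ix; rewrite lee_fin ler_wpM2r ?w0//.
    by have [/TE ->//|/T0 ->] := pselect (D n x); rewrite expr0n/= sqr_ge0.
have [||n Hn] := @dct f (fun x => f x ^+ 2 * w x) T mf mT _ _ ifw _ e20.
- apply: aeW; rewrite -/(forall x : R, I x -> T ^~ x @ \oo --> f x).
  move=> x Ix; apply: cvg_near_cst; near=> n; apply: TE; split => /=.
    by near: n; exact: nbhs_infty_ger.
  have := Ix; rewrite /= !in_itv/= => /andP[-> x1] /=.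
  have x1' : 0 < 1 - x by lra.
  have h : (1 - x)^-1 <= n%:R by near: n; exact: nbhs_infty_ger.
  rewrite lerBrDr addrC -lerBrDr.
  rewrite -[leRHS]invrK lef_pV2 ?posrE ?invr_gt0//.
  by apply: (le_trans h); rewrite ler_nat.
- move=> n x Ix; rewrite ler_wpM2r ?w0//.
  have [/TE ->|/T0 ->] := pselect (D n x); first by rewrite subrr expr0n/= sqr_ge0.
  by rewrite sub0r sqrrN.
have hTf := hmemB gw (hT n) hf; have {}Hn := Hn hTf.
pose c0 : R := 1 - n.+1%:R^-1.
have c0I : 0 <= c0 < 1.
  by rewrite subr_ge0 invf_le1// ler1n /= ltrBlDr ltrDl invr_gt0.
have [c00 c01] := andP c0I.
pose g : R -> R := T n \_ I.
have gT x : I x -> g x = T n x by move=> Ix; rewrite /g patchE mem_set.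
have g0 x : x < 0 \/ c0 < x -> g x = 0.
  move=> h; rewrite /g patchE; case: ifPn => // /set_mem Ix; apply: T0 => -[_].
  by rewrite /= in_itv/= -/c0; move: Ix; rewrite /= in_itv/= => /andP[? ?] /andP[? ?]; lra.
have gn x : `|g x| <= n%:R by rewrite /g patchE; case: ifPn => // _; rewrite normr0.
have mg : measurable_fun setT g by apply/(measurable_restrictT _ mI).
have ig : mu.-integrable setT (EFin \o g).
  have -> : g = g \_ `[0, 1].
    apply/funext => x; rewrite [RHS]patchE; case: ifPn => // /negP nx; apply: g0.
    have [x0|x0] := ltP x 0; [by left|right].
    have [//|xc] := ltP c0 x; exfalso; apply: nx; rewrite mem_set//= in_itv/= x0/=; lra.
  have := @integrable_mkcond _ (measurableTypeR R) R mu `[0, 1]%classic (EFin \o g) (measurable_itv _).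
  rewrite -(restrict_EFin g) => h; apply: (proj1 h).
  apply: (@le_lintegrable _ _ _ (cst n%:R)) => //; first exact: measurable_funS mg.
  exact: lintegrable_cst_itv.
pose F x : R := \int[mu]_(t in `[0, x]) g t.
have F0 x : x <= 0 -> F x = 0.
  rewrite le_eqVlt => /predU1P[->|x0]; first by rewrite /F set_itv1 Rintegral_set1.
  by rewrite /F set_itv_ge ?Rintegral_set0// bnd_simp -ltNge.
have igS x y : mu.-integrable `[x, y] (EFin \o g) by exact: integrableS ig.
have Flip0 x y : 0 <= x -> x <= y -> `|F y - F x| <= n%:R * (y - x).
  move=> x0 xy; rewrite /F (@lRint_split _ 0 x (BRight y)) ?bnd_simp// addrAC subrr add0r.
  have := @le_normr_Rintegral _ (measurableTypeR R) R mu `[x, y]%classic g (measurable_itv _) (igS x y).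
  move=> /le_trans; apply.
  have ic := lintegrable_cst_itv x y n%:R.
  apply: (@le_trans _ _ (\int[mu]_(t in `[x, y]) cst n%:R t)).
    apply: (@le_Rintegral _ (measurableTypeR R) R mu _ _ _ (measurable_itv _)) => //.
    exact: (integrable_norm (igS x y)).
  rewrite (@Rintegral_cst _ (measurableTypeR R) R mu _ (measurable_itv _)).
  apply: ler_wpM2l => //.
  have -> : y - x = fine (@lebesgue_measure R `[x, y]%classic); last exact: lexx.
  rewrite lebesgue_measure_itv/= lte_fin; case: ltP => [_|yx] /=; first by [].
  by apply/eqP; rewrite subr_eq0 eq_le xy yx.
have Flip x y : `|F x - F y| <= n%:R * `|x - y|.
  wlog xy : x y / y <= x.
    move=> H; have [|/ltW] := leP y x; first exact: H.
    by rewrite distrC (distrC x); exact: H.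
  rewrite [X in _ <= _ * X]ger0_norm ?subr_ge0//.
  have [y0|y0] := leP 0 y; first exact: Flip0.
  have [x0|x0] := leP x 0.
    by rewrite !F0 ?(ltW y0)// subrr normr0 mulr_ge0// subr_ge0.
  have := Flip0 0 x (lexx 0) (ltW x0); rewrite (F0 0)// (F0 y (ltW y0)).
  by move=> /le_trans; apply; apply: ler_wpM2l => //; rewrite lerD2l lerN2 ltW.
have Fc x : c0 <= x -> F x = F c0.
  move=> cx; rewrite /F (@lRint_split _ 0 c0 (BRight x)) ?bnd_simp//.
  rewrite -(@Rintegral_itv_obnd_cbnd R c0 (BRight x)); last first.
    by apply: integrableS ig.
  rewrite [X in _ + X]lRint0 ?addr0//.
  by move=> t /=; rewrite in_itv/= => /andP[h _]; apply: g0; right.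
pose d : R := (1 - c0) / 2.
have d0 : 0 < d by rewrite /d; lra.
pose s k : R := d / k.+1%:R.
have s0 k : 0 < s k by rewrite divr_gt0.
have sd k : s k <= d by rewrite ler_pdivrMr// (ler_peMr (ltW d0))// ler1n.
(* A backward quotient, so that it vanishes for [x <= 0] along with [F]. The support grows by at
   most [d], half the distance from [c0] to 1. *)
pose G k x : R := (F x - F (x - s k)) / s k.
have Ls k : 0 <= n%:R * 2 / s k by apply: divr_ge0; [exact: mulr_ge0|exact: ltW].
have Glip k x y : `|G k x - G k y| <= (n%:R * 2 / s k) * `|x - y|.
  rewrite /G -mulrBl normrM [X in _ * X]gtr0_norm ?invr_gt0//.
  rewrite mulrAC ler_pM2r ?invr_gt0//.
  rewrite subrACA; apply: le_trans (ler_normB _ _) _.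
  have := Flip x y; have := Flip (x - s k) (y - s k).
  rewrite (_ : x - s k - (y - s k) = x - y); last by ring.
  clear; lra.
have G0 k x : x <= 0 -> G k x = 0.
  move=> x0; rewrite /G (F0 _ x0) (F0 (x - s k)) ?subrr ?mul0r//.
  by rewrite lerBlDr add0r (le_trans x0)// ltW.
pose c1 := c0 + d.
have c1I : 0 <= c1 < 1.
  by rewrite /c1 addr_ge0 ?(ltW d0)//= -ltrBrDl /d ltr_pdivrMr// ltr_pMr ?subr_gt0 ?ltr1n.
have Gc k x : c1 <= x -> G k x = 0.
  move=> cx; have xs : c0 <= x - s k by rewrite lerBrDr (le_trans _ cx)// lerD2l sd.
  have xc : c0 <= x by rewrite (le_trans xs)// gerBl ltW.
  by rewrite /G !Fc// subrr mul0r.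
have Gn k x : `|G k x| <= n%:R.
  rewrite /G normrM [X in _ * X]gtr0_norm ?invr_gt0// ler_pdivrMr//.
  have := Flip x (x - s k); by rewrite subKr (gtr0_norm (s0 k)).
have mG k : measurable_fun I (G k).
  apply: loc_abs_cont_measurable01 => a b _.
  exact: lipschitz_abs_cont (Ls k) (Glip k).
have [M HM] : exists M, forall t, 0 <= t <= c1 -> w t <= M by apply: wb; case/andP: c1I.
have hG k : hmem (L2w I w) (G k).
  split => //; apply: (@le_lt_trans _ _ (\int[mu]_(x in I) (cst (n%:R ^+ 2 * `|M|) x)%:E)%E).
    apply: le_lint => //.
    - by apply/measurable_EFinP; apply: measurable_funM => //; exact: measurable_funX.
    - by apply/measurable_EFinP; exact: measurable_cst.
    - by move=> x Ix; rewrite lee_fin mulr_ge0 ?sqr_ge0// w0.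
    - move=> x Ix; rewrite lee_fin; have [c1x|xc1] := leP c1 x.
        by rewrite Gc// expr0n/= mul0r mulr_ge0// sqr_ge0.
      apply: ler_pM; rewrite ?sqr_ge0 ?w0//.
        by rewrite -[leLHS]real_normK ?num_real// lerXn2r// nnegrE.
      apply: le_trans (ler_norm _); apply: HM.
      by move: Ix; rewrite /= in_itv/= => /andP[-> _]; exact: ltW.
  apply: lint_lty => //.
  by apply: integrableS (lintegrable_cst_itv 0 1 _) => //; apply: subset_itvl; rewrite bnd_simp.
have [||||k Hk] := @dct g (fun x => (n%:R * 2) ^+ 2 * `|M|) G _ mG _ _ _ _ e20.
- exact: measurable_funS mg.
- have FE x : 0 <= x <= 1 -> F x = F 0 + \int[mu]_(t in `[0, x]) g t by rewrite (F0 0 (lexx 0)) add0r.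
  apply: ae_filterS2 (integral_derive1_ae ig FE) (ae_neq 0) => x H x0 Ix.
  have [|dF FEx] := H.
    by move: Ix; rewrite /= !in_itv/= => /andP[h ->]; rewrite andbT lt_neqAle eq_sym x0 h.
  have sk0 : s k @[k --> \oo] --> (0 : R).
    rewrite -(mulr0 d); apply: cvgMr; exact: cvg_harmonic.
  have := (cvgr_dnbhsP (fun h => h^-1 *: (F (h *: 1 + x) - F x)) 0 (derive1 F x)).1.
  rewrite {1}derive1E => /(_ dF (fun k => - s k)).
  have GE : (fun k => (- s k)^-1 *: (F (- s k *: 1 + x) - F x)) = G ^~ x.
    apply/funext => k; rewrite /G [- s k *: 1]mulr1 [- s k + x]addrC.
    by rewrite invrN scaleNr -scalerN opprB [LHS]mulrC.
  rewrite GE FEx; apply; split => [k|].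
    by rewrite oppr_eq0 gt_eqF.
  by rewrite -oppr0; apply: cvgN.
- move=> k x Ix; have [c1x|xc1] := leP c1 x.
    rewrite Gc// g0; first by rewrite subrr expr0n/= mul0r mulr_ge0// sqr_ge0.
    by right; rewrite (lt_le_trans _ c1x)// ltrDl.
  apply: ler_pM; rewrite ?sqr_ge0 ?w0//.
    rewrite -[leLHS]real_normK ?num_real// lerXn2r ?nnegrE ?mulr_ge0//.
    apply: le_trans (ler_normB _ _) _; rewrite mulr_natr mulr2n; exact: lerD (Gn k x) (gn x).
  apply: le_trans (ler_norm _); apply: HM.
  by move: Ix; rewrite /= in_itv/= => /andP[-> _]; exact: ltW.
- by apply: integrableS (lintegrable_cst_itv 0 1 _) => //; apply: subset_itvl; rewrite bnd_simp.
exists (G k), (n%:R * 2 / s k), c1; split => //.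
- by split; [exact: Glip|split; [exact: G0|exact: Gc]].
- have hgT : hequiv (L2w I w) g (T n) by apply: eq_hequiv_L2w => // x; exact: gT.
  have hg : hmem (L2w I w) g by apply: eq_hmem_L2w (hT n) => // x Ix; rewrite gT.
  have {}Hk := Hk (hmemB gw (hG k) hg).
  have -> : f - G k = (f - T n) + ((T n - g) + (g - G k)).
    by rewrite !addrA subrK subrK.
  have h1 := hmemB gw hf (hT n); have h2 := hmemB gw (hT n) hg; have h3 := hmemB gw hg (hG k).
  apply: le_lt_trans (hnorm_tri gw h1 (hmemD gw h2 h3)) _.
  have := hnorm_tri gw h2 h3; have := hequiv_sym gw hg (hT n) hgT; rewrite /hequiv => ->.
  rewrite (hnormB gw hf (hT n)) (hnormB gw hg (hG k)).
  move: Hn Hk; lra.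
Unshelve. all: by end_near. Qed.

End density.

(** * Density of the ranges of the Volterra operators *)

Section volterra_density.
Variables (R : realType) (p q : R -> R).
Hypotheses (vw : volterra_weights p q)
  (pq : forall t, (itv01 : set R) t -> p t * q t = 4^-1).
Notation I := (itv01 : set R).
Let mu := @lebesgue_measure R.
Let mI : measurable I. Proof. exact: measurable_itv. Qed.
Notation Lp := (L2w I p).
Notation Lq := (L2w I q).

(** As [v w = 1/4], division by [v] is multiplication by [4 w], and [(4 w h)^2 v = 4 w h^2] is
    bounded: [w] is bounded up to [c] and [h] vanishes beyond. *)
Let hmem_div (v w h : R -> R) (L c : R) : measurable_fun I v -> measurable_fun I w ->
  (forall t, I t -> 0 < w t) -> (forall t, I t -> v t * w t = 4^-1) ->
  (forall b, b < 1 -> exists M, forall t, 0 <= t <= b -> w t <= M) ->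
  measurable_fun setT h -> c < 1 -> (forall x, `|h x| <= L) -> (forall x, c < x -> h x = 0) ->
  hmem (L2w I v) (fun t => 4 * (w t * h t)).
Proof.
move=> mv mw w0 vwE wb mh c1 hL hc.
have [M HM] := wb c c1.
have E t : I t -> (4 * (w t * h t)) ^+ 2 * v t = 4 * (w t * h t ^+ 2).
  move=> It; have -> : (4 * (w t * h t)) ^+ 2 * v t = 16 * (v t * w t) * (w t * h t ^+ 2) by ring.
  by rewrite vwE//; field.
have mhI : measurable_fun I h by exact: measurable_funS mh.
split.
  by apply: measurable_funM; [exact: measurable_cst|exact: measurable_funM].
have ic : mu.-integrable I (EFin \o cst (4 * (`|M| * L ^+ 2))).
  by apply: integrableS (lintegrable_cst_itv 0 1 _) => //; apply: subset_itvl; rewrite bnd_simp.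
apply: (@lint_lty _ _ (fun t => (4 * (w t * h t)) ^+ 2 * v t)) => //.
apply: (le_lintegrable mI _ _ ic).
  apply: measurable_funM => //; apply: measurable_funX.
  by apply: measurable_funM; [exact: measurable_cst|exact: measurable_funM].
move=> t It; rewrite E// ger0_norm; last first.
  by rewrite mulr_ge0// mulr_ge0 ?sqr_ge0// ltW// w0.
apply: ler_wpM2l => //; have [tc|ct] := leP t c; last first.
  by rewrite hc// expr0n/= mulr0 mulr_ge0// sqr_ge0.
apply: ler_pM; rewrite ?sqr_ge0 ?(ltW (w0 _ It))//.
  apply: le_trans (ler_norm _); apply: HM.
  by move: It; rewrite /= in_itv/= => /andP[-> _].
by rewrite -[leLHS]real_normK ?num_real// lerXn2r// nnegrE (le_trans _ (hL t)).
Qed.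

Let qb (b : R) : b < 1 -> exists M, forall t, 0 <= t <= b -> q t <= M.
Proof. by move=> /(vw_bound vw)[M HM]; exists M => t /HM[]. Qed.

Let pb (b : R) : b < 1 -> exists M, forall t, 0 <= t <= b -> p t <= M.
Proof. by move=> /(vw_bound vw)[M HM]; exists M => t /HM[]. Qed.

Lemma volterra_dense f (e : R) : hmem Lp f -> 0 < e ->
  exists phi, hmem Lq phi /\ hnorm Lp (f - volterra q phi) < e.
Proof.
move=> hf e0.
have [G [L [c [L0 /andP[c0 c1] [GL [G0 Gc]] hG fG]]]] :=
  lipschitz_dense (vw_mp vw) (fun t It => ltW (vw_p0 vw It)) pb hf e0.
have [h [mh hL hc hE]] := lipschitz_integral_supp L0 c0 c1 GL Gc.
(* This is [G' / q], since [p q = 1/4]. *)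
exists (fun t => 4 * (p t * h t)); split.
  apply: (hmem_div (vw_mq vw) (vw_mp vw) (vw_p0 vw) _ pb mh c1 hL hc).
  by move=> t It; rewrite mulrC pq.
have VE t : I t -> volterra q (fun t => 4 * (p t * h t)) t = G t.
  move=> It; rewrite volterraE// hE; last by move: It; rewrite /= in_itv/= => /andP[].
  rewrite (G0 0 (lexx 0)) add0r; apply: eq_lRint => r /= rt.
  have Ir : I r.
    by move: It rt; rewrite /= !in_itv/= => /andP[_ t1] /andP[-> rt]; exact: le_lt_trans t1.
  have -> : q r * (4 * (p r * h r)) = 4 * (p r * q r) * h r by ring.
  by rewrite pq//; field.
rewrite (_ : hnorm _ _ = hnorm Lp (f - G))//.
rewrite /hnorm; congr (Num.sqrt _); apply: eq_lRint => t It.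
have -> : (f - volterra q (fun t => 4 * (p t * h t))) t = (f - G) t.
  by rewrite -[LHS]/(f t - volterra q (fun t => 4 * (p t * h t)) t) VE.
by [].
Qed.

Lemma volterra_adj_dense f (e : R) : hmem Lq f -> 0 < e ->
  exists psi, hmem Lp psi /\ hnorm Lq (f - volterra_adj p psi) < e.
Proof.
move=> hf e0.
have [G [L [c [L0 /andP[c0 c1] [GL [G0 Gc]] hG fG]]]] :=
  lipschitz_dense (vw_mq vw) (fun t It => ltW (vw_q0 vw It)) qb hf e0.
have [h [mh hL hc hE]] := lipschitz_integral_supp L0 c0 c1 GL Gc.
have mh' : measurable_fun setT (fun t => - h t) by exact: measurableT_comp.
(* This is [- G' / p]. *)
exists (fun t => 4 * (q t * - h t)); split.
  apply: (hmem_div (vw_mp vw) (vw_mq vw) (vw_q0 vw) pq qb mh' c1).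
    by move=> x; rewrite normrN; exact: hL.
  by move=> x /hc ->; rewrite oppr0.
have ih : mu.-integrable I (EFin \o h).
  apply: (@le_lintegrable _ _ _ (cst L)) => //; first exact: measurable_funS mh.
  by apply: integrableS (lintegrable_cst_itv 0 1 _) => //; apply: subset_itvl; rewrite bnd_simp.
(* [G] vanishes at 1 as well as at 0; hence the integral of [- h] from [t] to 1 equals that of [h]
   from 0 to [t], which is [G t]. *)
have h01 : \int[mu]_(r in `[0, 1[) h r = 0.
  have -> : \int[mu]_(r in `[0, 1[) h r = \int[mu]_(r in `[0, 1]) h r.
    apply: (@Rintegral_itv_bndo_bndc R (BLeft 0) 1 h).
    by apply: integrableS ih.
  by have := hE 1 ler01; rewrite (G0 0)// add0r => <-; apply: Gc; exact: ltW.
have VE t : I t -> volterra_adj p (fun t => 4 * (q t * - h t)) t = G t.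
  move=> It; have := It; rewrite /= in_itv/= => /andP[t0 t1].
  rewrite volterra_adjE// hE// (G0 0 (lexx 0)) add0r.
  have St : `[t, 1[ `<=` I by apply: subset_itvr; rewrite bnd_simp.
  have it : mu.-integrable `[t, 1[ (EFin \o h) by exact: integrableS ih.
  have := h01; rewrite (@lRint_split _ 0 t (BLeft 1) h t0)//.
  move=> /eqP; rewrite addr_eq0 => /eqP ->.
  rewrite -mulN1r -lRintegralZ//; apply: eq_lRint => r /= rt.
  have Ir : I r by exact: St.
  have -> : p r * (4 * (q r * - h r)) = 4 * (p r * q r) * - h r by ring.
  by rewrite pq//; field.
rewrite (_ : hnorm _ _ = hnorm Lq (f - G))//.
rewrite /hnorm; congr (Num.sqrt _); apply: eq_lRint => t It.
have -> : (f - volterra_adj p (fun t => 4 * (q t * - h t))) t = (f - G) t.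
  by rewrite -[LHS]/(f t - volterra_adj p (fun t => 4 * (q t * - h t)) t) VE.
by [].
Qed.

End volterra_density.

(** [v] is the integral of some density, which agrees with [g] almost everywhere because both are
    the derivative of [v]. The equation for [g] is asked only where [v] is derivable, as [derive1]
    is meaningless elsewhere; integrability of [g] is a conclusion. *)
Lemma abs_cont_primitive (R : realType) (I : set R) (v g : R -> R) (a b : R) :
  measurable I -> loc_abs_cont I (v : R -> R^o) -> `[a, b] `<=` I -> a <= b ->
  measurable_fun I g ->
  {ae @lebesgue_measure R, forall x, I x -> derivable v x 1 -> g x = derive1 v x} ->
  (@lebesgue_measure R).-integrable `[a, b] (EFin \o g) /\
  v b = v a + \int[@lebesgue_measure R]_(x in `[a, b]) g x.
Proof.
move=> mI acv abI ab mg gE.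
have [h [ih vE]] := abs_cont_integral ab (acv a b abI).
have hE := integral_derive1_ae ih vE.
have ihab : (@lebesgue_measure R).-integrable `[a, b] (EFin \o h) by exact: integrableS ih.
have mgab : measurable_fun `[a, b] g by exact: measurable_funS mg.
have mhab : measurable_fun `[a, b] h by apply/measurable_EFinP; exact: measurable_int ihab.
have E : {ae @lebesgue_measure R, forall x, `[a, b]%classic x -> h x = g x}.
  have := ae_filterS2 (fun x p q => conj p q) (ae_filterS2 (fun x p q => conj p q) (ae_neq a) (ae_neq b))
    (ae_filterS2 (fun x p q => conj p q) hE gE).
  apply: ae_filterS => x [[xa xb] [H1 H2]] axb.
  have [|dv <-] := H1.
    by move: axb; rewrite /= !in_itv/= !le_eqVlt (eq_sym a) (negPf xa) (negPf xb).
  by rewrite H2//; exact: abI.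
split; last by rewrite vE ?ab ?lexx//; congr (_ + _); exact: ae_eq_lint.
have /integrableP[_ hoo] := ihab.
apply/integrableP; split; first exact/measurable_EFinP.
apply: le_lt_trans hoo; rewrite le_eqVlt; apply/orP; left; apply/eqP.
apply: (@ae_eq_integral _ (measurableTypeR R) R (@lebesgue_measure R) _ _ _ (measurable_itv _)).
- by apply: measurableT_comp => //; exact/measurable_EFinP.
- by apply: measurableT_comp => //; exact/measurable_EFinP.
- by apply: ae_filterS E => x + Dx /= => ->.
Qed.

(** Exhaust [I] by the intervals [[a, b n]]; on each of them the integrand, extended by 0, is
    integrable over the line. *)
Lemma primitive_derive1_ae (R : realType) (I : set R) (v g : R -> R) (a : R) (b : nat -> R) :
  (forall n, I (b n)) -> (forall x, I x -> a <= x /\ exists n, x < b n) ->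
  (forall x, I x -> (@lebesgue_measure R).-integrable `[a, x] (EFin \o g)) ->
  (forall x y, I x -> a <= y <= x -> I y) ->
  (forall x, I x -> v x = v a + \int[@lebesgue_measure R]_(t in `[a, x]) g t) ->
  {ae @lebesgue_measure R, forall x, I x -> derivable v x 1 /\ derive1 v x = g x}.
Proof.
move=> Ib I0 ig sI vE.
have H n : {ae @lebesgue_measure R, forall x, x \in `]a, b n[ -> derivable v x 1 /\ derive1 v x = g x}.
  pose h : R -> R := g \_ `[a, b n].
  have ih : (@lebesgue_measure R).-integrable setT (EFin \o h).
    have := @integrable_mkcond _ (measurableTypeR R) R (@lebesgue_measure R) `[a, b n]%classic (EFin \o g) (measurable_itv _).
    by rewrite -(restrict_EFin g) => H; apply: (proj1 H); exact: ig.
  have hE x : a <= x <= b n -> v x = v a + \int[@lebesgue_measure R]_(t in `[a, x]) h t.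
    move=> axb; rewrite vE; last exact: sI axb.
    congr (_ + _); apply: eq_lRint => t /= atx; rewrite /h patchE mem_set//=.
    by move: atx; rewrite !in_itv/= => /andP[-> tx]; apply: (le_trans tx); case/andP: axb.
  apply: ae_filterS (integral_derive1_ae ih hE) => x Hx xin.
  have [dv ->] := Hx xin; split => //; rewrite /h patchE mem_set//=.
  by move: xin; rewrite !in_itv/= => /andP[/ltW -> /ltW ->].
apply: ae_filterS2 (ae_neq a) (ae_forall_nat H) => x xa Hx Ix.
have [ax [n xn]] := I0 x Ix; apply: (Hx n).
by rewrite in_itv/= xn andbT lt_neqAle eq_sym xa.
Qed.

Lemma mx_coord_le (R : realType) (m n : nat) (M : 'M[R]_(m, n)) i j : `|M i j| <= `|M|.
Proof. by rewrite [leRHS]/Num.Def.normr /= mx_normrE; exact: (le_bigmax _ _ (i, j)). Qed.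

Lemma mx_norm_le (R : realType) (m n : nat) (M : 'M[R]_(m, n)) (c : R) : 0 <= c ->
  (forall i j, `|M i j| <= c) -> `|M| <= c.
Proof. by move=> c0 Mc; rewrite [leLHS]/Num.Def.normr /= mx_normrE; apply: bigmax_le => // -[i j] _ /=. Qed.

Lemma ord2P (P : 'I_2 -> Prop) : P 0 -> P 1 -> forall i, P i.
Proof.
move=> P0 P1 [[|[|//]] lti].
  by rewrite (_ : Ordinal lti = 0)//; exact: val_inj.
by rewrite (_ : Ordinal lti = 1)//; exact: val_inj.
Qed.

Lemma cv_norm_le (R : realType) (v : 'cV[R]_2) : `|v| <= `|v 0 0| + `|v 1 0|.
Proof.
apply: mx_norm_le => [|i j]; first exact: addr_ge0.
rewrite ord1; elim/ord2P: i; rewrite ?lerDl ?lerDr//.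
Qed.

Lemma loc_abs_cont_coord (R : realType) (I : set R) (v : R -> 'cV[R]_2) i :
  loc_abs_cont I v -> loc_abs_cont I ((fun t => v t i 0) : R -> R^o).
Proof.
move=> acv a b sab e e0; have [d d0 H] := acv a b sab e e0; exists d => // n l r lr tI s.
apply: le_lt_trans (H n l r lr tI s); apply: ler_sum => k _.
by apply: le_trans (mx_coord_le _ i 0); rewrite !mxE.
Qed.

Lemma loc_abs_cont_cv (R : realType) (I : set R) (v : R -> 'cV[R]_2) :
  (forall i, loc_abs_cont I ((fun t => v t i 0) : R -> R^o)) -> loc_abs_cont I v.
Proof.
move=> acv a b sab e e0; have e20 : 0 < e / 2 by lra.
have [d0 d00 H0] := acv 0 a b sab _ e20; have [d1 d10 H1] := acv 1 a b sab _ e20.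
exists (Num.min d0 d1); first by rewrite lt_min d00.
move=> n l r lr tI; rewrite lt_min => /andP[s0 s1].
apply: (@le_lt_trans _ _ (\sum_(i < n) (`|v (r i) 0 0 - v (l i) 0 0| + `|v (r i) 1 0 - v (l i) 1 0|))).
  by apply: ler_sum => k _; apply: le_trans (cv_norm_le _) _; rewrite !mxE.
by rewrite big_split (splitr e) ltrD ?H0 ?H1.
Qed.

Lemma derive1_cv (R : realType) (v : R -> 'cV[R]_2) (t : R) :
  (forall i, derivable (fun t => v t i 0) t 1) ->
  forall i, derive1 v t i 0 = derive1 (fun t => v t i 0) t.
Proof.
move=> dv i; rewrite !derive1E derive_mx ?mxE//.
by apply/derivable_mxP => k j; rewrite ord1.
Qed.

Lemma cvg_primitive_left (R : realType) (g : R -> R) (a b : R) : a < b ->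
  (@lebesgue_measure R).-integrable `[a, b[ (EFin \o g) ->
  \int[@lebesgue_measure R]_(t in `[a, x]) g t @[x --> b^'-] -->
  \int[@lebesgue_measure R]_(t in `[a, b[) g t.
Proof.
move=> ab ig.
have ig' : (@lebesgue_measure R).-integrable `[a, b] (EFin \o g).
  have mg : measurable_fun `[a, b[ g by apply/measurable_EFinP; exact: measurable_int ig.
  have mg' := (@measurable_fun_itv_bndo_bndcP R (BLeft a) b g).1 mg.
  have /integrableP[_ hoo] := ig.
  apply/integrableP; split; first exact/measurable_EFinP.
  rewrite -integral_itv_bndo_bndc//.
  by apply: measurableT_comp => //; exact/measurable_EFinP.
rewrite (@Rintegral_itv_bndo_bndc R (BLeft a) b g)//.
exact: parameterized_integral_cvg_at_left.
Qed.

Lemma loc_abs_cont_derivable_ae (R : realType) (I : set R) (v : R -> R) (a : R) (b : nat -> R) :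
  (forall n, a <= b n /\ `[a, b n] `<=` I) -> (forall x, I x -> a <= x /\ exists n, x < b n) ->
  loc_abs_cont I (v : R -> R^o) ->
  {ae @lebesgue_measure R, forall x, I x -> derivable v x 1}.
Proof.
move=> bI Ib acv.
have H n : {ae @lebesgue_measure R, forall x, x \in `]a, b n[ -> derivable v x 1}.
  have [h [ih hE]] := abs_cont_integral (bI n).1 (acv a (b n) (bI n).2).
  by apply: ae_filterS (integral_derive1_ae ih hE) => x Hx /Hx[].
apply: ae_filterS2 (ae_neq a) (ae_forall_nat H) => x xa Hx Ix.
have [ax [n xn]] := Ib x Ix; apply: (Hx n).
by rewrite in_itv/= xn andbT lt_neqAle eq_sym xa.
Qed.

(** * Diagonal Dirac operators *)

Lemma big_ord2 (R : pzRingType) (F : 'I_2 -> R) : \sum_i F i = F 0 + F 1.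
Proof. by rewrite !big_ord_recl big_ord0 addr0; congr (F _ + F _); exact: val_inj. Qed.

Lemma wformE (R : realType) (a b c d : R) (u v : 'cV[R]_2) :
  wform (mx2 a b c d) u v =
  a * (u 0 0 * v 0 0) + b * (u 0 0 * v 1 0) + c * (u 1 0 * v 0 0) + d * (u 1 0 * v 1 0).
Proof. rewrite /wform /mx2 !mxE big_ord2 !mxE !big_ord2 !mxE /=; ring. Qed.

Lemma invmx_diag2 (R : realType) (a b : R) : a != 0 -> b != 0 ->
  invmx (mx2 a 0 0 b) = mx2 a^-1 0 0 b^-1.
Proof.
move=> a0 b0.
have E : mx2 a 0 0 b *m mx2 a^-1 0 0 b^-1 = 1%:M.
  apply/matrixP => i j; rewrite !mxE big_ord2 !mxE /=.
  by elim/ord2P: i; elim/ord2P: j => /=; rewrite ?mulr0 ?mul0r ?addr0 ?add0r ?divff.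
have [u _] := mulmx1_unit E.
by rewrite -[LHS]mulmx1 -E mulmxA mulVmx// mul1mx.
Qed.

Lemma mulmx_J_diag2 (R : realType) (a b : R) (u : 'cV[R]_2) :
  mx2 a 0 0 b *m Jmx R *m u = cv2 (- (a * u 1 0)) (b * u 0 0).
Proof.
apply/matrixP => i j; rewrite ord1 !mxE big_ord2 !mxE !big_ord2 !mxE /=.
elim/ord2P: i => /=; ring.
Qed.

Lemma mx2_norm_le (R : realType) (a b c : R) : `|a| <= c -> `|b| <= c -> `|mx2 a 0 0 b| <= c.
Proof.
move=> ac bc; have c0 := le_trans (normr_ge0 a) ac.
by apply: mx_norm_le => // i j; rewrite mxE; elim/ord2P: i; elim/ord2P: j; rewrite /= ?normr0.
Qed.

Lemma mx2_norm_ge (R : realType) (a b : R) : `|b| <= `|mx2 a 0 0 b|.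
Proof. by have := mx_coord_le (mx2 a 0 0 b) 1 1; rewrite mxE. Qed.

Definition cvmk (R : realType) (f g : R -> R) : R -> 'cV[R]_2 := fun t => cv2 (f t) (g t).

Section diagonal_dirac.
Variables (R : realType) (y : R -> R).
Let p t := (2 * y t)^-1.
Let q t := y t / 2.
Hypothesis vw : volterra_weights p q.
Notation I := (itv01 : set R).
Let mu := @lebesgue_measure R.
Let D : dirac_data R := Dir 1 (fun t => 0 +i* y t) (Some 0) None.
Notation H := (L2R D).
Notation Lp := (L2w I p).
Notation Lq := (L2w I q).
Let pr1 (v : R -> 'cV[R]_2) t := v t 0 0.
Let pr2 (v : R -> 'cV[R]_2) t := v t 1 0.

Let mI : measurable I. Proof. exact: measurable_itv. Qed.
Let domE : dir_dom D = I. Proof. by []. Qed.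
Let y0 t : I t -> 0 < y t.
Proof. by move=> /(vw_q0 vw); rewrite /q pmulr_lgt0 ?invr_gt0. Qed.
Let p0 t : I t -> 0 < p t. Proof. exact: (vw_p0 vw). Qed.
Let q0 t : I t -> 0 < q t. Proof. exact: (vw_q0 vw). Qed.
Let gp : prehilbert Lp := prehilbert_L2w mI (vw_mp vw) (fun t It => ltW (p0 It)).
Let gq : prehilbert Lq := prehilbert_L2w mI (vw_mq vw) (fun t It => ltW (q0 It)).

Let pq t : I t -> p t * q t = 4^-1.
Proof. by move=> It; rewrite /p /q; field; rewrite gt_eqF// y0. Qed.

Let RE t : I t -> dir_R D t = mx2 (p t) 0 0 (q t).
Proof.
move=> It; have yt := y0 It; rewrite /dir_R /=; apply/matrixP => i j; rewrite !mxE.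
elim/ord2P: i; elim/ord2P: j; rewrite /= /p /q ?oppr0 ?mulr1 ?mulr0//.
by field; rewrite gt_eqF.
Qed.

Let wRE u v t : I t -> wform (dir_R D t) u v = u 0 0 * v 0 0 * p t + u 1 0 * v 1 0 * q t.
Proof. move=> It; rewrite RE// wformE; ring. Qed.

Lemma diagonal_condA : condA D.
Proof.
move=> t It; split.
  by rewrite RE//; apply/matrixP => i j; rewrite !mxE; elim/ord2P: i; elim/ord2P: j.
move=> u u0; rewrite wRE//.
have [u00|u00] := eqVneq (u 0 0) 0; last first.
  apply: ltr_pwDl; rewrite -expr2.
    by rewrite mulr_gt0 ?p0// lt0r sqrf_eq0 u00 sqr_ge0.
  by rewrite mulr_ge0 ?sqr_ge0// ltW// q0.
have u10 : u 1 0 != 0.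
  apply: contra u0 => /eqP u10; apply/eqP/matrixP => i j; rewrite ord1 mxE.
  by elim/ord2P: i.
by rewrite u00 !mul0r add0r mulr_gt0 ?q0// -expr2 lt0r sqrf_eq0 u10 sqr_ge0.
Qed.

Lemma diagonal_condB : condB D.
Proof.
split.
- move=> i j; apply: (eq_measurable_fun (fun t => mx2 (p t) 0 0 (q t) i j)).
    by move=> t /set_mem It; rewrite RE.
  under eq_fun do rewrite mxE.
  by elim/ord2P: i; elim/ord2P: j => /=;
    [exact: (vw_mp vw)|exact: measurable_cst|exact: measurable_cst|exact: (vw_mq vw)].
- rewrite domE => t It; have := It; rewrite /= in_itv/= => /andP[t0 t1].
  (* The entries of the inverse are [1 / p = 4 q] and [1 / q = 4 p]. *)
  have [M HM] := vw_bound vw t1; exists (4 * M) => s st.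
  have Is : I s by case/andP: st => s0 st; rewrite /= in_itv/= s0 (le_lt_trans st).
  have [pM qM] := HM s st; have ps := p0 Is; have qs := q0 Is.
  have M0 : 0 <= M by rewrite (le_trans (ltW ps)).
  have M4 x : x <= M -> x <= 4 * M by move=> xM; lra.
  rewrite RE// invmx_diag2 ?(gt_eqF ps) ?(gt_eqF qs)//; split; apply: mx2_norm_le.
  + by rewrite gtr0_norm// M4.
  + by rewrite gtr0_norm// M4.
  + have -> : (p s)^-1 = 4 * q s by rewrite /p /q invrK; field.
    by rewrite gtr0_norm; [apply: ler_wpM2l|rewrite mulr_gt0].
  + have -> : (q s)^-1 = 4 * p s by rewrite /p /q; field; rewrite gt_eqF ?y0.
    by rewrite gtr0_norm; [apply: ler_wpM2l|rewrite mulr_gt0].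
Qed.

Lemma diagonal_ustar : ustar D (cv2 1 0).
Proof.
split.
  by apply/eqP => /matrixP/(_ 0 0); rewrite !mxE/=; apply/eqP; rewrite oner_eq0.
rewrite (eq_lint (g := fun t => (p t)%:E)); first exact: lint_lty (vw_ip vw).
by move=> t It; rewrite wRE// !mxE/= !mulr1 mul1r !mul0r addr0.
Qed.

Lemma diagonal_condC : condC D.
Proof. by exists (cv2 1 0); exact: diagonal_ustar. Qed.

Lemma diagonal_u1_admissible : u1_admissible D.
Proof. by move=> _; exists (cv2 1 0); [exact: diagonal_ustar|exists 1; rewrite scale1r]. Qed.

(** The norm of the matrix is the maximum of [p] and [q], which is at most [p + q], and [p] is
    integrable in either case. *)
Lemma diagonal_limit_circle : limit_circle_case D <-> mu.-integrable I (EFin \o q).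
Proof.
split=> [h|iq].
  apply: (@le_lintegrable _ _ _ (fun t => `|dir_R D t|)) => //; first exact: (vw_mq vw).
  by move=> t It; rewrite RE//; exact: mx2_norm_ge.
have E t : I t -> `|dir_R D t| = Num.max (p t) (q t).
  move=> It; rewrite RE//; apply/eqP; rewrite eq_le; apply/andP; split.
    by apply: mx2_norm_le; rewrite gtr0_norm ?p0 ?q0// le_max lexx ?orbT.
  rewrite ge_max; apply/andP; split.
    by apply: le_trans (ler_norm _) _; have := mx_coord_le (mx2 (p t) 0 0 (q t)) 0 0; rewrite mxE.
  by apply: le_trans (ler_norm _) _; exact: mx2_norm_ge.
apply: (@eq_lintegrable _ _ (fun t => Num.max (p t) (q t))) => //.
  by move=> t It; rewrite E.
apply: (le_lintegrable mI _ _ (lintegrableD mI (vw_ip vw) iq)).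
  by apply: measurable_maxr; [exact: (vw_mp vw)|exact: (vw_mq vw)].
move=> t It; have := p0 It; have := q0 It => qt pt.
by rewrite ger0_norm; [rewrite ge_max lerDl lerDr !ltW|rewrite le_max (ltW pt)].
Qed.

Let hmemE v : hmem H v <-> hmem Lp (pr1 v) /\ hmem Lq (pr2 v).
Proof.
have E (v0 v1 : R -> R) t : I t -> 0 <= v0 t ^+ 2 * p t /\ 0 <= v1 t ^+ 2 * q t.
  by move=> It; split; apply: mulr_ge0; rewrite ?sqr_ge0// ltW// ?p0 ?q0.
have intE (mv0 : measurable_fun I (pr1 v)) (mv1 : measurable_fun I (pr2 v)) :
    (\int[mu]_(t in I) (wform (dir_R D t) (v t) (v t))%:E =
     \int[mu]_(t in I) (pr1 v t ^+ 2 * p t)%:E + \int[mu]_(t in I) (pr2 v t ^+ 2 * q t)%:E)%E.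
  rewrite -ge0_integralD//; last 4 first.
  - by move=> t /(E (pr1 v) (pr2 v))[].
  - by apply/measurable_EFinP; apply: measurable_funM; [exact: measurable_funX|exact: (vw_mp vw)].
  - by move=> t /(E (pr1 v) (pr2 v))[].
  - by apply/measurable_EFinP; apply: measurable_funM; [exact: measurable_funX|exact: (vw_mq vw)].
  by apply: eq_lint => t It; rewrite wRE// -EFinD !expr2.
split=> [[mv voo]|[[mv0 v0oo] [mv1 v1oo]]].
  have mv0 : measurable_fun I (pr1 v) by exact: mv.
  have mv1 : measurable_fun I (pr2 v) by exact: mv.
  move: voo; rewrite intE// => voo; split; split => //; apply: le_lt_trans voo.
    by rewrite leeDl//; apply: integral_ge0 => t /(E (pr1 v) (pr2 v))[].
  by rewrite leeDr//; apply: integral_ge0 => t /(E (pr1 v) (pr2 v))[].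
split; first by elim/ord2P.
by rewrite intE//; exact: lte_add_pinfty.
Qed.

Lemma diagonal_split : hilb_split H Lp Lq pr1 pr2 (@cvmk R).
Proof.
split => //.
- by move=> a u v; apply/funext => t; rewrite /pr1 !mxE.
- by move=> a u v; apply/funext => t; rewrite /pr2 !mxE.
- by move=> u v; apply/funext => t; rewrite /pr1 mxE.
- by move=> u v; apply/funext => t; rewrite /pr2 mxE.
move=> u v /hmemE[hu0 hu1] /hmemE[hv0 hv1] /=.
have i0 := L2w_integrable mI (vw_mp vw) (fun t It => ltW (p0 It)) hu0 hv0.
have i1 := L2w_integrable mI (vw_mq vw) (fun t It => ltW (q0 It)) hu1 hv1.
rewrite -lRintegralD//; apply: eq_lRint => t It; exact: wRE.
Qed.

Let sp := diagonal_split.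

Lemma prehilbert_L2R : prehilbert H.
Proof.
have h u : hmem H u -> hmem Lp (pr1 u) /\ hmem Lq (pr2 u) by move/hmemE.
split.
- by apply/hmemE; split; [apply: eq_hmem_L2w (hmem0 gp)|apply: eq_hmem_L2w (hmem0 gq)];
    move=> t _; rewrite /pr1 /pr2 mxE.
- move=> a u v /h[u1 u2] /h[v1 v2]; apply/hmemE; rewrite (pr1P sp) (pr2P sp).
  by split; exact: hmemP.
- move=> u v /=; apply: eq_lRint => t It; rewrite !wRE//; ring.
- move=> a u v w hu hv hw; have huv : hmem H (a *: u + v).
    have [u1 u2] := h _ hu; have [v1 v2] := h _ hv; apply/hmemE; rewrite (pr1P sp) (pr2P sp).
    by split; exact: hmemP.
  have [u1 u2] := h _ hu; have [v1 v2] := h _ hv; have [w1 w2] := h _ hw.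
  rewrite !(ip_split sp)// (pr1P sp) (pr2P sp) (ipP gp)// (ipP gq)//; ring.
- move=> u hu; have [u1 u2] := h _ hu; rewrite (ip_split sp)//.
  by rewrite addr_ge0 ?(ip_ge0 gp)// (ip_ge0 gq).
Qed.

Let gH := prehilbert_L2R.

(** Solves [v1' = q w2] and [- v2' = p w1] with [v1 = 0] at 0 and [v2 = 0] at 1. *)
Definition dirac_inverse (v : R -> 'cV[R]_2) : R -> 'cV[R]_2 :=
  cvmk (volterra q (pr2 v)) (volterra_adj p (pr1 v)).

Let bV := volterra_bounded vw.
Let bA := volterra_adj_bounded vw.
Notation K := dirac_inverse.

Lemma dirac_inverse_bounded : bounded_op H H K.
Proof.
have hK u : hmem H u -> hmem H (K u).
  move=> /hmemE[u1 u2]; apply/hmemE; rewrite (pr1K sp) (pr2K sp).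
  by split; [exact: (bop_hmem bV)|exact: (bop_hmem bA)].
split => //.
- move=> a u v /hmemE[u1 u2] /hmemE[v1 v2]; rewrite /K (pr1P sp) (pr2P sp).
  rewrite (bop_linear bV)// (bop_linear bA)//; apply/funext => t; apply/matrixP => i j.
  by rewrite !mxE; case: ifP.
- have [C C0 HC] := bop_bound bV; have [C' C'0 HC'] := bop_bound bA.
  exists (C + C'); first exact: addr_ge0.
  move=> u hu; have [u1 u2] := (hmemE u).1 hu.
  apply: le_trans (hnorm_le_split gH gp gq sp (hK _ hu)) _.
  rewrite (pr1K sp) (pr2K sp) mulrDl; apply: lerD.
    apply: le_trans (HC _ u2) _; apply: ler_wpM2l => //; exact: (hnorm_pr2 gH gp gq sp).
  apply: le_trans (HC' _ u1) _; apply: ler_wpM2l => //; exact: (hnorm_pr1 gH gp gq sp).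
Qed.

Lemma dirac_inverse_symmetric u v : hmem H u -> hmem H v -> ip H (K u) v = ip H u (K v).
Proof.
move=> hu hv; have [u1 u2] := (hmemE u).1 hu; have [v1 v2] := (hmemE v).1 hv.
rewrite !(ip_split sp)//; try exact: (bop_hmem dirac_inverse_bounded).
rewrite !(pr1K sp) !(pr2K sp) (volterra_adjoint vw)// -(volterra_adjoint vw)//.
by rewrite (ipC gp) (volterra_adjoint vw) 1?addrC// [in RHS](ipC gq).
Qed.

Let inI t : 0 <= t -> t < 1 -> I t.
Proof. by move=> t0 t1; rewrite /= in_itv/= t0. Qed.

Let Itv t : I t -> 0 <= t /\ t < 1.
Proof. by rewrite /= in_itv/= => /andP[]. Qed.

Let subI t : I t -> `[0, t] `<=` I.
Proof. by move=> /Itv[_ t1] r /=; rewrite !in_itv/= => /andP[-> rt]; exact: le_lt_trans t1. Qed.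

Let b (n : nat) : R := 1 - n.+1%:R^-1.

Let bI n : I (b n).
Proof.
by apply: inI; rewrite /b ?subr_ge0 ?invf_le1 ?ler1n// ltrBlDr ltrDl invr_gt0.
Qed.

Let bE t : I t -> 0 <= t /\ exists n, t < b n.
Proof.
move=> /Itv[t0 t1]; split => //; exists (Num.truncn (1 - t)^-1).
rewrite /b ltrBrDr addrC -ltrBrDr invf_plt ?posrE ?subr_gt0//.
exact: truncnS_gt.
Qed.

Let IsubI x z : I x -> 0 <= z <= x -> I z.
Proof. by move=> /Itv[_ x1] /andP[z0 zx]; apply: inI => //; exact: le_lt_trans x1. Qed.

Lemma dirac_inverse_right w : hmem H w -> dirac_op D (K w) w.
Proof.
move=> hw; have [hw1 hw2] := (hmemE w).1 hw; have hK := bop_hmem dirac_inverse_bounded hw.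
have V0 : volterra q (pr2 w) 0 = 0.
  by rewrite (volterraE _ _ (inI (lexx 0) ltr01)) set_itv1 Rintegral_set1.
have VP t : I t -> volterra q (pr2 w) t = volterra q (pr2 w) 0 + \int[mu]_(r in `[0, t]) (q r * pr2 w r).
  by move=> It; rewrite V0 add0r volterraE.
have ip t : I t -> mu.-integrable `[0, t] (EFin \o (fun r => - (p r * pr1 w r))).
  move=> It; apply: (@eq_lintegrable _ _ (fun r => -1 * (p r * pr1 w r))) => // [r _|].
    by rewrite mulN1r.
  apply: lintegrableZ => //; apply: integrableS (volterra_adj_integrable vw hw1) => //.
  exact: subI.
have AP t : I t -> volterra_adj p (pr1 w) t =
    volterra_adj p (pr1 w) 0 + \int[mu]_(r in `[0, t]) - (p r * pr1 w r).
  move=> It; rewrite (volterra_adj_split vw hw1 It).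
  have -> : \int[mu]_(r in `[0, t]) - (p r * pr1 w r) = - \int[mu]_(r in `[0, t]) (p r * pr1 w r).
    rewrite -[RHS]mulN1r -lRintegralZ//.
      by apply: eq_lRint => r _; rewrite mulN1r.
    by apply: integrableS (volterra_adj_integrable vw hw1) => //; exact: subI.
  by rewrite addrAC subrr add0r.
split.
- apply: loc_abs_cont_cv; elim/ord2P.
    have -> : (fun t => K w t 0 0) = volterra q (pr2 w) by apply/funext => t; rewrite mxE.
    exact: (volterra_loc_abs_cont vw hw2).
  have -> : (fun t => K w t 1 0) = volterra_adj p (pr1 w) by apply/funext => t; rewrite mxE.
  exact: (volterra_adj_loc_abs_cont vw hw1).
- by [].
- have HV := primitive_derive1_ae bI bE (fun t It => (volterra_cs vw hw2 It).1) IsubI VP.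
  have HA := primitive_derive1_ae bI bE ip IsubI AP.
  apply: ae_filterS2 HV HA => t HV HA It.
  have {HV}[dV VE] := HV It; have {HA}[dA AE] := HA It.
  have E0 : (fun t => K w t 0 0) = volterra q (pr2 w) by apply/funext => r; rewrite mxE.
  have E1 : (fun t => K w t 1 0) = volterra_adj p (pr1 w) by apply/funext => r; rewrite mxE.
  have dK i : derivable (fun t => K w t i 0) t 1 by elim/ord2P: i; rewrite ?E0 ?E1.
  rewrite RE// invmx_diag2 ?gt_eqF ?p0 ?q0// mulmx_J_diag2.
  apply/matrixP => i j; rewrite ord1 !mxE !(derive1_cv dK) E0 E1 VE AE.
  elim/ord2P: i => /=.
    by rewrite mulrN opprK mulKf// gt_eqF// p0.
  by rewrite mulKf// gt_eqF// q0.
- by rewrite wformE /= !mxE /= V0; ring.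
(* The boundary form at 1 is the second component, the tail of a convergent integral. *)
- move=> _; have cv := cvg_primitive_left ltr01 (volterra_adj_integrable vw hw1).
  have -> : (0 : R) = volterra_adj p (pr1 w) 0 - \int[mu]_(r in `[0, 1[) (p r * pr1 w r).
    by rewrite (volterra_adjE _ _ (inI (lexx 0) ltr01)) subrr.
  apply: cvg_trans (cvgB (cvg_cst (volterra_adj p (pr1 w) 0)) cv).
  apply: near_eq_cvg; near=> s; have Is : I s.
    by apply: inI; near: s; [apply: nbhs_left_ge|exact: nbhs_left_lt].
  rewrite -[LHS]/(volterra_adj p (pr1 w) 0 - \int[mu]_(t in `[0, s]) (p t * pr1 w t)).
  rewrite wformE /= !mxE /= (volterra_adj_split vw hw1 Is); ring.
Unshelve. all: by end_near. Qed.

(** Integrating the equation determines [v] up to a constant [c] in the second component; that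
    [c = 0] has a different reason in each of the two cases. *)
Lemma dirac_inverse_left v w : dirac_op D v w -> [/\ hmem H v, hmem H w & hequiv H v (K w)].
Proof.
move=> [acv [hv hw] vw' v0 vlc].
have [hw1 hw2] := (hmemE w).1 hw; have [hv1 hv2] := (hmemE v).1 hv.
have hK := bop_hmem dirac_inverse_bounded hw.
have ac i := loc_abs_cont_coord i acv.
have b0n n : 0 <= b n /\ `[0, b n] `<=` I by have [] := Itv (bI n); split => //; exact: subI.
have dae i := loc_abs_cont_derivable_ae b0n bE (ac i).
have V0 : v 0 0 0 = 0.
  by move: v0; rewrite wformE /= !mxE /=; lra.
have wE : {ae mu, forall t, I t -> (forall i, derivable (fun t => v t i 0) t 1) ->
    q t * pr2 w t = derive1 (fun t => v t 0 0) t /\ - (p t * pr1 w t) = derive1 (fun t => v t 1 0) t}.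
  apply: ae_filterS vw' => t vw' It dv; have := vw' It.
  rewrite RE// invmx_diag2 ?gt_eqF ?p0 ?q0// mulmx_J_diag2 !(derive1_cv dv) /pr1 /pr2 => ->.
  rewrite !mxE/= mulVKf ?gt_eqF ?q0//; split => //.
  by rewrite mulrN opprK mulVKf// gt_eqF// p0.
(* The derivative of a column can be read off by components only where both are derivable; [dae]
   supplies the other one. *)
have wE0 : {ae mu, forall t, I t -> derivable (fun t => v t 0 0) t 1 -> q t * pr2 w t = derive1 (fun t => v t 0 0) t}.
  apply: ae_filterS2 wE (dae 1) => t wE d1 It d0.
  by have [] := wE It (ord2P d0 (d1 It)).
have wE1 : {ae mu, forall t, I t -> derivable (fun t => v t 1 0) t 1 -> - (p t * pr1 w t) = derive1 (fun t => v t 1 0) t}.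
  apply: ae_filterS2 wE (dae 0) => t wE d0 It d1.
  by have [] := wE It (ord2P (d0 It) d1).
have mq2 : measurable_fun I (fun t => q t * pr2 w t).
  by apply: measurable_funM; [exact: (vw_mq vw)|exact: hw2.1].
have mp1 : measurable_fun I (fun t => - (p t * pr1 w t)).
  by apply: measurableT_comp => //; apply: measurable_funM; [exact: (vw_mp vw)|exact: hw1.1].
have E0 t : I t -> v t 0 0 = volterra q (pr2 w) t.
  move=> It; have [t0 _] := Itv It.
  by have [_ ->] := abs_cont_primitive mI (ac 0) (subI It) t0 mq2 wE0; rewrite V0 add0r volterraE.
pose c := v 0 1 0 - volterra_adj p (pr1 w) 0.
have E1 t : I t -> v t 1 0 = c + volterra_adj p (pr1 w) t.
  move=> It; have [t0 _] := Itv It.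
  have [_ ->] := abs_cont_primitive mI (ac 1) (subI It) t0 mp1 wE1.
  have ip := volterra_adj_integrable vw hw1.
  have -> : \int[mu]_(r in `[0, t]) - (p r * pr1 w r) = - \int[mu]_(r in `[0, t]) (p r * pr1 w r).
    rewrite -[RHS]mulN1r -lRintegralZ//.
      by apply: eq_lRint => r _; rewrite mulN1r.
    by apply: integrableS ip => //; exact: subI.
  rewrite /c (volterra_adj_split vw hw1 It); ring.
clearbody c; have c0 : c = 0.
  (* In the limit circle case the boundary form tends to [c], while the domain prescribes the limit
     0. *)
  have [lc|lp] := pselect (limit_circle_case D).
    have cv := cvg_primitive_left ltr01 (volterra_adj_integrable vw hw1).
    have := vlc lc => vl.
    have : (fun s => wform (Jmx R) (v s) (dirvec (dir_u1 D))) @ 1^'- --> c.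
      have cE : c + volterra_adj p (pr1 w) 0 - \int[mu]_(r in `[0, 1[) (p r * pr1 w r) = c.
        by rewrite (volterra_adjE _ _ (inI (lexx 0) ltr01)) addrK.
      rewrite -[X in _ --> X]cE.
      apply: cvg_trans (cvgB (cvg_cst (c + volterra_adj p (pr1 w) 0)) cv); apply: near_eq_cvg; near=> s; have Is : I s.
        by apply: inI; near: s; [apply: nbhs_left_ge|exact: nbhs_left_lt].
      rewrite -[LHS]/(c + volterra_adj p (pr1 w) 0 - \int[mu]_(t in `[0, s]) (p t * pr1 w t)).
      rewrite wformE /= !mxE /= (E1 _ Is) (volterra_adj_split vw hw1 Is); ring.
    by move=> vc; apply: (cvg_unique _ vc vl).
  (* In the limit point case the constant [c] is the difference of two members of [L2w I q], so a
     nonzero one would make [q] integrable. *)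
  apply: contrapT => /eqP c0; apply: lp; apply/diagonal_limit_circle.
  have hc : hmem Lq (cst c).
    have := hmemB gq hv2 (bop_hmem bA hw1); apply: eq_hmem_L2w => t It.
    by rewrite -[LHS]/(v t 1 0 - volterra_adj p (pr1 w) t) E1// addrK.
  have := L2w_integrable mI (vw_mq vw) (fun t It => ltW (q0 It)) hc hc.
  move=> /(lintegrableZ (c ^+ 2)^-1 mI); apply: eq_lintegrable => // t _ /=.
  by rewrite -expr2 mulKf// expf_neq0.
split => //; apply/(hequiv_split gH gp gq sp hv hK); rewrite (pr1K sp) (pr2K sp).
split; apply: eq_hequiv_L2w => t It; first exact: E0.
by rewrite -[LHS]/(v t 1 0) E1// c0 add0r.
Unshelve. all: by end_near. Qed.

Lemma dirac_inverseP : inverse_of H (dirac_op D) K.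
Proof.
split; [exact: dirac_inverse_bounded|exact: dirac_inverse_left|exact: dirac_inverse_right].
Qed.

Lemma dirac_dense : dense_dom H (dirac_op D).
Proof.
move=> f hf e e0; have e20 : 0 < e / 2 by lra.
have [f1 f2] := (hmemE f).1 hf.
have [phi [hphi Hphi]] := volterra_dense vw pq f1 e20.
have [psi [hpsi Hpsi]] := volterra_adj_dense vw pq f2 e20.
have hw : hmem H (cvmk psi phi) by apply/hmemE; rewrite (pr1K sp) (pr2K sp).
exists (K (cvmk psi phi)), (cvmk psi phi); split; first exact: dirac_inverse_right.
have hK := bop_hmem dirac_inverse_bounded hw.
apply: le_lt_trans (hnorm_le_split gH gp gq sp (hmemB gH hf hK)) _.
have E1 : pr1 (K (cvmk psi phi)) = volterra q phi.
  by rewrite [LHS](pr1K sp) (_ : pr2 _ = phi)//; exact: (pr2K sp).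
have E2 : pr2 (K (cvmk psi phi)) = volterra_adj p psi.
  by rewrite [LHS](pr2K sp) (_ : pr1 _ = psi)//; exact: (pr1K sp).
rewrite (pr1B sp) (pr2B sp) E1 E2.
by rewrite (splitr e) ltrD.
Qed.

Lemma dirac_self_adjoint : self_adjoint H (dirac_op D).
Proof. exact: (inverse_self_adjoint gH dirac_inverseP dirac_inverse_symmetric dirac_dense). Qed.

Lemma dirac_solvable_at z :
  solvable_at H K z <-> solvable_at Lp (volterra q \o volterra_adj p) (z * z).
Proof.
apply: (block_solvable_at z gH gp gq sp bV bA) => v _; [exact: (pr1K sp)|exact: (pr2K sp)].
Qed.

Let ip_indic (w f : R -> R) (J : set R) : measurable J -> J `<=` I ->
  ip (L2w I w) (\1_J : R -> R) f = \int[mu]_(t in J) (w t * f t).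
Proof.
move=> mJ JI /=; rewrite -[in RHS](setIidr JI) Rintegral_mkcondr; apply: eq_lRint => t It.
rewrite patchE indicE; case: ifP => _; first by rewrite mul1r mulrC.
by rewrite !mul0r.
Qed.

Let hmem_indic (w : R -> R) (J : set R) : measurable_fun I w -> (forall t, I t -> 0 < w t) ->
  measurable J -> J `<=` I -> mu.-integrable J (EFin \o w) ->
  hmem (L2w I w) (\1_J : R -> R).
Proof.
move=> mw w0 mJ JI iw; split; first exact: measurable_indic.
apply: le_lt_trans (lint_lty mJ iw).
rewrite -[in leRHS](setIidr JI) integral_mkcondr.
rewrite le_eqVlt; apply/orP; left; apply/eqP; apply: eq_integral => t _.
by rewrite patchE indicE; case: ifP => _; rewrite ?expr1n ?mul1r// expr0n/= mul0r.
Qed.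

(** Exchanges a finite sum with the integral: a bound on the sum of squared values at each point
    becomes one on the sum of squared norms. *)
Let sum_hnorm_le (T : eqType) (s : seq T) (F : T -> R -> R) (w S : R -> R) (C : R) :
  measurable_fun I w -> (forall t, I t -> 0 <= w t) -> measurable_fun I S ->
  (forall e, e \in s -> hmem (L2w I w) (F e)) ->
  (forall t, I t -> \sum_(e <- s) F e t ^+ 2 <= S t) ->
  (\int[mu]_(t in I) (w t * S t)%:E = C%:E)%E ->
  \sum_(e <- s) hnorm (L2w I w) (F e) ^+ 2 <= C.
Proof.
move=> mw w0 mS hF FS wS.
have [mF FE] : measurable_fun I (fun t => \sum_(e <- s) F e t ^+ 2) /\
    ((\sum_(e <- s) hnorm (L2w I w) (F e) ^+ 2)%:E =
     \int[mu]_(t in I) ((\sum_(e <- s) F e t ^+ 2) * w t)%:E)%E.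
  elim: s hF {FS} => [|e s IH] hF.
    split; last by rewrite big_nil integral0_eq// => t It; rewrite big_nil mul0r.
    by rewrite (_ : (fun t => _) = cst 0)//; apply/funext => t; rewrite big_nil.
  have [//|ms sE] := IH; first by move=> e' e's; apply: hF; rewrite inE e's orbT.
  have he : hmem (L2w I w) (F e) by apply: hF; rewrite mem_head.
  have me : measurable_fun I (fun t => F e t ^+ 2) by apply: measurable_funX; exact: he.1.
  have E t : \sum_(e' <- e :: s) F e' t ^+ 2 = F e t ^+ 2 + \sum_(e' <- s) F e' t ^+ 2.
    by rewrite big_cons.
  split; first by rewrite (funext E); exact: measurable_funD.
  rewrite big_cons EFinD sE (L2w_norm_int mI mw w0 he) -ge0_integralD//.
  - by apply: eq_lint => t It; rewrite E mulrDl EFinD.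
  - by move=> t It; rewrite lee_fin mulr_ge0 ?sqr_ge0// w0.
  - by apply/measurable_EFinP; exact: measurable_funM.
  - by move=> t It; rewrite lee_fin mulr_ge0 ?w0//; apply: sumr_ge0 => e' _; exact: sqr_ge0.
  - by apply/measurable_EFinP; exact: measurable_funM.
rewrite -lee_fin FE -wS; apply: le_lint => //.
- by apply/measurable_EFinP; exact: measurable_funM.
- by apply/measurable_EFinP; exact: measurable_funM.
- by move=> t It; rewrite lee_fin mulr_ge0 ?w0//; apply: sumr_ge0 => e' _; exact: sqr_ge0.
- by move=> t It; rewrite lee_fin mulrC; apply: ler_wpM2l; [exact: w0|exact: FS].
Qed.

(* The rows of the integral kernel of [K] at [t] are the vectors [(0, 1_[0,t])]
   and [(1_[t,1[, 0)], so Bessel's inequality bounds the sum over an orthonormal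
   family of the squared values at [t] by their squared norms. *)
Lemma dirac_inverse_hilbert_schmidt : hilbert_schmidt H K.
Proof.
have [E onE] := exists_orthonormal_basis gH; exists E => //.
have [EH on _] := onE.
(* One square for each off-diagonal block of [K]; the bound is the same for every finite subfamily
   of the basis. *)
apply: (@le_lt_trans _ _ (volterra_const p q ^+ 2 + volterra_const p q ^+ 2)%:E); last exact: ltry.
rewrite /esum; apply: ub_ereal_sup => _ [A [finA AE] <-].
have [s us As] : exists2 s : seq (R -> 'cV[R]_2), uniq s & A = [set` s].
  have /finite_seqP[s As] := finA; exists (undup s); first exact: undup_uniq.
  by rewrite As; apply/seteqP; split => x /=; rewrite mem_undup.
rewrite As -fsbig_seq//.
have sE e : e \in s -> E e by move=> es; apply: AE; rewrite As.
have hs e : e \in s -> hmem H e by move=> /sE/EH.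
have hs1 e : e \in s -> hmem Lp (pr1 e) by move=> /hs/hmemE[].
have hs2 e : e \in s -> hmem Lq (pr2 e) by move=> /hs/hmemE[].
have os e e' : e \in s -> e' \in s -> ip H e e' = (e == e')%:R by move=> /sE Ee /sE; exact: on.
have bessel u : hmem H u -> \sum_(e <- s) ip H u e ^+ 2 <= ip H u u.
  by move=> hu; exact: (bessel_inequality gH us hu hs os).
rewrite sumEFin lee_fin big_seq.
apply: (@le_trans _ _ (\sum_(e <- s | e \in s) (hnorm Lp (volterra q (pr2 e)) ^+ 2 +
    hnorm Lq (volterra_adj p (pr1 e)) ^+ 2))).
  apply: ler_sum => e es; rewrite (hnorm_split gH gp gq sp) ?(pr1K sp) ?(pr2K sp)//.
  exact: (bop_hmem dirac_inverse_bounded (hs e es)).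
rewrite -big_seq big_split/=; apply: lerD.
- apply: (@sum_hnorm_le _ _ _ p (fun t => \int[mu]_(r in `[0, t]) q r)) => //.
  + exact: (vw_mp vw).
  + by move=> t /p0/ltW.
  + exact: (volterra_q_mass_measurable vw).
  + by move=> e es; apply: (bop_hmem bV); exact: hs2.
  + move=> t It; pose k := cvmk (cst 0) (\1_`[0, t] : R -> R).
    have hk : hmem H k.
      apply/hmemE; rewrite (pr1K sp) (pr2K sp); split; first exact: (hmem0 gp).
      apply: hmem_indic; [exact: (vw_mq vw)|exact: q0|exact: measurable_itv|exact: subI|].
      exact: (volterra_q_integrable vw).
    apply: le_trans (_ : ip H k k <= _).
      apply: le_trans (bessel k hk); rewrite big_seq [leRHS]big_seq; apply: ler_sum => e es.
      rewrite (ip_split sp hk (hs e es)) (pr1K sp) (pr2K sp).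
      rewrite (_ : ip Lp _ _ = 0) ?add0r; last exact: (ip0l gp (hs1 e es)).
      by rewrite ip_indic ?volterraE//; exact: subI.
    rewrite (ip_split sp hk hk) !(pr1K sp) !(pr2K sp).
    rewrite (_ : ip Lp _ _ = 0) ?add0r; last exact: (ip0l gp (hmem0 gp)).
    rewrite ip_indic//; last exact: subI.
    rewrite le_eqVlt; apply/orP; left; apply/eqP; apply: eq_lRint => r rt.
    by rewrite indicE mem_set// mulr1.
  + by rewrite volterra_hsE// volterra_constE.
- apply: (@sum_hnorm_le _ _ _ q (fun t => \int[mu]_(r in `[t, 1[) p r)) => //.
  + exact: (vw_mq vw).
  + by move=> t /q0/ltW.
  + exact: (volterra_p_mass_measurable vw).
  + by move=> e es; apply: (bop_hmem bA); exact: hs1.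
  + move=> t It; pose k := cvmk (\1_`[t, 1[ : R -> R) (cst 0).
    have tI : `[t, 1[ `<=` I by apply: subset_itvr; rewrite bnd_simp; have [] := Itv It.
    have hk : hmem H k.
      apply/hmemE; rewrite (pr1K sp) (pr2K sp); split; last exact: (hmem0 gq).
      apply: hmem_indic => //; [exact: (vw_mp vw)|].
      by apply: integrableS (vw_ip vw).
    apply: le_trans (_ : ip H k k <= _).
      apply: le_trans (bessel k hk); rewrite big_seq [leRHS]big_seq; apply: ler_sum => e es.
      rewrite (ip_split sp hk (hs e es)) (pr1K sp) (pr2K sp).
      rewrite (_ : ip Lq _ _ = 0) ?addr0; last exact: (ip0l gq (hs2 e es)).
      by rewrite ip_indic ?volterra_adjE.
    rewrite (ip_split sp hk hk) !(pr1K sp) !(pr2K sp).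
    rewrite (_ : ip Lq _ _ = 0) ?addr0; last exact: (ip0l gq (hmem0 gq)).
    rewrite ip_indic//.
    rewrite le_eqVlt; apply/orP; left; apply/eqP; apply: eq_lRint => r rt.
    by rewrite indicE mem_set// mulr1.
  + exact: (volterra_constE vw).
Qed.

End diagonal_dirac.

(** * The change of variables [x = - 2 ln (1 - t)] *)

Section time_change.
Variable R : realType.
Notation I := (itv01 : set R).
Let mu := @lebesgue_measure R.
Let mI : measurable I. Proof. exact: measurable_itv. Qed.

Definition time_of (t : R) : R := - (2 * ln (1 - t)).
Definition time_inv (x : R) : R := 1 - expR (- (x / 2)).
Notation phi := time_of.
Notation psi := time_inv.

Lemma time_ofK t : I t -> psi (phi t) = t.
Proof.
rewrite /= in_itv/= => /andP[_ t1]; rewrite /psi /phi mulNr opprK mulrAC divff// mul1r.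
by rewrite lnK ?posrE ?subr_gt0// subKr.
Qed.

Lemma time_invK x : phi (psi x) = x.
Proof. by rewrite /phi /psi subKr expRK mulrN opprK mulrC divfK. Qed.

Lemma time_inv_in x : 0 <= x -> I (psi x).
Proof.
move=> x0; rewrite /= in_itv/= /psi subr_ge0 ltrBlDr ltrDl expR_gt0 andbT.
by rewrite expR_le1 oppr_le0 divr_ge0.
Qed.

Lemma time_of_ge0 t : I t -> 0 <= phi t.
Proof.
rewrite /= in_itv/= => /andP[t0 t1]; rewrite /phi oppr_ge0 mulr_ge0_le0// ln_le0//; lra.
Qed.

Lemma time_inv_lt : {mono psi : x y / x < y}.
Proof. by move=> x y; rewrite /psi ltrD2l ltrN2 ltr_expR ltrN2 ltr_pM2r ?invr_gt0. Qed.

Lemma time_inv_le : {mono psi : x y / x <= y}.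
Proof. by move=> x y; rewrite !leNgt time_inv_lt. Qed.

Lemma measurable_time_inv : measurable_fun setT psi.
Proof.
apply: measurable_funB; first exact: measurable_cst.
apply: measurableT_comp; first exact: measurable_expR.
by apply: measurableT_comp => //; apply: measurable_funM.
Qed.

Lemma measurable_time_of : measurable_fun setT phi.
Proof.
apply: measurableT_comp => //; apply: measurable_funM; first exact: measurable_cst.
apply: measurableT_comp; first exact: measurable_ln.
by apply: measurable_funB; first exact: measurable_cst.
Qed.

Let r0 : (0 : R) < 2^-1. Proof. by rewrite invr_gt0. Qed.
(** The exponential law of rate 1/2, whose density on the half-line is the derivative of [time_inv].
    Its image under [time_inv] is therefore the uniform law, and integrating against both laws gives
    the substitution. *)
Let nu : probability (measurableTypeR R) R :=
  exponential_distribution_exponential_prob__canonical__probability_measure_Probability r0.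

Let nuE A : nu A = (\int[mu]_(x in A) (exponential_pdf 2^-1 x)%:E)%E.
Proof. by []. Qed.

Let mpdf : measurable_fun setT (fun x : R => (exponential_pdf 2^-1 x)%:E).
Proof. by apply/measurable_EFinP; exact: measurable_exponential_pdf. Qed.

Let nu_dom : nu `<< mu.
Proof.
apply/null_content_dominatesP => A mA A0; rewrite nuE.
apply: null_set_integral => //; exact: measurable_funS mpdf.
Qed.

(** The Radon-Nikodym derivative of [nu] and the exponential density have the same integrals, so
    they agree almost everywhere. *)
Let integral_nu (f : R -> \bar R) : measurable_fun setT f -> (forall x, 0 <= f x)%E ->
  (\int[nu]_x f x = \int[mu]_x (f x * (exponential_pdf 2^-1 x)%:E))%E.
Proof.
move=> mf f0; rewrite -(Radon_Nikodym_SigmaFinite.change_of_variables nu_dom f0)//.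
have ig := Radon_Nikodym_SigmaFinite.f_integrable nu_dom.
apply: ae_eq_integral => //.
- by apply: emeasurable_funM => //; exact: measurable_int ig.
- exact: emeasurable_funM.
- apply: ae_eqe_mul2l; apply: integral_ae_eq => // E _ mE.
  by rewrite -Radon_Nikodym_SigmaFinite.f_integral.
Qed.

Let nu_psi (c : R) : nu (psi @^-1` `[c, +oo[) = uniform_prob (@ltr01 R) `[c, +oo[%classic.
Proof.
rewrite nuE [RHS]integral_uniform_pdf.
have -> : (\int[mu]_(x in psi @^-1` `[c, +oo[) (exponential_pdf 2^-1 x)%:E =
    \int[mu]_(x in psi @^-1` `[c, +oo[ `&` `[0%R, +oo[) (exponential_pdf 2^-1 x)%:E)%E.
  rewrite [RHS]integral_mkcondr; apply: eq_integral => x _; rewrite patchE; case: ifPn => //.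
  by rewrite notin_setE/= in_itv/= andbT => /negP; rewrite -ltNge => /lt0_exponential_pdf ->.
have [c1|c1] := leP 1 c.
  rewrite (_ : _ `&` _ = set0) ?integral_set0; last first.
    rewrite -subset0 => x [] /=; rewrite !in_itv/= !andbT => cx /time_inv_in.
    by rewrite /= in_itv/= => /andP[_]; rewrite ltNge (le_trans c1 cx).
  (* At [c = 1] the ray meets [[0, 1]] in a single point, which has measure 0. *)
  have [c1'|c1'] := eqVneq c 1.
    rewrite (_ : _ `&` _ = [set 1]) ?integral_set1//.
    apply/seteqP; split=> [x /= []|x /= ->]; rewrite !in_itv/= !andbT c1'.
      by move=> h1 /andP[_ h2]; apply/eqP; rewrite eq_le h1 h2.
    by rewrite lexx ler01.
  rewrite (_ : _ `&` _ = set0) ?integral_set0// -subset0 => x [] /=.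
  rewrite !in_itv/= andbT => cx /andP[_ x1]; have := le_trans cx x1.
  by rewrite leNgt lt_neqAle eq_sym c1' c1.
(* A ray starting below 0 has the same mass as the one starting at 0. *)
pose c' := Num.max c 0; have Ic : I c' by rewrite /= in_itv/= /c' le_max lexx orbT/= gt_max c1 ltr01.
have c'0 : 0 <= c' by rewrite le_max lexx orbT.
have c'1 : c' < 1 by rewrite gt_max c1 ltr01.
have phc := time_of_ge0 Ic.
have -> : psi @^-1` `[c, +oo[ `&` `[0%R, +oo[ = `[phi c', +oo[%classic.
  apply/seteqP; split=> x /=; rewrite !in_itv/= !andbT.
    move=> [cx x0]; rewrite -time_inv_le time_ofK// /c' ge_max cx.
    by have := time_inv_in x0; rewrite /= in_itv/= => /andP[].
  move=> px; rewrite (le_trans phc px); split => //.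
  by move: px; rewrite -time_inv_le time_ofK// /c' ge_max => /andP[].
have -> : `[c, +oo[ `&` `[0%R, 1%R] = `[c', 1%R]%classic.
  by apply/seteqP; split=> x /=; rewrite !in_itv/= !andbT /c' ge_max;
    [move=> [-> /andP[-> ->]]|move=> /andP[/andP[-> ->] ->]].
have -> : (\int[mu]_(x in `[c', 1%R]) (uniform_pdf 0 1 x)%:E = (1 - c')%:E)%E.
  rewrite (@eq_lint _ _ _ (fun x : R => (1%R)%:E)); last first.
    move=> x; rewrite /= in_itv/= /uniform_pdf => /andP[cx ->].
    by rewrite (le_trans c'0 cx) subr0 invr1.
  by rewrite integral_cst//= mul1e lebesgue_measure_itv/= lte_fin c'1 -EFinB.
rewrite (@ge0_continuous_FTC2y _ _ (fun x => - expR (- 2^-1 * x)) _ 0).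
- rewrite sub0e EFinN oppeK; congr (_%:E); rewrite mulrC mulrN.
  by have := time_ofK Ic; rewrite /psi => E; rewrite -[X in 1 - X]E subKr.
- by move=> x _; exact: exponential_pdf_ge0.
- apply: (@continuous_subspaceW R^o _ _ [set` `[0, +oo[%R]).
    by apply: subset_itvr; rewrite bnd_simp.
  exact: within_continuous_exponential_pdf.
- rewrite -oppr0; apply: cvgN.
  rewrite (_ : (fun x => _) = (fun z => expR (- z)) \o (fun z => 2^-1 * z)); last first.
    by apply/funext => x /=; rewrite mulNr.
  by apply: (@cvg_comp _ _ _ _ _ _ (pinfty_nbhs R)); [exact: gt0_cvgMry|exact: cvgr_expR].
- by move=> x _; exact: ex_derive.
- apply/cvg_at_right_filter; apply: cvgN.
  apply: (@cvg_comp _ _ _ (fun x => - 2^-1 * x) expR); last exact: continuous_expR.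
  by apply: cvgMr; exact: cvg_id.
- move=> x; rewrite in_itv/= andbT => px; apply: derive1_exponential_pdf.
  by rewrite in_itv/= andbT (le_lt_trans phc px).
Qed.

Let unif : probability (measurableTypeR R) R := uniform_prob (@ltr01 R).

Let mpsi : measurable_fun [set: measurableTypeR R] (psi : _ -> measurableTypeR R).
Proof. exact: measurable_time_inv. Qed.

Let nu' : {measure set (measurableTypeR R) -> \bar R} :=
  measure_function_pushforward__canonical__measure_function_Measure nu mpsi.

(** The rays [[c, +oo[] generate the Borel sets and are closed under intersection, so agreement on
    them is enough. *)
Let pushforward_psi A : measurable A -> nu' A = unif A.
Proof.
move=> mA; refine (@measure_unique _ R (measurableTypeR R) (@RGenCInfty.G R)
  (fun n => `[(- n%:R), +oo[%classic) _ _ _ _ nu' unif _ _ A mA).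
- exact: RGenCInfty.measurableE.
- move=> _ _ [x ->] [y ->]; exists (Num.max x y); apply/seteqP; split=> z /=;
    rewrite !in_itv/= !andbT ge_max; [by move=> [-> ->]|by move=> /andP].
- by move=> n; exists (- n%:R).
- apply/seteqP; split => // x _; exists (Num.truncn `|x|).+1 => //=.
  rewrite in_itv/= andbT lerNl; apply: le_trans (ler_norm _) _; rewrite normrN.
  by apply: ltW; exact: truncnS_gt.
- by move=> _ [x ->]; exact: nu_psi.
- move=> n; rewrite (_ : nu' _ = unif `[(- n%:R), +oo[%classic); last exact: nu_psi.
  by apply: le_lt_trans (@probability_le1 _ _ _ unif _ (measurable_itv _)) _; exact: ltry.
Qed.

(** The factor [2 * expR (phi t / 2)] is [2 / (1 - t)], the derivative of [time_of]; expressed in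
    [x] it cancels against the exponential density. *)
Lemma time_change_ge0 (F : R -> \bar R) : measurable_fun setT F -> (forall x, 0 <= F x)%E ->
  (\int[mu]_(x in halfline) F x = \int[mu]_(t in I) (F (phi t) * (2 * expR (phi t / 2))%:E))%E.
Proof.
move=> mF F0; pose G t : \bar R := (F (phi t) * (2 * expR (phi t / 2))%:E)%E.
have G0 t : (0 <= G t)%E by rewrite mule_ge0// lee_fin mulr_ge0// expR_ge0.
have mG : measurable_fun setT G.
  apply: emeasurable_funM; first by apply: measurableT_comp mF measurable_time_of.
  apply/measurable_EFinP; apply: measurable_funM; first exact: measurable_cst.
  apply: measurableT_comp; first exact: measurable_expR.
  by apply: measurable_funM => //; exact: measurable_time_of.
rewrite [RHS](_ : _ = \int[mu]_(t in I) G t)%E// integral_itv_bndo_bndc; last exact: measurable_funS mG.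
have := integral_uniform (@ltr01 R) mG G0; rewrite subr0 invr1 mul1e => <-.
rewrite [RHS](eq_measure_integral nu'); last by move=> A mA _; exact/esym/pushforward_psi.
rewrite (@ge0_integral_pushforward _ _ _ _ _ _ mpsi nu)// preimage_setT integral_nu//; last 2 first.
  exact: measurableT_comp measurable_time_inv.
  by move=> x; exact: G0.
rewrite [LHS]integral_mkcond; apply: eq_integral => x _; rewrite patchE.
case: ifPn => [/set_mem|]; rewrite /halfline.
  rewrite /= in_itv/= andbT => x0; rewrite exponential_pdfE//.
  rewrite /G /= time_invK -muleA -EFinM.
  have -> : 2 * expR (x / 2) * (2^-1 * expR (- 2^-1 * x)) = 1 :> R.
    rewrite mulrACA mulfV// mul1r (_ : - 2^-1 * x = - (x / 2)); last by rewrite mulNr mulrC.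
    exact: expRxMexpNx_1.
  by rewrite mule1.
by rewrite notin_setE/= in_itv/= andbT => /negP; rewrite -ltNge => /lt0_exponential_pdf ->; rewrite mule0.
Qed.

Let time_change_ge0_sub (J : set R) (F : R -> \bar R) : measurable J -> J `<=` halfline ->
  measurable_fun J F -> (forall x, 0 <= F x)%E ->
  (\int[mu]_(x in J) F x =
   \int[mu]_(t in I `&` phi @^-1` J) (F (phi t) * (2 * expR (phi t / 2))%:E))%E.
Proof.
move=> mJ JI mF F0; rewrite -[in LHS](setIidr JI) integral_mkcondr time_change_ge0.
- rewrite [RHS]integral_mkcondr; apply: eq_integral => t It.
  rewrite !patchE; case: ifPn => [Jt|Jt]; first by rewrite ifT// inE; move: Jt; rewrite inE.
  by rewrite ifF ?mul0e//; apply/negbTE; move: Jt; rewrite !notin_setE.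
- exact/(measurable_restrictT _ mJ).
- by move=> x; rewrite patchE; case: ifP.
Qed.

Lemma time_change (J : set R) (F : R -> R) : measurable J -> J `<=` halfline ->
  measurable_fun J F ->
  (\int[mu]_(x in J) (F x)%:E =
   \int[mu]_(t in I `&` phi @^-1` J) (F (phi t) * (2 * expR (phi t / 2)))%:E)%E.
Proof.
move=> mJ JI mF; rewrite integralE [RHS]integralE.
have mF' : measurable_fun J (EFin \o F) by exact/measurable_EFinP.
have w0 t : 0 <= 2 * expR (phi t / 2) by rewrite mulr_ge0// expR_ge0.
congr (_ - _)%E.
- rewrite time_change_ge0_sub//; last exact: measurable_funepos.
  apply: eq_integral => t _; rewrite !funeposE -!EFin_max -EFinM; congr (_%:E).
  by rewrite -[in RHS](mul0r (2 * expR (phi t / 2))) maxr_pMl.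
- rewrite time_change_ge0_sub//; last exact: measurable_funeneg.
  apply: eq_integral => t _; rewrite !funenegE -!EFinN -!EFin_max -EFinM; congr (_%:E).
  by rewrite -mulNr -[in RHS](mul0r (2 * expR (phi t / 2))) maxr_pMl.
Qed.

Lemma time_change_integrable (J : set R) (F : R -> R) : measurable J -> J `<=` halfline ->
  measurable_fun J F ->
  mu.-integrable J (EFin \o F) <->
  mu.-integrable (I `&` phi @^-1` J) (EFin \o (fun t => F (phi t) * (2 * expR (phi t / 2)))).
Proof.
move=> mJ JI mF.
have w0 t : 0 <= 2 * expR (phi t / 2) by rewrite mulr_ge0// expR_ge0.
have mnF : measurable_fun J (fun x => `|F x|) by exact: measurableT_comp.
have E : (\int[mu]_(x in J) `|(F x)%:E| =
    \int[mu]_(t in I `&` phi @^-1` J) `|(F (phi t) * (2 * expR (phi t / 2)))%:E|)%E.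
  have := time_change mJ JI mnF; rewrite (@eq_lint _ J _ (fun x => `|(F x)%:E|%E))// => ->.
  by apply: eq_integral => t _ /=; rewrite normrM (ger0_norm (w0 t)).
have mJ' : measurable (I `&` phi @^-1` J).
  by apply: measurableI => //; rewrite -(setTI (_ @^-1` _)); exact: measurable_time_of.
split=> /integrableP[m h]; apply/integrableP; split; rewrite -?E//.
- apply/measurable_EFinP; apply: measurable_funM.
    apply: (@measurable_comp _ _ _ _ _ _ J) => //; first by move=> _ [t [_ Jt] <-].
    exact: measurable_funS measurable_time_of.
  apply: measurable_funM; first exact: measurable_cst.
  apply: measurableT_comp; first exact: measurable_expR.
  by apply: measurable_funM => //; exact: measurable_funS measurable_time_of.
- exact/measurable_EFinP.
- by rewrite [X in (X < _)%E]E.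
Qed.

Lemma time_of_cvg : phi t @[t --> 1^'-] --> +oo.
Proof.
apply/cvgryPge => A; near=> t.
have t1 : t < 1 by near: t; exact: nbhs_left_lt.
have : psi A <= t.
  near: t; apply: nbhs_left_ge; rewrite /psi ltrBlDr ltrDl; exact: expR_gt0.
move=> At; rewrite -[A]time_invK /phi lerN2 ler_pM2l// ler_ln ?posrE ?subr_gt0//.
- by rewrite lerD2l lerN2.
- by rewrite /psi ltrBlDr ltrDl expR_gt0.
Unshelve. all: by end_near. Qed.

Lemma time_inv_cvg : psi x @[x --> +oo] --> 1^'-.
Proof.
have h : psi x @[x --> +oo] --> (1 : R).
  rewrite -[X in _ --> X]subr0; apply: cvgB; first exact: cvg_cst.
  apply: (@cvg_comp _ _ _ (fun x : R => x / 2) (fun z => expR (- z)) _ (pinfty_nbhs R));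
    last exact: cvgr_expR.
  by apply: gt0_cvgMly; rewrite ?invr_gt0//; exact: cvg_id.
move=> A hA; have {}h : \forall x \near +oo, psi x < 1 -> A (psi x) by exact: h _ hA.
change (\forall x \near +oo, A (psi x)); apply: filterS h => x; apply.
by rewrite /psi ltrBlDr ltrDl expR_gt0.
Qed.

End time_change.

(** * Sturm-Liouville operators *)

Lemma volterra_adj_cvg0 (R : realType) (p q g : R -> R) : volterra_weights p q ->
  hmem (L2w itv01 p) g -> volterra_adj p g t @[t --> 1^'-] --> (0 : R).
Proof.
move=> vw hg; have ig := volterra_adj_integrable vw hg.
have I0 : (itv01 : set R) 0 by rewrite /= in_itv/= lexx ltr01.
have -> : (0 : R) = volterra_adj p g 0 - \int[@lebesgue_measure R]_(r in `[0, 1[) (p r * g r).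
  by rewrite (volterra_adjE _ _ I0) subrr.
apply: cvg_trans (cvgB (cvg_cst (volterra_adj p g 0)) (cvg_primitive_left ltr01 ig)).
apply: near_eq_cvg; near=> s; have Is : (itv01 : set R) s.
  by rewrite /= in_itv/=; apply/andP; split; near: s; [apply: nbhs_left_ge|exact: nbhs_left_lt].
rewrite -[LHS]/(volterra_adj p g 0 - \int[@lebesgue_measure R]_(t in `[0, s]) (p t * g t)).
by rewrite (volterra_adj_split vw hg Is) addrAC subrr add0r.
Unshelve. all: by end_near. Qed.

Lemma eq_hnorm_L2w (R : realType) (I : set R) (w f g : R -> R) :
  (forall x, I x -> f x = g x) -> hnorm (L2w I w) f = hnorm (L2w I w) g.
Proof.
by move=> fg; rewrite /hnorm; congr (Num.sqrt _); apply: eq_lRint => x Ix; rewrite fg.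
Qed.

Lemma primitive_loc_abs_cont (R : realType) (F g : R -> R) :
  (forall x, 0 <= x -> (@lebesgue_measure R).-integrable `[0, x] (EFin \o g)) ->
  (forall x, 0 <= x -> F x = F 0 + \int[@lebesgue_measure R]_(t in `[0, x]) g t) ->
  loc_abs_cont halfline (F : R -> R^o).
Proof.
move=> ig FE a b sab.
have [ba|ab] := ltP b a.
  apply: (@integral_abs_cont _ a b g) => [|x /andP[ax xb]]; last first.
    by have := lt_le_trans ba (le_trans ax xb); rewrite ltxx.
  by rewrite set_itv_ge ?bnd_simp -?ltNge//; exact: integrable_set0.
have a0 : 0 <= a.
  have /sab : `[a, b]%classic a by rewrite /= in_itv/= lexx ab.
  by rewrite /halfline /= in_itv/= andbT.
apply: (@integral_abs_cont _ a b g) => [|x /andP[ax xb]].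
  apply: integrableS (ig b (le_trans a0 ab)) => //.
  by apply: subset_itvr; rewrite bnd_simp.
have x0 := le_trans a0 ax; rewrite (FE x x0) (FE a a0).
by rewrite (@lRint_split _ 0 a (BRight x) g a0) ?bnd_simp// ?addrA//; exact: ig.
Qed.

Section sturm_liouville_theory.
Variables (R : realType) (m s p q : R -> R).
Notation I := (itv01 : set R).
Notation J := (@halfline R).
Notation phi := (@time_of R).
Notation psi := (@time_inv R).
Let mu := @lebesgue_measure R.
Hypotheses (vw : volterra_weights p q)
  (pE : forall t, I t -> m (phi t) * (2 * expR (phi t / 2)) = 4 * p t)
  (qE : forall t, I t -> s (phi t) * (2 * expR (phi t / 2)) = 4 * q t)
  (m0 : forall x, 0 < m x) (s0 : forall x, 0 < s x)
  (mm : measurable_fun J m) (ms : measurable_fun J s)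
  (cs : forall x, 0 < x -> {for x, continuous s}).
Notation Lp := (L2w I p).
Notation Lq := (L2w I q).
Notation Lm := (L2m m).

Let mI : measurable I. Proof. exact: measurable_itv. Qed.
Let mJ : measurable J. Proof. exact: measurable_itv. Qed.
Let gp : prehilbert Lp := prehilbert_L2w mI (vw_mp vw) (fun t It => ltW (vw_p0 vw It)).
Let bV := volterra_bounded vw.
Let bA := volterra_adj_bounded vw.

Lemma prehilbert_L2m : prehilbert Lm.
Proof. exact: (prehilbert_L2w mJ mm (fun x _ => ltW (m0 x))). Qed.
Let gm := prehilbert_L2m.

Let JE x : J x -> 0 <= x. Proof. by rewrite /halfline /= in_itv/= andbT. Qed.

Let inJ x : 0 <= x -> J x. Proof. by rewrite /halfline /= in_itv/= andbT. Qed.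

Let preJ : I `&` phi @^-1` J = I.
Proof. by apply/setIidl => t /time_of_ge0; exact: inJ. Qed.

Let preItv x : 0 <= x -> I `&` phi @^-1` `[0, x] = `[0, psi x]%classic.
Proof.
move=> x0; have := time_inv_in x0; rewrite /= in_itv/= => /andP[px0 px1].
apply/seteqP; split=> t /=; rewrite !in_itv/=.
  move=> [t01 /andP[_ tx]]; have It : I t by rewrite /= in_itv.
  by rewrite -[t](time_ofK It) time_inv_le tx andbT; case/andP: t01; rewrite time_ofK.
move=> /andP[t0 tx]; have It : I t by rewrite /= in_itv/= t0 (le_lt_trans tx).
split; first by rewrite t0 (le_lt_trans tx).
by rewrite time_of_ge0//= -time_inv_le time_ofK.
Qed.

Let subJ x : `[0, x] `<=` J.
Proof. by move=> y; rewrite /= in_itv/= => /andP[/inJ]. Qed.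

Let mcomp (f : R -> R) : measurable_fun J f -> measurable_fun I (f \o phi).
Proof.
move=> mf; apply: (@measurable_comp _ _ _ _ _ _ J) => //.
  by move=> _ [t It <-]; apply: inJ; exact: time_of_ge0.
exact: measurable_funS (@measurable_time_of R).
Qed.

Let mcompV (f : R -> R) : measurable_fun I f -> measurable_fun J (f \o psi).
Proof.
move=> mf; apply: (@measurable_comp _ _ _ _ _ _ I) => //.
  by move=> _ [x Jx <-]; exact/time_inv_in/JE.
exact: measurable_funS (@measurable_time_inv R).
Qed.

Lemma time_change_m (f : R -> R) : measurable_fun J f ->
  (\int[mu]_(x in J) (f x * m x)%:E = \int[mu]_(t in I) (4 * (f (phi t) * p t))%:E)%E.
Proof.
move=> mf; rewrite time_change//; last exact: measurable_funM.
rewrite preJ; apply: eq_lint => t It; congr (_%:E).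
by rewrite -mulrA pE//; ring.
Qed.

Let hmemU f : hmem Lm f <-> hmem Lp (f \o phi).
Proof.
have E : measurable_fun J f ->
    (\int[mu]_(x in J) (f x ^+ 2 * m x)%:E = 4%:E * \int[mu]_(t in I) ((f \o phi) t ^+ 2 * p t)%:E)%E.
  move=> mf; rewrite (@time_change_m (fun x => f x ^+ 2)); last exact: measurable_funX.
  rewrite -ge0_integralZl_EFin//.
  - by move=> t It; rewrite lee_fin mulr_ge0 ?sqr_ge0// ltW// (vw_p0 vw).
  - apply/measurable_EFinP; apply: measurable_funM; last exact: (vw_mp vw).
    by apply: measurable_funX; exact: mcomp.
split=> [[mf foo]|[mf foo]].
  split; first exact: mcomp.
  move: foo; rewrite E// => foo.
  rewrite -[X in (X < _)%E]mul1e -(_ : ((4^-1)%:E * 4%:E)%E = 1%E); last by rewrite -EFinM mulVf.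
  by rewrite -muleA lte_mul_pinfty// lee_fin.
have mf' : measurable_fun J f.
  apply: eq_measurable_fun (mcompV mf) => x /set_mem Jx.
  by rewrite /= time_invK.
by split => //; rewrite E// lte_mul_pinfty.
Qed.

Let ipU f g : hmem Lm f -> hmem Lm g -> ip Lm f g = 4 * ip Lp (f \o phi) (g \o phi).
Proof.
move=> hf hg; have [mf _] := hf; have [mg _] := hg.
have hf' := (hmemU f).1 hf; have hg' := (hmemU g).1 hg.
have ig := L2w_integrable mI (vw_mp vw) (fun t It => ltW (vw_p0 vw It)) hf' hg'.
rewrite /= -lRintegralZ// /Rintegral; congr fine.
by rewrite (@time_change_m (fun x => f x * g x)); [apply: eq_lint|exact: measurable_funM].
Qed.

(** With [h = s^-1 f'] the tail integral of [m g] and [f] the integral of [s h], each of the two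
    integrations contributes a factor 4. *)
Definition sl_inverse (g : R -> R) : R -> R :=
  fun x => 16 * volterra q (volterra_adj p (g \o phi)) (psi x).
Notation KG := sl_inverse.

Let K' := volterra q \o volterra_adj p.

Let bK' : bounded_op Lp Lp K'.
Proof.
have [C C0 HC] := bop_bound bV; have [C' C'0 HC'] := bop_bound bA; split.
- move=> a u v hu hv; rewrite /K' /= (bop_linear bA)// (bop_linear bV)//; exact: (bop_hmem bA).
- by move=> u hu; apply: (bop_hmem bV); exact: (bop_hmem bA).
- exists (C * C'); first exact: mulr_ge0.
  move=> u hu; apply: le_trans (HC _ (bop_hmem bA hu)) _; rewrite -mulrA.
  by apply: ler_wpM2l => //; exact: HC'.
Qed.

Let KGU g t : I t -> (KG g \o phi) t = 16 * K' (g \o phi) t.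
Proof. by move=> It; rewrite /= /KG time_ofK. Qed.

Let hnU f : hmem Lm f -> hnorm Lm f = 2 * hnorm Lp (f \o phi).
Proof.
move=> hf; rewrite /hnorm ipU// sqrtrM//; congr (_ * _).
by rewrite (_ : 4 = 2 ^+ 2) ?sqrtr_sqr ?ger0_norm// -natrX.
Qed.

Lemma sl_inverse_bounded : bounded_op Lm Lm KG.
Proof.
have KGh g : hmem Lm g -> hmem Lm (KG g) /\ hnorm Lm (KG g) = 32 * hnorm Lp (K' (g \o phi)).
  move=> /hmemU hg; have hK := bop_hmem bK' hg.
  have h : hmem Lp (KG g \o phi).
    by apply: eq_hmem_L2w (hmemZ gp 16 hK) => t It; rewrite KGU.
  split; first exact/hmemU.
  rewrite hnU; last exact/hmemU.
  have -> : hnorm Lp (KG g \o phi) = hnorm Lp (16 *: K' (g \o phi)).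
    by apply: eq_hnorm_L2w => t It; rewrite KGU.
  by rewrite (hnormZ gp)// ger0_norm// mulrA; congr (_ * _); rewrite -natrM.
split.
- move=> a u v hu hv; apply/funext => x.
  have -> : (a *: KG u + KG v) x = a * KG u x + KG v x by [].
  rewrite /KG; have -> : (a *: u + v) \o phi = a *: (u \o phi) + (v \o phi) by [].
  have := bop_linear bK' a ((hmemU u).1 hu) ((hmemU v).1 hv).
  move=> /(congr1 (fun F => F (psi x))); rewrite /K' /= => ->.
  have E (F G : R -> R) y : (a *: F + G) y = a * F y + G y by [].
  by rewrite E mulrDr mulrCA.
- by move=> u /KGh[].
- have [C C0 HC] := bop_bound bK'; exists (16 * C); first exact: mulr_ge0.
  move=> u hu; have [_ ->] := KGh u hu; rewrite hnU//.
  have := HC _ ((hmemU u).1 hu) => h.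
  have -> : 16 * C * (2 * hnorm Lp (u \o phi)) = 32 * (C * hnorm Lp (u \o phi)) by ring.
  by apply: ler_wpM2l.
Qed.

Let tcR (F : R -> R) x : 0 <= x -> measurable_fun J F ->
  \int[mu]_(y in `[0, x]) F y = \int[mu]_(t in `[0, psi x]) (F (phi t) * (2 * expR (phi t / 2))).
Proof.
move=> x0 mF; rewrite /Rintegral time_change//; first by rewrite preItv.
exact: measurable_funS mF.
Qed.

Let subI t : I t -> `[0, t] `<=` I.
Proof.
by rewrite /= in_itv/= => /andP[_ t1] r /=; rewrite !in_itv/= => /andP[-> rt]; exact: le_lt_trans t1.
Qed.

Let tc_m (g : R -> R) t : measurable_fun J g -> I t ->
  \int[mu]_(y in `[0, phi t]) (m y * g y) = \int[mu]_(r in `[0, t]) (4 * (p r * (g \o phi) r)).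
Proof.
move=> mg It; rewrite tcR ?time_of_ge0//; last exact: measurable_funM.
rewrite time_ofK//; apply: eq_lRint => r /(subI It) Ir /=.
by rewrite mulrAC pE// mulrA.
Qed.

Let tc_s (g : R -> R) t : measurable_fun J g -> I t ->
  \int[mu]_(y in `[0, phi t]) (s y * g y) = \int[mu]_(r in `[0, t]) (4 * (q r * (g \o phi) r)).
Proof.
move=> mg It; rewrite tcR ?time_of_ge0//; last exact: measurable_funM.
rewrite time_ofK//; apply: eq_lRint => r /(subI It) Ir /=.
by rewrite mulrAC qE// mulrA.
Qed.

Let phipsi (P : R -> Prop) : (forall t, I t -> P (phi t)) -> forall x, 0 <= x -> P x.
Proof. by move=> H x x0; rewrite -[x]time_invK; apply: H; exact: time_inv_in. Qed.

Let dae (f : R -> R) : loc_abs_cont J (f : R -> R^o) ->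
  {ae mu, forall x, J x -> derivable f x 1}.
Proof.
apply: (@loc_abs_cont_derivable_ae _ _ _ 0 (fun n => n%:R)).
  by move=> n; split => //; exact: subJ.
move=> x /JE x0; split => //; exists (Num.truncn x).+1; exact: truncnS_gt.
Qed.

Lemma sl_inverse_left f g : sturm_liouville m s f g -> [/\ hmem Lm f, hmem Lm g & hequiv Lm f (KG g)].
Proof.
move=> [acf [hf hg] f0 [h [ach hE gE h0]]]; split => //.
have hg' := (hmemU g).1 hg; have [mg _] := hg; set g' := g \o phi in hg'.
have mh : measurable_fun J h by exact: loc_abs_cont_measurable_halfline.
have ig := volterra_adj_integrable vw hg'.
have hP t : I t -> h (phi t) = h 0 - 4 * volterra_adj p g' 0 + 4 * volterra_adj p g' t.
  move=> It; have mmg : measurable_fun J (fun x => - (m x * g x)).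
    by apply: measurableT_comp => //; exact: measurable_funM.
  have gE' : {ae mu, forall x, J x -> derivable h x 1 -> - (m x * g x) = derive1 h x}.
    apply: ae_filterS gE => x gE Jx _; rewrite gE//.
    by rewrite mulrN opprK mulVKf// gt_eqF.
  have [ih ->] := abs_cont_primitive mJ ach (@subJ _) (time_of_ge0 It) mmg gE'.
  rewrite (volterra_adj_split vw hg' It).
  have igt : mu.-integrable `[0, t] (EFin \o (fun r => p r * g' r)).
    by apply: integrableS ig => //; exact: subI.
  have -> : \int[mu]_(x in `[0, phi t]) - (m x * g x) =
      \int[mu]_(x in `[0, phi t]) (m x * (- g x)).
    by apply: eq_lRint => x _; rewrite mulrN.
  rewrite tc_m//; last exact: measurableT_comp.
  have -> : \int[mu]_(r in `[0, t]) (4 * (p r * ((fun x => - g x) \o phi) r)) =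
      - 4 * \int[mu]_(r in `[0, t]) (p r * g' r).
    by rewrite -lRintegralZ//; apply: eq_lRint => r _ /=; rewrite /g' /=; ring.
  ring.
(* Here the Neumann condition enters: [h] and the tail integral both tend to 0, so the constant
   between them vanishes. *)
have c0 : h 0 - 4 * volterra_adj p g' 0 = 0.
  have c1 : h (phi t) @[t --> 1^'-] --> (0 : R) by exact: cvg_comp (@time_of_cvg R) h0.
  have c2 : h 0 - 4 * volterra_adj p g' 0 + 4 * volterra_adj p g' t @[t --> 1^'-] -->
      h 0 - 4 * volterra_adj p g' 0 + 4 * 0.
    by apply: cvgD; [exact: cvg_cst|apply: cvgMr; exact: volterra_adj_cvg0 vw hg'].
  have c3 : h (phi t) @[t --> 1^'-] --> h 0 - 4 * volterra_adj p g' 0 + 4 * 0.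
    apply: cvg_trans c2; apply: near_eq_cvg; near=> t; rewrite hP//.
    by rewrite /= in_itv/=; apply/andP; split; near: t; [apply: nbhs_left_ge|exact: nbhs_left_lt].
  have := cvg_unique _ c1 c3; rewrite mulr0 addr0 => <-//.
apply: (@eq_hequiv_L2w _ J m) => x /JE x0; move: x x0; apply: phipsi => t It.
have sE : {ae mu, forall x, J x -> derivable f x 1 -> s x * h x = derive1 f x}.
  apply: ae_filterS (ae_neq 0) => x x00 /JE x0 _.
  by rewrite hE ?mulVKf ?gt_eqF// lt_neqAle eq_sym x00.
have msh : measurable_fun J (fun x => s x * h x) by exact: measurable_funM.
have [_ ->] := abs_cont_primitive mJ acf (@subJ _) (time_of_ge0 It) msh sE.
rewrite f0 add0r tc_s// /KG time_ofK// volterraE//.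
have hA := bop_hmem bA hg'.
rewrite -lRintegralZ//; last exact: (volterra_cs vw hA It).1.
apply: eq_lRint => r /(subI It) Ir /=; rewrite hP// c0 add0r; ring.
Unshelve. all: by end_near. Qed.

(** The relation [h = s^-1 f'] is demanded at every positive point, so the derivative of [f] is
    taken from the continuity of [s h] rather than from almost everywhere differentiation. *)
Lemma sl_inverse_right w : hmem Lm w -> sturm_liouville m s (KG w) w.
Proof.
move=> hw; have hg' := (hmemU w).1 hw; have [mw _] := hw; set g' := w \o phi in hg'.
have ig := volterra_adj_integrable vw hg'; have hA := bop_hmem bA hg'.
have hV := bop_hmem sl_inverse_bounded hw.
pose h x := 4 * volterra_adj p g' (psi x).
have mh : measurable_fun J h.
  apply: measurable_funM; first exact: measurable_cst.
  exact: (mcompV (volterra_adj_measurable vw hg')).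
have msh : measurable_fun J (fun x => s x * h x) by exact: measurable_funM.
have mmw : measurable_fun J (fun x => - (m x * w x)).
  by apply: measurableT_comp => //; exact: measurable_funM.
have psi0 : psi 0 = 0 by rewrite /psi mul0r oppr0 expR0 subrr.
have ish : forall x, 0 <= x -> mu.-integrable `[0, x] (EFin \o (fun x => s x * h x)).
  apply: phipsi => t It; apply/time_change_integrable => //.
  - exact: measurable_funS msh.
  - rewrite preItv ?time_of_ge0// time_ofK//.
    apply: (@eq_lintegrable _ _ (fun r => 16 * (q r * volterra_adj p g' r))) => //.
      move=> r /(subI It) Ir; by rewrite mulrAC (qE Ir) /h (time_ofK Ir) mulrACA -natrM.
    apply: lintegrableZ => //; exact: (volterra_cs vw hA It).1.
have imw : forall x, 0 <= x -> mu.-integrable `[0, x] (EFin \o (fun x => - (m x * w x))).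
  apply: phipsi => t It; apply/time_change_integrable => //.
  - exact: measurable_funS mmw.
  - rewrite preItv ?time_of_ge0// time_ofK//.
    apply: (@eq_lintegrable _ _ (fun r => - 4 * (p r * g' r))) => //.
      move=> r /(subI It) Ir; by rewrite [RHS]mulNr mulrAC pE// mulNr mulrA.
    by apply: lintegrableZ => //; apply: integrableS ig => //; exact: subI.
have KG0 : KG w 0 = 0.
  by rewrite /KG psi0 volterraE /= ?in_itv/= ?lexx ?ltr01// set_itv1 Rintegral_set1 mulr0.
have fP : forall x, 0 <= x -> KG w x = KG w 0 + \int[mu]_(y in `[0, x]) (s y * h y).
  apply: phipsi => t It; rewrite KG0 add0r tc_s// /KG time_ofK// volterraE//.
  rewrite -lRintegralZ//; last exact: (volterra_cs vw hA It).1.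
  by apply: eq_lRint => r /(subI It) Ir /=; rewrite /h time_ofK//; ring.
have hP : forall x, 0 <= x -> h x = h 0 + \int[mu]_(y in `[0, x]) - (m y * w y).
  apply: phipsi => t It; rewrite /h psi0 time_ofK// (volterra_adj_split vw hg' It).
  have -> : \int[mu]_(x in `[0, phi t]) - (m x * w x) =
      \int[mu]_(x in `[0, phi t]) (m x * (- w x)).
    by apply: eq_lRint => x _; rewrite mulrN.
  rewrite tc_m//; last exact: measurableT_comp.
  have -> : \int[mu]_(r in `[0, t]) (4 * (p r * ((fun x => - w x) \o phi) r)) =
      - 4 * \int[mu]_(r in `[0, t]) (p r * g' r).
    rewrite -lRintegralZ//; first by apply: eq_lRint => r _ /=; rewrite /g' /=; ring.
    by apply: integrableS ig => //; exact: subI.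
  ring.
have ach : loc_abs_cont J (h : R -> R^o) by exact: primitive_loc_abs_cont imw hP.
split => //; first exact: primitive_loc_abs_cont ish fP.
exists h; split => //.
- move=> x x0; have x1 : x < x + 1 by rewrite ltrDl.
  have x10 : 0 < x + 1 by exact: lt_trans x1.
  have ch : {for x, continuous h}.
    have := abs_cont_continuous (ach 0 (x + 1) (@subJ _)).
    move=> /(continuous_within_itvP _ x10)[+ _ _]; apply; by rewrite in_itv/= x0.
  have csh : {for x, continuous (fun x => s x * h x)} by apply: continuousM => //; exact: cs.
  have [] := continuous_FTC1_closed x1 (ish _ (ltW x10)) x0 csh.
  set G := (fun x : R => _) => dG GE.
  have nearE : {near x, G =1 KG w}.
    near=> y; rewrite fP ?KG0 ?add0r//; near: y.
    by apply: (@filterS _ (nbhs x) _ (fun y => 0 < y)) => [y /ltW //|]; exact: lt_nbhsr.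
  clearbody G; have isG : is_derive x (1 : R) G (s x * h x) by apply: DeriveDef => //; rewrite -derive1E.
  have isF : is_derive x (1 : R) (KG w) (s x * h x) by exact: near_eq_is_derive nearE isG.
  by rewrite derive1E derive_val mulKf// gt_eqF.
- have bJ (n : nat) : J n%:R by exact: inJ.
  have bE x : J x -> 0 <= x /\ exists n : nat, x < n%:R.
    by move=> /JE x0; split => //; exists (Num.truncn x).+1; exact: truncnS_gt.
  have sub x y : J x -> 0 <= y <= x -> J y by move=> _ /andP[y0 _]; exact: inJ.
  have := primitive_derive1_ae bJ bE (fun x Jx => imw x (JE Jx)) sub (fun x Jx => hP x (JE Jx)).
  apply: ae_filterS => x H Jx; have [_ ->] := H Jx.
  by rewrite mulrN opprK mulKf// gt_eqF.
- rewrite -(mulr0 4); apply: cvgMr.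
  exact: cvg_comp (@time_inv_cvg R) (volterra_adj_cvg0 vw hg').
Unshelve. all: by end_near. Qed.

Lemma sl_inverseP : inverse_of Lm (sturm_liouville m s) KG.
Proof. by split; [exact: sl_inverse_bounded|exact: sl_inverse_left|exact: sl_inverse_right]. Qed.

Lemma sl_solvable_at z : solvable_at Lm KG z <-> solvable_at Lp K' (z * 16%:C).
Proof.
apply: (@transport_solvable_at _ _ _ Lm Lp 4 16 (fun f => f \o phi) (fun f => f \o psi)).
- exact: gm.
- exact: gp.
- by [].
- by [].
- exact: hmemU.
- exact: ipU.
- move=> u hu; have e t : I t -> u t = ((u \o psi) \o phi) t by move=> It; rewrite /= time_ofK.
  have h : hmem Lp ((u \o psi) \o phi) by apply: eq_hmem_L2w hu.
  split; first exact/hmemU.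
  by apply: hequiv_sym => //; exact: eq_hequiv_L2w.
- exact: sl_inverse_bounded.
- exact: bK'.
- by move=> v hv; apply: eq_hequiv_L2w => t It; rewrite KGU.
Qed.

End sturm_liouville_theory.

(** * Paths of sublinear growth *)

Lemma integral_exp_tail (R : realType) (r x : R) : 0 < r ->
  (\int[@lebesgue_measure R]_(y in `[x, +oo[) (expR (- r * y))%:E = (expR (- r * x) / r)%:E)%E.
Proof.
move=> r0.
have cexp : continuous (fun y : R => expR (- r * y)).
  move=> y; apply: (@continuous_comp _ _ _ (fun y => - r * y) expR); last exact: continuous_expR.
  exact: mulrl_continuous.
rewrite (@ge0_continuous_FTC2y _ _ (fun y => - (expR (- r * y) / r)) _ 0).
- by rewrite sub0e EFinN oppeK.
- by move=> y _; exact: expR_ge0.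
- exact: continuous_subspaceT.
- rewrite -oppr0; apply: cvgN; rewrite -(mul0r r^-1); apply: cvgMl.
  rewrite (_ : (fun x => _) = (fun z => expR (- z)) \o (fun z => r * z)); last first.
    by apply/funext => y /=; rewrite mulNr.
  by apply: (@cvg_comp _ _ _ _ _ _ (pinfty_nbhs R)); [exact: gt0_cvgMry|exact: cvgr_expR].
- by move=> y _; exact: ex_derive.
- by apply/cvg_at_right_filter; apply: cvgN; apply: cvgMl; exact: cexp.
- move=> y _; rewrite derive1E derive_val; rewrite /GRing.scale/=; field.
  by rewrite gt_eqF.
Qed.

Lemma integrable_exp_tail (R : realType) (r x : R) : 0 < r ->
  (@lebesgue_measure R).-integrable `[x, +oo[ (EFin \o (fun y => expR (- r * y))).
Proof.
move=> r0; apply: integrable_of_ge0.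
- apply: measurable_funS (_ : measurable_fun setT _) => //.
  apply: measurableT_comp; first exact: measurable_expR.
  by apply: measurable_funM.
- by move=> y _; exact: expR_ge0.
- by rewrite integral_exp_tail// ltry.
Qed.

Section path.
Variables (R : realType) (beta a : R) (b : R -> R).
Hypotheses (beta0 : 0 < beta) (a1 : -1 < a).
Notation c := (2 / Num.sqrt beta).
Notation I := (itv01 : set R).
Notation J := (@halfline R).
Notation phi := (@time_of R).
Notation psi := (@time_inv R).
Let mu := @lebesgue_measure R.
Hypotheses (cb : {within `[0, +oo[, continuous b})
  (bb : forall e : R, 0 < e -> exists C, forall x, 0 <= x -> `|c * b x| <= C + e * x)
  (ib : ~ mu.-integrable J (EFin \o (fun x => expR (c * b x)))).
Notation y := (bessel_ytilde beta a b).
Notation m := (sl_m beta a b).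
Notation s := (sl_s beta a b).
Let p t := (2 * y t)^-1.
Let q t := y t / 2.
Let mI : measurable I. Proof. exact: measurable_itv. Qed.
Let mJ : measurable J. Proof. exact: measurable_itv. Qed.

Let JE x : J x -> 0 <= x. Proof. by rewrite /halfline /= in_itv/= andbT. Qed.
Let inJ x : 0 <= x -> J x. Proof. by rewrite /halfline /= in_itv/= andbT. Qed.

Let yE t : y t = expR (c * b (phi t) + (2 * a + 1) * (phi t / 2)).
Proof.
rewrite /bessel_ytilde /bessel_y /time_of mulrN; congr (expR (_ + _ * _)).
by rewrite mulNr mulrAC divff// mul1r.
Qed.

Let y0 t : 0 < y t. Proof. by rewrite yE expR_gt0. Qed.

Let mb : measurable_fun J b.
Proof. exact: subspace_continuous_measurable_fun. Qed.

Let mcb : measurable_fun J (fun x => c * b x).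
Proof. by apply: measurable_funM => //; exact: measurable_cst. Qed.

Let mid (k : R) : measurable_fun J (fun x => k * x).
Proof. by apply: measurable_funM => //; exact: measurable_cst. Qed.

Let mm : measurable_fun J m.
Proof.
by apply: measurableT_comp; [exact: measurable_expR|exact: measurable_funB].
Qed.

Let ms : measurable_fun J s.
Proof.
by apply: measurableT_comp; [exact: measurable_expR|exact: measurable_funD].
Qed.

Let pE t : m (phi t) * (2 * expR (phi t / 2)) = 4 * p t.
Proof.
rewrite /p invfM yE -expRN /sl_m mulrCA -expRD [RHS]mulrA.
have -> : 4 / 2 = 2 :> R by field.
by move: (c * b (phi t)) => z; congr (_ * expR _); field.
Qed.

Let qE t : s (phi t) * (2 * expR (phi t / 2)) = 4 * q t.
Proof.
rewrite /q yE /sl_s mulrCA -expRD mulrCA.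
have -> : 4 / 2 = 2 :> R by field.
by rewrite [RHS]mulrC; move: (c * b (phi t)) => z; congr (_ * expR _); field.
Qed.

Let cs x : 0 < x -> {for x, continuous s}.
Proof.
move=> x0; have cbx : {for x, continuous b}.
  by move: cb => /continuous_within_itvcyP[+ _]; apply; rewrite in_itv/= andbT.
apply: (@continuous_comp _ _ _ (fun x => a * x + c * b x) expR); last exact: continuous_expR.
apply: continuousD; first by apply: continuousM => //; exact: cst_continuous.
by apply: continuousM => //; exact: cst_continuous.
Qed.

Let phi_mono t u : I u -> 0 <= t <= u -> 0 <= phi t <= phi u.
Proof.
move=> Iu /andP[t0 tu]; have It : I t.
  by move: Iu; rewrite /= !in_itv/= t0 => /andP[_]; exact: le_lt_trans.
by rewrite time_of_ge0//= -time_inv_le !time_ofK.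
Qed.

Let mphi (f : R -> R) : measurable_fun J f -> measurable_fun I (f \o phi).
Proof.
move=> mf; apply: (@measurable_comp _ _ _ _ _ _ J) => //.
  by move=> _ [t It <-]; apply: inJ; exact: time_of_ge0.
exact: measurable_funS (@measurable_time_of R).
Qed.

Let mW : measurable_fun I (fun t => 2 * expR (phi t / 2)).
Proof.
apply: measurable_funM; first exact: measurable_cst.
apply: measurableT_comp; first exact: measurable_expR.
by apply: measurable_funM => //; exact: measurable_funS (@measurable_time_of R).
Qed.

Let mp : measurable_fun I p.
Proof.
apply: (eq_measurable_fun (fun t => 4^-1 * (m (phi t) * (2 * expR (phi t / 2))))).
  by move=> t _; rewrite pE mulKf.
apply: measurable_funM; first exact: measurable_cst.
by apply: measurable_funM => //; exact: (mphi mm).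
Qed.

Let mq : measurable_fun I q.
Proof.
apply: (eq_measurable_fun (fun t => 4^-1 * (s (phi t) * (2 * expR (phi t / 2))))).
  by move=> t _; rewrite qE mulKf.
apply: measurable_funM; first exact: measurable_cst.
by apply: measurable_funM => //; exact: (mphi ms).
Qed.

Let m_le (e C x : R) : `|c * b x| <= C + e * x -> m x <= expR C * expR (- (a + 1 - e) * x).
Proof.
rewrite ler_norml => /andP[h _]; rewrite -expRD ler_expR; lra.
Qed.

Let preTail t : I t -> I `&` phi @^-1` `[phi t, +oo[ = `[t, 1[%classic.
Proof.
move=> It; apply/seteqP; split=> r /=; rewrite !in_itv/= !andbT.
  move=> [/andP[r0 r1]]; rewrite r1 andbT -time_inv_le !time_ofK//.
  by rewrite /= in_itv/= r0.
move=> /andP[tr r1]; have Ir : I r.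
  by move: It; rewrite /= !in_itv/= r1 andbT => /andP[t0 _]; exact: le_trans tr.
by split; [move: Ir; rewrite /= in_itv|rewrite -time_inv_le !time_ofK].
Qed.

Let int_m (e C x : R) : 0 < a + 1 - e -> (forall x, 0 <= x -> `|c * b x| <= C + e * x) ->
  0 <= x -> mu.-integrable `[x, +oo[ (EFin \o m) /\
  (\int[mu]_(z in `[x, +oo[) (m z)%:E <=
   (expR C * (expR (- (a + 1 - e) * x) / (a + 1 - e)))%:E)%E.
Proof.
move=> r0 bC x0; have sub : `[x, +oo[ `<=` J by apply: subset_itvr; rewrite bnd_simp.
have ie : mu.-integrable `[x, +oo[ (EFin \o (fun z => expR C * expR (- (a + 1 - e) * z))).
  by apply: lintegrableZ => //; exact: integrable_exp_tail.
have mmx : measurable_fun `[x, +oo[ m by exact: measurable_funS mm.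
split.
  apply: (le_lintegrable _ mmx _ ie) => // z /sub/JE z0.
  by rewrite ger0_norm ?expR_ge0//; apply: m_le; exact: bC.
apply: (@le_trans _ _ (\int[mu]_(z in `[x, +oo[) (expR C * expR (- (a + 1 - e) * z))%:E)%E).
  apply: le_lint => //.
  - exact/measurable_EFinP.
  - by apply/measurable_EFinP; apply/measurable_EFinP; exact: measurable_int ie.
  - by move=> z _; rewrite lee_fin expR_ge0.
  - by move=> z /sub/JE z0; rewrite lee_fin; apply: m_le; exact: bC.
rewrite (@eq_lint _ _ _ (fun z => (expR C)%:E * (expR (- (a + 1 - e) * z))%:E)%E); last by [].
rewrite ge0_integralZl_EFin ?expR_ge0//.
  by rewrite integral_exp_tail// -EFinM.
exact: (measurable_int _ (integrable_exp_tail x r0)).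
Qed.

Lemma path_volterra_weights : volterra_weights p q.
Proof.
(* [e <= (a + 1) / 2] lets [m] decay at the rate [a + 1 - e > 0]; [e <= 1/4] keeps the growth of
   [q], at the rate [a + 1/2 + e], no faster than that decay, so [vw_hs] holds. *)
pose e := Num.min (4^-1) ((a + 1) / 2).
have a10 : 0 < a + 1 by rewrite -ltrBlDr sub0r.
have e0 : 0 < e by rewrite /e lt_min; apply/andP; split; [rewrite invr_gt0|apply: divr_gt0].
have e4 : e <= 4^-1 by rewrite ge_min lexx.
have ea : e <= (a + 1) / 2 by rewrite ge_min lexx orbT.
clearbody e; have r0 : 0 < a + 1 - e by lra.
have [C bC] := bb e0.
have ip0 : mu.-integrable I (EFin \o p).
  have [im _] := int_m r0 bC (lexx 0).
  have /(time_change_integrable mJ (fun x Jx => Jx) mm) := im.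
  have -> : I `&` phi @^-1` J = I by apply/setIidl => t /time_of_ge0; exact: inJ.
  move=> /(lintegrableZ 4^-1 mI); apply: eq_lintegrable => // t It.
  by rewrite pE mulKf.
split => //.
- by move=> t _; rewrite /p invr_gt0 mulr_gt0.
- by move=> t _; rewrite /q divr_gt0.
- move=> u u1; have [u0|u0] := ltP u 0.
    by exists 0 => t /andP[t0 tu]; have := le_lt_trans (le_trans t0 tu) u0; rewrite ltxx.
  have Iu : I u by rewrite /= in_itv/= u0.
  exists (expR (C + e * phi u + `|2 * a + 1| * (phi u / 2))) => t tu.
  have /andP[pt0 ptu] := phi_mono Iu tu.
  have h1 : `|c * b (phi t)| <= C + e * phi u.
    by apply: le_trans (bC _ pt0) _; rewrite lerD2l ler_pM2l.
  have h2 : `|(2 * a + 1) * (phi t / 2)| <= `|2 * a + 1| * (phi u / 2).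
    by rewrite normrM ler_wpM2l// ger0_norm ?divr_ge0// ler_pM2r.
  rewrite /p /q invfM yE -expRN.
  have half (x z : R) : x <= z -> 0 < expR x / 2 <= expR z.
    move=> xz; have := expR_gt0 x; have : expR x <= expR z by rewrite ler_expR.
    by move=> ? ?; apply/andP; split; lra.
  move: h1 h2; rewrite !ler_norml => /andP[h1 h2] /andP[h3 h4].
  split.
    by rewrite mulrC; have /half/andP[] : - (c * b (phi t) + (2 * a + 1) * (phi t / 2)) <=
      C + e * phi u + `|2 * a + 1| * (phi u / 2) by rewrite opprD lerD// lerNl.
  by have /half/andP[] : c * b (phi t) + (2 * a + 1) * (phi t / 2) <=
      C + e * phi u + `|2 * a + 1| * (phi u / 2) by rewrite lerD.
- exists (8^-1 * (expR C * expR C / (a + 1 - e))).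
    by rewrite mulr_ge0// divr_ge0 ?mulr_ge0 ?expR_ge0// ltW.
  move=> t It; have pt0 := time_of_ge0 It.
  have [im im_le] := int_m r0 bC pt0.
  have sub : `[phi t, +oo[ `<=` J by apply: subset_itvr; rewrite bnd_simp.
  have PE : (\int[mu]_(r in `[phi t, +oo[) (m r)%:E = \int[mu]_(r in `[t, 1%R[) (4 * p r)%:E)%E.
    rewrite time_change//; last exact: measurable_funS mm.
    by rewrite preTail//; apply: eq_lint => r _; rewrite pE.
  have P4 : 4 * \int[mu]_(r in `[t, 1[) p r <= expR C * (expR (- (a + 1 - e) * phi t) / (a + 1 - e)).
    have ip : mu.-integrable `[t, 1[ (EFin \o p).
      apply: integrableS ip0 => //; apply: subset_itvr; rewrite bnd_simp.
      by move: It; rewrite /= in_itv/= => /andP[].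
    rewrite -lRintegralZ// -lee_fin lRintegral_int//; last exact: lintegrableZ.
    by rewrite -PE.
  have qC : q t <= 2^-1 * (expR C * expR ((a + 2^-1 + e) * phi t)).
    rewrite /q yE mulrC; apply: ler_wpM2l => //; rewrite -expRD ler_expR.
    have := bC _ pt0; rewrite ler_norml => /andP[_]; lra.
  have P0 : 0 <= \int[mu]_(r in `[t, 1[) p r.
    by apply: Rintegral_ge0 => r _; rewrite /p invr_ge0 mulr_ge0// ltW.
  have q0 : 0 <= q t by rewrite /q divr_ge0// ltW.
  rewrite -[X in q t * X](@mulKf _ 4)// mulrCA.
  apply: le_trans (_ : 4^-1 * (2^-1 * (expR C * expR ((a + 2^-1 + e) * phi t)) *
      (expR C * (expR (- (a + 1 - e) * phi t) / (a + 1 - e)))) <= _).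
    by apply: ler_wpM2l => //; apply: ler_pM => //; rewrite mulr_ge0.
  have -> : 4^-1 * (2^-1 * (expR C * expR ((a + 2^-1 + e) * phi t)) *
      (expR C * (expR (- (a + 1 - e) * phi t) / (a + 1 - e)))) =
    8^-1 * (expR C * expR C / (a + 1 - e)) *
    (expR ((a + 2^-1 + e) * phi t) * expR (- (a + 1 - e) * phi t)).
    by field; rewrite gt_eqF.
  rewrite ger_pMr; last first.
    apply: mulr_gt0; first by rewrite invr_gt0.
    by apply: divr_gt0 => //; apply: mulr_gt0; exact: expR_gt0.
  rewrite -expRD -[leRHS]expR0 ler_expR -mulrDl; apply: mulr_le0_ge0 => //; lra.
Qed.

Let vw := path_volterra_weights.

Let q_integrable : mu.-integrable I (EFin \o q) <-> mu.-integrable J (EFin \o s).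
Proof.
have E := time_change_integrable mJ (fun x Jx => Jx) ms.
have IJ : I `&` phi @^-1` J = I by apply/setIidl => t /time_of_ge0; exact: inJ.
rewrite IJ in E; split=> [iq|/E is_].
  apply/E; apply: eq_lintegrable (lintegrableZ 4 mI iq) => // t _; by rewrite qE.
by apply: eq_lintegrable (lintegrableZ 4^-1 mI is_) => // t _; rewrite qE mulKf.
Qed.

Lemma path_limit_circle : a < 0 -> limit_circle_case (bessel beta a b).
Proof.
move=> a0; apply/(diagonal_limit_circle vw)/q_integrable.
(* Half of the drift [- a] is spent on the path, and [s] still decays at the rate [- a / 2]. *)
have r0 : 0 < - a / 2 by rewrite divr_gt0// oppr_gt0.
have [C bC] := bb r0.
have ie : mu.-integrable J (EFin \o (fun z => expR C * expR (- (- a / 2) * z))).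
  by apply: lintegrableZ => //; exact: integrable_exp_tail.
apply: (le_lintegrable mJ ms _ ie) => x /JE x0; rewrite ger0_norm ?expR_ge0//.
rewrite -expRD ler_expR; have := bC x x0; rewrite ler_norml => /andP[_].
by move: (c * b x) => z; lra.
Qed.

(** For [a >= 0] the weight [s] dominates [expR (c * b x)], so integrability of [q] would pass to
    that function. *)
Lemma path_limit_point : 0 <= a -> limit_point_case (bessel beta a b).
Proof.
move=> a0 /(diagonal_limit_circle vw)/q_integrable is_; apply: ib.
apply: (le_lintegrable mJ _ _ is_) => [|x /JE x0].
  by apply: measurableT_comp => //; exact: measurable_expR.
by rewrite ger0_norm ?expR_ge0// ler_expR lerDr mulr_ge0.
Qed.

Let D := bessel beta a b.

(** Both spectra are tested on the same operator, at [w ^ 2] for Dirac and at [16 z] for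
    Sturm-Liouville. The principal root selects one of [w / 4] and [- w / 4]; the union of the two
    images restores the other. *)
Lemma path_spec : spec (L2R D) (dirac_op D) =
  let specG := spec (sl_space beta a b) (sl_op beta a b) in
  [set 4 * z | z in sqrt_set specG] `|` [set - (4 * z) | z in sqrt_set specG].
Proof.
have SA w : spec (L2R D) (dirac_op D) w <->
    ~ solvable_at (L2w I p) (volterra q \o volterra_adj p) (w * w).
  apply: iff_trans (spec_solvable_at (prehilbert_L2R vw) (dirac_inverseP vw) w) _.
  by split=> h h'; apply: h; apply/(dirac_solvable_at vw).
have sm0 x : 0 < m x by exact: expR_gt0.
have ss0 x : 0 < s x by exact: expR_gt0.
have pE' t : I t -> m (phi t) * (2 * expR (phi t / 2)) = 4 * p t by move=> _; exact: pE.
have qE' t : I t -> s (phi t) * (2 * expR (phi t / 2)) = 4 * q t by move=> _; exact: qE.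
have SG z : spec (sl_space beta a b) (sl_op beta a b) z <->
    ~ solvable_at (L2w I p) (volterra q \o volterra_adj p) (z * 16%:C).
  apply: iff_trans (spec_solvable_at (prehilbert_L2m sm0 mm) (sl_inverseP vw pE' qE' sm0 ss0 mm ms cs) z) _.
  by split=> h h'; apply: h; apply/(sl_solvable_at vw pE' sm0 mm).
have E16 : (16 : R)%:C = 4 ^+ 2 :> R[i] by rewrite rmorph_nat -natrX.
set specG := spec _ (sl_op _ _ _); apply/seteqP; split=> [w /SA nw|w].
  pose z := (w / 4) ^+ 2.
  have Gz : specG z.
    apply/SG; by rewrite E16 /z -exprMn divfK.
  have : sqrtc z ^+ 2 = (w / 4) ^+ 2 by rewrite sqr_sqrtc.
  move=> /eqP; rewrite eqf_sqr => /orP[]/eqP E.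
    by left; exists (sqrtc z); [exists z|rewrite E mulrC divfK].
  by right; exists (sqrtc z); [exists z|rewrite E mulrN opprK mulrC divfK].
have H z : specG z -> forall w, w ^+ 2 = 16 * z -> spec (L2R D) (dirac_op D) w.
  move=> /SG Gz w' wz; apply/SA; rewrite (_ : w' * w' = z * 16%:C)//.
  by rewrite -expr2 wz E16 mulrC -natrX.
move=> [[_ [z Gz <-] <-]|[_ [z Gz <-] <-]]; apply: (H z Gz); rewrite ?sqrrN exprMn sqr_sqrtc//.
  by rewrite -natrX.
by rewrite -natrX.
Qed.

Lemma path_theorem :
  let specG := spec (sl_space beta a b) (sl_op beta a b) in
  [/\ [/\ condA D, condB D, condC D & u1_admissible D],
      self_adjoint (L2R D) (dirac_op D),
      (a < 0 -> limit_circle_case D) /\ (0 <= a -> limit_point_case D),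
      exists2 K, bounded_inverse (L2R D) (dirac_op D) K & hilbert_schmidt (L2R D) K &
      spec (L2R D) (dirac_op D) =
        [set 4 * z | z in sqrt_set specG] `|` [set - (4 * z) | z in sqrt_set specG]].
Proof.
split.
- split; [exact: (diagonal_condA vw)|exact: (diagonal_condB vw)|exact: (diagonal_condC vw)|].
  exact: (diagonal_u1_admissible vw).
- exact: (dirac_self_adjoint vw).
- by split; [exact: path_limit_circle|exact: path_limit_point].
- exists (dirac_inverse y); last exact: (dirac_inverse_hilbert_schmidt vw).
  exact: (inverse_bounded_inverse (prehilbert_L2R vw) (dirac_inverseP vw)).
- exact: path_spec.
Qed.

End path.

(** * Growth of Brownian paths *)

Lemma nneseries_le_geometric (R : realType) (f : nat -> \bar R) (K q : R) :
  0 <= K -> 0 < q < 1 -> (forall n, 0 <= f n <= (K * q ^+ n)%:E)%E ->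
  (\sum_(0 <= n <oo) f n <= (K / (1 - q))%:E)%E.
Proof.
move=> K0 /andP[q0 q1] fK; apply: lime_le.
  by apply: is_cvg_nneseries => n _ _; have /andP[] := fK n.
near=> n; apply: (@le_trans _ _ (\sum_(0 <= i < n) (K * q ^+ i)%:E)%E).
  by apply: lee_sum => i _; have /andP[] := fK i.
rewrite sumEFin lee_fin; apply: geometric_le_lim => //.
by rewrite gtr0_norm.
Unshelve. all: by end_near. Qed.

(** * Gaussian estimates *)

Section gaussian_tail.
Variable R : realType.
Let mu := @lebesgue_measure R.

(** Order 2 in [z] becomes order 4 in [normal_tail], enough to outweigh the number of dyadic
    intervals in the chaining. *)
Lemma expR_neg_le (z : R) : 0 < z -> expR (- z) <= 4 / z ^+ 2.
Proof.
move=> z0; rewrite expRN -(invrK (4 / _)) lef_pV2 ?posrE ?expR_gt0 ?invr_gt0 ?divr_gt0 ?exprn_gt0//.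
rewrite invf_div (_ : z ^+ 2 / 4 = (z / 2) ^+ 2); last by rewrite expr_div_n -natrX.
have -> : expR z = expR (z / 2) ^+ 2 by rewrite expr2 -expRD -splitr.
have h := expR_ge1Dx (z / 2).
by rewrite lerXn2r ?nnegrE ?divr_ge0 ?expR_ge0 ?ltW//; lra.
Qed.

Let split_exponent (w v : R) : v != 0 ->
  - w / (v *+ 2) = - (w / (4 * v)) + - w / (2 * v *+ 2).
Proof. by rewrite -(mulr_natr v) -(mulr_natr (2 * v)) => v0; field. Qed.

(* Up to the factor [sqrt 2 * expR (- z ^+ 2 / (4 * v))] the density of variance
   [v] is that of variance [2 * v], whose total mass is [1]. *)
Lemma normal_tail (v x : R) : 0 < v -> 0 < x ->
  (normal_prob 0 (Num.sqrt v) [set z | (x < `|z|)%R] <= (128 * v ^+ 2 / x ^+ 4)%:E)%E.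
Proof.
move=> v0 x0.
have v20 : 0 < 2 * v by rewrite mulr_gt0.
have sv : Num.sqrt v != 0 by rewrite gt_eqF// sqrtr_gt0.
have sv2 : Num.sqrt (2 * v) != 0 by rewrite gt_eqF// sqrtr_gt0.
have pdf_le z : x < `|z| -> normal_pdf 0 (Num.sqrt v) z <=
    128 * v ^+ 2 / x ^+ 4 * normal_pdf 0 (Num.sqrt (2 * v)) z.
  move=> xz; rewrite !normal_pdfE// /normal_peak /normal_fun (sqr_sqrtr (ltW v0)) (sqr_sqrtr (ltW v20)) subr0.
  have -> : Num.sqrt (2 * v * pi *+ 2) = Num.sqrt 2 * Num.sqrt (v * pi *+ 2).
    by rewrite -mulrA -mulrnAr sqrtrM.
  have -> : expR (- z ^+ 2 / (v *+ 2)) = expR (- (z ^+ 2 / (4 * v))) * expR (- z ^+ 2 / (2 * v *+ 2)).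
    by rewrite -expRD -split_exponent// gt_eqF.
  (* [expR_neg_le] at [x ^ 2 / (4 v)] gives the 64; the factor [sqrt 2 <= 2] between the two
     densities makes it 128. *)
  have e1 : expR (- (z ^+ 2 / (4 * v))) <= 64 * v ^+ 2 / x ^+ 4.
    have xz2 : x ^+ 2 / (4 * v) <= z ^+ 2 / (4 * v).
      rewrite ler_pM2r ?invr_gt0 ?mulr_gt0// -[leRHS]real_normK ?num_real//.
      by rewrite lerXn2r ?nnegrE// ltW.
    apply: (@le_trans _ _ (expR (- (x ^+ 2 / (4 * v))))); first by rewrite ler_expR lerN2.
    apply: le_trans (expR_neg_le _) _; first by rewrite divr_gt0 ?exprn_gt0// mulr_gt0.
    rewrite le_eqVlt; apply/orP; left; apply/eqP; field.
    by rewrite !gt_eqF.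
  have s2 : Num.sqrt 2 <= 2 :> R.
    by rewrite -(@ler_pXn2r _ 2)// ?nnegrE ?sqrtr_ge0// sqr_sqrtr// -natrX ler_nat.
  have s20 : 0 < Num.sqrt 2 :> R by rewrite sqrtr_gt0.
  have P0 : 0 < Num.sqrt (v * pi *+ 2) by rewrite sqrtr_gt0 mulrn_wgt0// mulr_gt0// pi_gt0.
  set E := expR (- z ^+ 2 / (2 * v *+ 2)); have E0 : 0 <= E by exact: expR_ge0.
  set e := expR _ in e1 *; set P := Num.sqrt _ in P0 *; set k := v ^+ 2 / x ^+ 4.
  have -> : 128 * v ^+ 2 / x ^+ 4 * ((Num.sqrt 2 * P)^-1 * E) = P^-1 * E * (128 * k / Num.sqrt 2).
    have -> : 128 * v ^+ 2 / x ^+ 4 = 128 * k by rewrite /k mulrA.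
    by rewrite invfM -[_ * P^-1 * E]mulrA [LHS]mulrA [RHS]mulrC.
  rewrite [leLHS]mulrCA [leLHS]mulrC; apply: ler_wpM2l; first by rewrite mulr_ge0// invr_ge0 ltW.
  rewrite ler_pdivlMr//; have k0 : 0 <= k by rewrite divr_ge0 ?exprn_ge0 ?ltW.
  apply: (@le_trans _ _ (64 * k * 2)); last by rewrite mulrAC -natrM.
  by apply: ler_pM => //; rewrite ?expR_ge0 ?sqrtr_ge0// /k mulrA.
rewrite /normal_prob.
have mA : measurable [set z : R | x < `|z|].
  have : measurable_fun [set: R] (fun z : R => x < `|z|) by exact: measurable_fun_ltr.
  by move=> /(_ measurableT [set true] I); rewrite setTI.
apply: (@le_trans _ _ (\int[mu]_(z in [set z | (x < `|z|)%R])
    (128 * v ^+ 2 / x ^+ 4 * normal_pdf 0 (Num.sqrt (2 * v)) z)%:E)%E).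
  apply: le_lint => //.
  - by apply/measurable_EFinP; apply: measurable_funTS; exact: measurable_normal_pdf.
  - apply/measurable_EFinP; apply: measurable_funTS; apply: measurable_funM => //.
    exact: measurable_normal_pdf.
  - by move=> z _; rewrite lee_fin normal_pdf_ge0.
have K0 : 0 <= 128 * v ^+ 2 / x ^+ 4.
  by rewrite divr_ge0 ?exprn_ge0 ?mulr_ge0 ?exprn_ge0// ltW.
rewrite (@eq_lint _ _ _ (fun z => ((128 * v ^+ 2 / x ^+ 4)%:E * (normal_pdf 0 (Num.sqrt (2 * v)) z)%:E)%E)); last by [].
rewrite ge0_integralZl_EFin//; last 2 first.
  by move=> z _; rewrite lee_fin normal_pdf_ge0.
  by apply/measurable_EFinP; apply: measurable_funTS; exact: measurable_normal_pdf.
rewrite -[leRHS]mule1; apply: lee_wpmul2l; first by rewrite lee_fin.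
rewrite -(integral_normal_pdf 0 (Num.sqrt (2 * v))); apply: ge0_subset_integral => //.
  by apply/measurable_EFinP; exact: measurable_normal_pdf.
by move=> z _; rewrite lee_fin normal_pdf_ge0.
Qed.

(** On [[sg, 2 sg]] the density is at least [expR (- 2) / (sqrt (2 pi) sg)], and that interval has
    length [sg], so the bound is the same for every variance. *)
Lemma normal_ge_sd : exists2 p0 : R, 0 < p0 &
  forall v, 0 < v -> (p0%:E <= normal_prob 0 (Num.sqrt v) `[Num.sqrt v, +oo[)%E.
Proof.
exists (expR (- 2) / (Num.sqrt (pi *+ 2))).
  by rewrite divr_gt0 ?expR_gt0// sqrtr_gt0 mulrn_wgt0// pi_gt0.
move=> v v0; set sg := Num.sqrt v.
have sg0 : 0 < sg by rewrite sqrtr_gt0.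
have sgn0 : sg != 0 by rewrite gt_eqF.
have pi2 : (0 : R) < pi *+ 2 by rewrite mulrn_wgt0// pi_gt0.
rewrite /normal_prob.
apply: (@le_trans _ _ (\int[mu]_(z in `[sg, (2 * sg)%R]) (normal_pdf 0 sg z)%:E)%E); last first.
  apply: ge0_subset_integral => //.
  - by apply/measurable_EFinP; apply: measurable_funTS; exact: measurable_normal_pdf.
  - by move=> z _; rewrite lee_fin normal_pdf_ge0.
  - by apply: subset_itvl; rewrite bnd_simp.
have low z : sg <= z <= 2 * sg -> expR (- 2) / Num.sqrt (pi *+ 2) / sg <= normal_pdf 0 sg z.
  move=> /andP[z1 z2]; rewrite normal_pdfE// /normal_peak /normal_fun subr0.
  rewrite -mulrnAr sqrtrM ?sqr_ge0// sqrtr_sqr gtr0_norm// invfM.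
  rewrite (_ : _ / sg = sg^-1 / Num.sqrt (pi *+ 2) * expR (- 2)); last first.
    by rewrite [RHS]mulrC mulrA mulrAC.
  apply: ler_wpM2l; first by rewrite divr_ge0 ?sqrtr_ge0 ?invr_ge0// ltW.
  rewrite ler_expR mulNr lerN2 ler_pdivrMr; last by rewrite mulrn_wgt0// exprn_gt0.
  rewrite (_ : 2 * _ = (2 * sg) ^+ 2); last by rewrite exprMn mulrnAr -mulrnAl -natrX -mulrnA.
  by rewrite lerXn2r ?nnegrE// ?mulr_ge0// ltW// (lt_le_trans sg0).
apply: (@le_trans _ _ (\int[mu]_(z in `[sg, (2 * sg)%R]) (expR (- 2) / Num.sqrt (pi *+ 2) / sg)%:E)%E).
  rewrite integral_cst//= lebesgue_measure_itv/= lte_fin.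
  rewrite ifT; last by rewrite mulr_natl mulr2n ltrDl.
  rewrite -EFinB -EFinM lee_fin le_eqVlt; apply/orP; left; apply/eqP; field.
  by rewrite sgn0 gt_eqF// sqrtr_gt0.
apply: le_lint => //.
- by apply/measurable_EFinP; apply: measurable_funTS; exact: measurable_normal_pdf.
- by move=> z _; rewrite lee_fin !divr_ge0 ?expR_ge0 ?sqrtr_ge0.
Qed.

End gaussian_tail.

(** * Dyadic chaining on an interval *)

Section chaining.
Variables (R : realType) (f : R -> R) (s L M : R).
Hypotheses (L0 : 0 < L) (M0 : 0 < M).
Definition dyadic (n i : nat) : R := s + i%:R * (L / 2 ^+ n).
(* The weights sum to [1] while the sum of [2 ^ n * 4 ^- n / chain_weight n ^ 4],
   which bounds the probability of a large dyadic increment, stays finite. *)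
Definition chain_weight (n : nat) : R := (9 / 10) ^+ n / 10.

Hypothesis small : forall n i, (i < 2 ^ n)%N ->
  `|f (dyadic n i.+1) - f (dyadic n i)| <= chain_weight n * M.

Lemma dyadic_double n i : dyadic n.+1 i.*2 = dyadic n i.
Proof.
rewrite /dyadic exprS -muln2 natrM; congr (_ + _); field.
by rewrite expf_neq0.
Qed.

(** The factor of [M] is the sum of the weights up to level [n]. A point of odd index at level
    [n.+1] is one step from a point of even index, which belongs to level [n]. *)
Lemma chaining_dyadic n i : (i <= 2 ^ n)%N ->
  `|f (dyadic n i) - f s| <= (1 - (9 / 10) ^+ n.+1) * M.
Proof.
elim: n i => [|n IH] i.
  rewrite expn0; case: i => [|[|//]] _.
    rewrite /dyadic mul0r addr0 subrr normr0 mulr_ge0 ?ltW// subr_gt0 expr1; lra.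
  have := @small 0 0 isT; rewrite /chain_weight !expr0 !expr1.
  have -> : dyadic 0 0 = s by rewrite /dyadic mul0r addr0.
  move=> /le_trans; apply; lra.
move=> ile.
have C : (1 - (9 / 10) ^+ n.+1) * M + chain_weight n.+1 * M = (1 - (9 / 10) ^+ n.+2) * M.
  by rewrite /chain_weight -mulrDl [_ ^+ n.+2]exprS; congr (_ * _); field.
have w0 : 0 <= chain_weight n.+1 * M.
  by rewrite /chain_weight mulr_ge0 ?ltW// divr_gt0// exprn_gt0// divr_gt0.
rewrite -C; have := odd_double_half i; case: (odd i) => /= E.
  have iE : i = (i./2).*2.+1 by rewrite -[LHS]E.
  have i2 : (i./2.*2 < 2 ^ n.+1)%N by rewrite -iE.
  have i2' : (i./2 <= 2 ^ n)%N.
    by move: i2; rewrite expnS mul2n ltn_double => /ltnW.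
  rewrite iE.
  have h1 := small i2; have := IH _ i2'; rewrite -dyadic_double => h2.
  rewrite -(subrKA (f (dyadic n.+1 i./2.*2))) addrC.
  by apply: le_trans (ler_normD _ _) _; apply: lerD.
have i2' : (i./2 <= 2 ^ n)%N.
  have : (i./2.*2 <= 2 ^ n.+1)%N by rewrite -[X in (X <= _)%N]add0n E.
  by rewrite expnS mul2n leq_double.
rewrite -E add0n dyadic_double; apply: le_trans (IH _ i2') _; rewrite lerDl.
exact: w0.
Qed.

(** By continuity [f x] is within [e] of the value at a dyadic point of high enough level, and [e]
    is arbitrary. *)
Lemma chaining x : {within `[s, s + L], continuous f} -> s <= x <= s + L -> `|f x - f s| <= M.
Proof.
move=> cf /andP[sx xs]; apply/ler_addgt0Pr => e e0.
have Ix : `[s, s + L]%classic x by rewrite /= in_itv/= sx.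
have /subspace_continuousP/(_ x Ix) := cf.
move=> /cvgrPdist_lt/(_ e e0); rewrite near_withinE => -[d /= d0 dx].
pose n := (Num.truncn (L / d)).+1.
have nd : L / 2 ^+ n < d.
  rewrite ltr_pdivrMr ?exprn_gt0// mulrC -ltr_pdivrMr//.
  apply: lt_trans (truncnS_gt _) _.
  by rewrite -natrX ltr_nat ltn_expl.
pose i := Num.truncn ((x - s) / (L / 2 ^+ n)).
have h0 : 0 < L / 2 ^+ n by rewrite divr_gt0// exprn_gt0.
have q0 : 0 <= (x - s) / (L / 2 ^+ n) by rewrite divr_ge0 ?subr_ge0// ltW.
have /andP[i1 i2] := truncn_itv q0.
rewrite ler_pdivlMr// in i1; rewrite ltr_pdivrMr// in i2.
have ile : (i <= 2 ^ n)%N.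
  rewrite -(@ler_nat R) natrX -(ler_pM2r h0); apply: le_trans i1 _.
  rewrite mulrC divfK ?expf_neq0//; lra.
have yx : dyadic n i <= x by rewrite /dyadic; move: i1; rewrite -/i; lra.
have xy : x < dyadic n i + L / 2 ^+ n.
  by rewrite /dyadic; move: i2; rewrite -/i -natr1 mulrDl mul1r; lra.
have sy : s <= dyadic n i by rewrite /dyadic lerDl mulr_ge0// ltW.
have := chaining_dyadic ile => h1.
have h2 : `|f x - f (dyadic n i)| < e.
  apply: dx; first by rewrite /= ger0_norm ?subr_ge0//; lra.
  by rewrite /= in_itv/= sy (le_trans yx).
have h3 : (1 - (9 / 10) ^+ n.+1) * M <= M.
  by rewrite ler_piMl// ?ltW// gerBl exprn_ge0// divr_ge0.
rewrite -(subrKA (f (dyadic n i))); apply: le_trans (ler_normD _ _) _; lra.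
Qed.

End chaining.

Section brownian_oscillation.
Variables (R : realType) (d : measure_display) (Omega : measurableType d)
  (P : probability Omega R) (B : R -> Omega -> R).
Hypothesis hB : brownian_motion P B.

Lemma bm_increment_tail (s t x : R) : 0 <= s -> s < t -> 0 < x ->
  (P [set w | (x < `|B t w - B s w|)%R] <= (128 * (t - s) ^+ 2 / x ^+ 4)%:E)%E.
Proof.
move=> s0 st x0; have mA : measurable [set z : R | x < `|z|].
  have : measurable_fun [set: R] (fun z : R => x < `|z|) by exact: measurable_fun_ltr.
  by move=> /(_ measurableT [set true] I); rewrite setTI.
have := bm_gaussian hB s0 st mA; rewrite [X in P X](_ : _ = [set w | (x < `|B t w - B s w|)%R])// => ->.
by apply: normal_tail => //; rewrite subr_gt0.
Qed.

Lemma measurable_increment (s t : R) : 0 <= s -> 0 <= t ->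
  measurable_fun setT (fun w => B t w - B s w).
Proof. by move=> s0 t0; apply: measurable_funB; exact: (bm_measurable hB). Qed.

Let bad (s L M : R) (n i : nat) : set Omega :=
  [set w | chain_weight R n * M < `|B (dyadic s L n i.+1) w - B (dyadic s L n i) w|].

Let bad_measurable s L M n i : 0 <= s -> 0 < L -> measurable (bad s L M n i).
Proof.
move=> s0 L0; have D0 k : 0 <= dyadic s L n k.
  by rewrite /dyadic addr_ge0// mulr_ge0// divr_ge0 ?exprn_ge0// ltW.
have : measurable_fun setT (fun w => chain_weight R n * M < `|B (dyadic s L n i.+1) w - B (dyadic s L n i) w|).
  apply: measurable_fun_ltr => //; apply: measurableT_comp => //.
  exact: measurable_increment.
by move=> /(_ measurableT [set true] I); rewrite setTI.
Qed.

Let bad_le s L M n i : 0 <= s -> 0 < L -> 0 < M ->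
  (P (bad s L M n i) <= (128 * 10 ^+ 4 * L ^+ 2 / M ^+ 4 * (((9 / 10) ^+ 4)^-1 ^+ n / 4 ^+ n))%:E)%E.
Proof.
move=> s0 L0 M0; have D0 k : 0 <= dyadic s L n k.
  by rewrite /dyadic addr_ge0// mulr_ge0// divr_ge0 ?exprn_ge0// ltW.
have w0 : 0 < chain_weight R n * M.
  by rewrite mulr_gt0// /chain_weight divr_gt0// exprn_gt0// divr_gt0.
have DB : dyadic s L n i.+1 - dyadic s L n i = L / 2 ^+ n.
  by rewrite /dyadic -natr1; ring.
have DS : dyadic s L n i < dyadic s L n i.+1 by rewrite -subr_gt0 DB divr_gt0// exprn_gt0.
apply: le_trans (bm_increment_tail (D0 i) DS w0) _.
rewrite lee_fin DB /chain_weight le_eqVlt; apply/orP; left; apply/eqP.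
rewrite [in RHS]exprVn -exprM mulnC exprM (_ : 4 ^+ n = (2 ^+ n) ^+ 2 :> R); last first.
  by rewrite exprAC; congr (_ ^+ n); lra.
have : (9 / 10) ^+ n != 0 :> R by rewrite expf_neq0// mulf_neq0// invr_neq0.
have : 2 ^+ n != 0 :> R by rewrite expf_neq0.
move: (2 ^+ n) ((9 / 10) ^+ n) => p q p0 q0; field.
by rewrite p0 q0 gt_eqF.
Qed.

(** [U] is the event that some dyadic increment exceeds its share of [M]. It is built from countably
    many times and so is measurable, whereas the oscillation over the interval is controlled only on
    continuous paths. *)
Lemma bm_oscillation : exists2 K : R, 0 <= K & forall s L M : R, 0 <= s -> 0 < L -> 0 < M ->
  exists U : set Omega, [/\ measurable U, (P U <= (K * (L ^+ 2 / M ^+ 4))%:E)%E &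
    forall w, ~ U w -> {within `[0, +oo[, continuous (B ^~ w)} ->
      forall x, s <= x <= s + L -> `|B x w - B s w| <= M].
Proof.
(* The total probability at level [n] is at most a constant times the [n]-th power of
   [2 * (10 / 9) ^ 4 / 4], which is below [4 / 5]. *)
exists (128 * 10 ^+ 4 / (1 - 4 / 5)) => // [|s L M s0 L0 M0].
  by rewrite divr_ge0//; lra.
pose V n := \big[setU/set0]_(i < 2 ^ n) bad s L M n i.
have mV n : measurable (V n) by apply: bigsetU_measurable => i _; exact: bad_measurable.
pose K0 := 128 * 10 ^+ 4 * L ^+ 2 / M ^+ 4.
have K00 : 0 <= K0 by rewrite /K0 divr_ge0 ?mulr_ge0 ?exprn_ge0// ltW.
exists (\bigcup_n V n); split; first exact: bigcup_measurable.
- apply: le_trans (measure_sigma_subadditive P mV _ (@subset_refl _ _)) _.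
    exact: bigcup_measurable.
  have -> : 128 * 10 ^+ 4 / (1 - 4 / 5) * (L ^+ 2 / M ^+ 4) = K0 / (1 - 4 / 5).
    by rewrite /K0 !mulrA; ring.
  apply: nneseries_le_geometric => //.
    by apply/andP; split; [rewrite divr_gt0|rewrite ltr_pdivrMr// mul1r ltr_nat].
  move=> n; rewrite measure_ge0/=.
  apply: le_trans (Boole_inequality _ _) _; first by move=> i _; exact: bad_measurable.
  apply: (@le_trans _ _ (\sum_(i < 2 ^ n) (K0 * (((9 / 10) ^+ 4)^-1 ^+ n / 4 ^+ n))%:E)%E).
    by apply: lee_sum => i _; exact: bad_le.
  clearbody K0; rewrite sumEFin lee_fin sumr_const card_ord -[leLHS]mulr_natl.
  rewrite [leLHS]mulrCA; apply: (ler_wpM2l K00).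
  rewrite natrX -expr_div_n -exprMn lerXn2r ?nnegrE//; lra.
- move=> w nU cw x sx; apply: (@chaining _ (B ^~ w) s L M L0 M0) sx => //.
    move=> n i i2; rewrite leNgt; apply/negP => bw; apply: nU; exists n => //.
    by rewrite /V -bigcup_mkord; exists i.
  apply: continuous_subspaceW cw => z /=; rewrite !in_itv/= andbT => /andP[sz _].
  exact: le_trans sz.
Qed.

End brownian_oscillation.

Lemma borel_cantelli_geometric (R : realType) (d : measure_display) (Omega : measurableType d)
    (P : probability Omega R) (F : nat -> set Omega) (K q : R) :
  0 <= K -> 0 < q < 1 -> (forall n, measurable (F n)) ->
  (forall n, (P (F n) <= (K * q ^+ n)%:E)%E) ->
  {ae P, forall w, exists n0, forall n, (n0 <= n)%N -> ~ F n w}.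
Proof.
move=> K0 q01 mF PF; exists (lim_sup_set F); split.
- by apply: bigcap_measurable => // n _; apply: bigcup_measurable => j _.
- apply: lim_sup_set_cvg0 => //; apply: le_lt_trans (nneseries_le_geometric K0 q01 _) (ltry _) => n.
  by rewrite measure_ge0/= PF.
- move=> w /= nw n _; apply: contrapT => nU; apply: nw; exists n => j nj Fj.
  by apply: nU; exists j.
Qed.

Lemma prode_le_expr (R : realType) (n : nat) (f : 'I_n -> \bar R) (q : R) :
  0 <= q -> (forall i, 0 <= f i <= q%:E)%E -> (\big[*%E/1%E]_(i < n) f i <= (q ^+ n)%:E)%E.
Proof.
move=> q0; elim: n f => [|n IH] f fq; first by rewrite big_ord0 expr0.
rewrite big_ord_recr exprSr EFinM; apply: lee_pmul.
- by apply: prode_ge0 => i _; have /andP[] := fq (widen_ord (leqnSn n) i).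
- by have /andP[] := fq ord_max.
- exact: IH.
- by have /andP[] := fq ord_max.
Qed.

Lemma not_integrable_unit_intervals (R : realType) (g : R -> R) :
  (forall x, 0 <= x -> 0 <= g x) ->
  (forall m, exists2 n, (m <= n)%N & forall x, n%:R <= x <= n.+1%:R -> 1 <= g x) ->
  ~ (@lebesgue_measure R).-integrable halfline (EFin \o g).
Proof.
move=> g0 gn ig; have mg : measurable_fun (@halfline R) g.
  by apply/measurable_EFinP; have /integrableP[] := ig.
have mH : measurable (@halfline R) by exact: measurable_itv.
have sH (D : set R) : D `<=` halfline -> measurable D ->
    measurable_fun D (fun x => (g x)%:E) /\ (forall x, D x -> (0 <= (g x)%:E)%E).
  move=> DH mD; split; first by apply/measurable_EFinP; exact: measurable_funS mg.
  by move=> x /DH; rewrite /halfline/= in_itv/= andbT lee_fin; exact: g0.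
have step N : exists m : nat, (N%:R%:E <= \int[@lebesgue_measure R]_(x in `[0%R, m%:R[) (g x)%:E)%E.
  elim: N => [|N [m Nm]].
    by exists 0%N; apply: integral_ge0 => x /=; rewrite in_itv/= lee_fin => /andP[/g0].
  have [n mn n1] := gn m; exists n.+1.
  have H1 : [set` `[0%R, m%:R[] `<=` (@halfline R).
    by move=> x /=; rewrite /halfline/= !in_itv/= andbT => /andP[].
  have H2 : [set` `[n%:R, n.+1%:R[] `<=` (@halfline R).
    by move=> x /=; rewrite /halfline/= !in_itv/= andbT => /andP[+ _]; apply: le_trans.
  have H3 : [set` `[0%R, n.+1%:R[] `<=` (@halfline R).
    by move=> x /=; rewrite /halfline/= !in_itv/= andbT => /andP[].
  have m1 : measurable [set` `[0 : R, m%:R[] by exact: measurable_itv.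
  have m2 : measurable [set` `[n%:R : R, n.+1%:R[] by exact: measurable_itv.
  have m3 : measurable [set` `[0 : R, n.+1%:R[] by exact: measurable_itv.
  have [f1 p1] := sH _ H1 m1; have [f2 p2] := sH _ H2 m2; have [f3 p3] := sH _ H3 m3.
  have sub : [set` `[0%R, m%:R[] `|` [set` `[n%:R, n.+1%:R[] `<=` ([set` `[0%R, n.+1%:R[] : set R).
    move=> x [] /=; rewrite !in_itv/= => /andP[x0 x1].
      by rewrite x0/= (lt_trans x1)// ltr_nat ltnS.
    by rewrite x1 andbT (le_trans _ x0).
  have dis : [disjoint ([set` `[0%R, m%:R[] : set R) & [set` `[n%:R, n.+1%:R[]].
    apply/disj_setPS => x [] /=; rewrite !in_itv/= => /andP[_ xm] /andP[nx _].
    by have := le_lt_trans nx xm; rewrite ltr_nat ltnNge mn.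
  have mU := measurableU _ _ m1 m2.
  have [fU pU] := sH _ (subset_trans sub H3) mU.
  apply: le_trans (ge0_subset_integral (@lebesgue_measure R) mU m3 f3 p3 sub).
  rewrite (ge0_integral_setU (@lebesgue_measure R) m1 m2 fU pU)// -natr1 EFinD leeD//.
  have -> : 1%:E = (\int[@lebesgue_measure R]_(x in `[n%:R, n.+1%:R[) (cst 1%:E x))%E :> \bar R.
    rewrite (@integral_cst _ (measurableTypeR R) R (@lebesgue_measure R) _ m2 1) mul1e.
    transitivity ((n.+1%:R - n%:R : R)%:E); first by rewrite -natr1 addrAC subrr add0r.
    by have := lebesgue_measure_itv `[n%:R : R, n.+1%:R[ => /= ->; rewrite lte_fin ltr_nat ltnSn.
  apply: le_lint => // x /=; rewrite in_itv/= lee_fin => /andP[nx xn]; apply: n1.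
  by rewrite nx (ltW xn).
have := lint_lty mH ig; rewrite ltNge => /negP; apply.
have [N HN] : exists N : nat, (\int[@lebesgue_measure R]_(x in halfline) (g x)%:E < N%:R%:E)%E.
  exists (Num.truncn (fine (\int[@lebesgue_measure R]_(x in halfline) (g x)%:E))%E).+1.
  rewrite -[ltLHS]fineK ?lte_fin ?truncnS_gt//.
  exact: (@integrable_fin_num _ (measurableTypeR R) R (@lebesgue_measure R) _ mH _ ig).
have [m Hm] := step N.
have HI : [set` `[0%R, m%:R[] `<=` (@halfline R).
  by move=> x /=; rewrite /halfline/= !in_itv/= andbT => /andP[].
have [fH pH] := sH _ (@subset_refl _ _) mH.
have mI : measurable [set` `[0 : R, m%:R[] by exact: measurable_itv.
have := le_trans Hm (ge0_subset_integral (@lebesgue_measure R) mI mH fH pH HI).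
by move=> h; exfalso; move: h; rewrite leNgt HN.
Qed.

Section ae_combinators.
Variables (R : realType) (d : measure_display) (T : measurableType d) (mu : {measure set T -> \bar R}).

Lemma aeS (Q S : T -> Prop) : (forall w, Q w -> S w) ->
  {ae mu, forall w, Q w} -> {ae mu, forall w, S w}.
Proof. by move=> QS; apply: filterS QS; exact: (ae_filter_ringOfSetsType mu). Qed.

Lemma aeI (Q S : T -> Prop) : {ae mu, forall w, Q w} -> {ae mu, forall w, S w} ->
  {ae mu, forall w, Q w /\ S w}.
Proof. by move=> HQ HS; apply: filterI HQ HS; exact: (ae_filter_ringOfSetsType mu). Qed.

End ae_combinators.

(** * Almost sure properties of Brownian paths *)

Section brownian_paths.
Variables (R : realType) (d : measure_display) (Omega : measurableType d)
  (P : probability Omega R) (B : R -> Omega -> R).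
Hypothesis hB : brownian_motion P B.

(** From some [k] on, [|B| <= e 2^k] on [[0, 2^k]]. For large [x] the least admissible [k] has
    [2^k < 2 x], whence the factor 2. Taking the rates [1 / n.+1] leaves only countably many null
    sets. *)
Lemma bm_sublinear : {ae P, forall w, forall e : R, 0 < e ->
  exists C, forall x, 0 <= x -> `|B x w| <= C + e * x}.
Proof.
have [K K0 HK] := bm_oscillation hB.
have H (n : nat) : {ae P, forall w, {within `[0, +oo[, continuous (B ^~ w)} -> B 0 w = 0 ->
    exists C, forall x, 0 <= x -> `|B x w| <= C + 2 * n.+1%:R^-1 * x}.
  pose e : R := n.+1%:R^-1; have e0 : 0 < e by rewrite invr_gt0.
  have /choice[U HU] (k : nat) : exists U : set Omega, [/\ measurable U,
      (P U <= (K * ((2 ^+ k) ^+ 2 / (e * 2 ^+ k) ^+ 4))%:E)%E &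
      forall w, ~ U w -> {within `[0, +oo[, continuous (B ^~ w)} ->
        forall x, 0 <= x <= 0 + 2 ^+ k -> `|B x w - B 0 w| <= e * 2 ^+ k].
    by apply: HK => //; rewrite ?mulr_gt0 ?exprn_gt0.
  have c1 : 0 <= K / e ^+ 4 by rewrite divr_ge0// exprn_ge0// (ltW e0).
  have c2 : 0 < (4^-1 : R) < 1 by apply/andP; split; lra.
  have c3 k : measurable (U k) by have [] := HU k.
  have c4 k : (P (U k) <= (K / e ^+ 4 * 4^-1 ^+ k)%:E)%E.
    have [_ + _] := HU k => /le_trans; apply; rewrite lee_fin le_eqVlt; apply/orP; left; apply/eqP.
    rewrite (_ : 4^-1 = (2 ^+ 2)^-1 :> R); last by rewrite -natrX.
    rewrite [in RHS]exprVn -[in RHS]exprM mulnC [in RHS]exprM.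
    have : 2 ^+ k != 0 :> R by rewrite expf_neq0.
    have : e != 0 by rewrite gt_eqF.
    clear; move: (2 ^+ k) e => p e' e0 p0; field.
    by rewrite p0 e0.
  have := borel_cantelli_geometric c1 c2 c3 c4.
  apply: aeS => w [k0 Hk] cw B0; exists (e * 2 ^+ k0) => x x0.
  have Hb k : (k0 <= k)%N -> x <= 2 ^+ k -> `|B x w| <= e * 2 ^+ k.
    move=> kk xk; have [_ _ /(_ w (Hk k kk) cw x)] := HU k.
    by rewrite x0 add0r B0 subr0; exact.
  have [xk0|xk0] := leP x (2 ^+ k0).
    by apply: le_trans (Hb k0 (leqnn _) xk0) _; rewrite lerDl !mulr_ge0 ?invr_ge0.
  have ex : exists k, (k0 <= k)%N && (x <= 2 ^+ k).
    exists (maxn k0 (Num.truncn x).+1); rewrite leq_maxl/=.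
    apply: le_trans (ltW (truncnS_gt x)) _; rewrite -natrX ler_nat.
    by apply: leq_trans (ltnW (ltn_expl _ (isT : 1 < 2)%N)) _; rewrite leq_exp2l// leq_maxr.
  case: (ex_minnP ex) => k /andP[kk xk] kmin.
  have kk0 : (k0 < k)%N.
    by rewrite ltn_neqAle kk andbT; apply: contraTneq xk => <-; rewrite -ltNge.
  have xk' : 2 ^+ k.-1 < x.
    rewrite ltNge; apply/negP => h; have kp : (0 < k)%N by apply: leq_ltn_trans kk0.
    have : (k <= k.-1)%N by apply: kmin; rewrite h andbT -ltnS (prednK kp).
    by rewrite leqNgt ltn_predL kp.
  apply: le_trans (Hb k kk xk) _.
  have -> : 2 ^+ k = 2 * 2 ^+ k.-1 :> R by rewrite -exprS prednK// (leq_ltn_trans _ kk0).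
  rewrite -[leLHS]add0r lerD ?mulr_ge0 ?exprn_ge0// ?(ltW e0)//.
  by rewrite mulrA [e * 2]mulrC ler_wpM2l ?mulr_ge0 ?(ltW e0)// (ltW xk').
have := aeI (aeI (bm_continuous hB) (bm_start hB)) (ae_foralln H).
apply: aeS => w [[cw B0] Hw] e e0.
have [C HC] := Hw (Num.truncn (2 / e)) cw B0; exists C => x x0.
apply: le_trans (HC x x0) _; rewrite lerD2l ler_wpM2r//.
rewrite ler_pdivrMr// mulrC -ler_pdivrMr// (ltW (truncnS_gt _))//.
Qed.

(* As [N k.+1 = N k ^ 2], an increment of one standard deviation over
   [[N k, N k.+1]] dominates the sublinear bound on the path at [N k]. *)
Let N (k : nat) : R := 2 ^+ (2 ^ k).

Let N_ge1 k : 1 <= N k. Proof. by rewrite /N exprn_ege1// ler1n. Qed.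

Let N_S k : N k.+1 = N k ^+ 2.
Proof. by rewrite /N -exprM -expnSr. Qed.

Let N_ge k : 2 ^+ k <= N k.
Proof. by rewrite /N ler_eXn2l ?ltr1n// ltnW// ltn_expl. Qed.

Let N_ge2 k : 2 <= N k.
Proof. by rewrite /N -[leLHS]expr1 ler_eXn2l ?ltr1n// expn_gt0. Qed.

Let sd_ge k : N k / 2 <= Num.sqrt (N k.+1 - N k).
Proof.
have := N_ge2 k; rewrite N_S; move: (N k) => x x2.
rewrite -[leLHS]ger0_norm ?divr_ge0//; last by lra.
rewrite -sqrtr_sqr; apply: ler_wsqrtr; nra.
Qed.

Let N_ltS k : N k < N k.+1.
Proof. by have := N_ge2 k; rewrite N_S => h; nra. Qed.

(** That all increments from [m] on stay below one standard deviation has, by independence,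
    probability at most [(1 - p0) ^ n] for every [n], hence probability 0. *)
Lemma bm_large_increments : {ae P, forall w, forall m, exists2 k, (m <= k)%N &
  Num.sqrt (N k.+1 - N k) <= B (N k.+1) w - B (N k) w}.
Proof.
apply: ae_foralln => m.
have N0 k : 0 <= N k by apply: le_trans (N_ge1 k).
have [p0 p00 Hp0] := @normal_ge_sd R.
pose X k w := B (N k.+1) w - B (N k) w.
pose J k : set R := [set` `]-oo, Num.sqrt (N k.+1 - N k)[].
have mJ k : measurable (J k) by exact: measurable_itv.
have mX k : measurable_fun setT (X k) by exact: (measurable_increment hB).
have mA k : measurable (X k @^-1` J k) by rewrite -[_ @^-1` _]setTI; exact: mX.
have JE k : X k @^-1` J k = ~` (X k @^-1` `[Num.sqrt (N k.+1 - N k), +oo[).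
  by rewrite preimage_setC /J setCitvr.
have PA k : (P (X k @^-1` J k) <= (1 - p0)%:E)%E.
  rewrite JE probability_setC; last by rewrite -[_ @^-1` _]setTI; apply: mX => //; exact: measurable_itv.
  rewrite EFinB leeB// (bm_gaussian hB (N0 k) (N_ltS k)); last exact: measurable_itv.
  by apply: Hp0; rewrite subr_gt0.
have q0 : 0 <= 1 - p0.
  by rewrite -lee_fin; apply: le_trans (PA 0%N); exact: measure_ge0.
pose E := \bigcap_i (X (m + i)%N @^-1` J (m + i)%N).
have mE : measurable E by apply: bigcap_measurable => // i _; exact: mA.
have PE n : (P E <= ((1 - p0) ^+ n)%:E)%E.
  have tS i : (i < n)%N -> N (m + i) <= N (m + i.+1) by rewrite addnS (ltW (N_ltS _)).
  have := bm_independent hB (N0 (m + 0)%N) tS (A := fun i => J (m + i)%N) (fun i => mJ _).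
  move=> PI; apply: (@le_trans _ _ (P (\bigcap_(i in [set: 'I_n]) (X (m + i)%N @^-1` J (m + i)%N)))).
    apply: le_measure; rewrite ?inE//.
      by apply: fin_bigcap_measurable => // i _; exact: mA.
    by move=> w Ew i _; exact: Ew.
  rewrite (_ : P _ = (\big[*%E/1%E]_(i < n) P (X (m + i)%N @^-1` J (m + i)%N))%E).
    by apply: prode_le_expr => // i; rewrite measure_ge0 PA.
  rewrite /X; move: PI; under eq_bigcapr => i _ do rewrite addnS.
  by move=> ->; under eq_bigr => i _ do rewrite addnS.
exists E; split => //.
  have PEf : P E \is a fin_num by exact: fin_num_measure.
  apply/eqP; rewrite eq_le measure_ge0 andbT -[leLHS]fineK// lee_fin.
  have q1 : `|1 - p0| < 1 by rewrite ger0_norm// gtrBl.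
  apply: (cvgr_to_ge (cvg_expr q1)).
  by apply: nearW => n; rewrite -lee_fin fineK.
move=> w /= nw i _; rewrite /J /= in_itv/= ltNge; apply/negP => h; apply: nw.
by exists (m + i)%N => //; exact: leq_addr.
Qed.

(** For infinitely many [k] the large increment and the sublinear bound give
    [B >= N k / 2 - N k / 8 - C] at time [N k.+1]. Oscillation over the next unit of time costs at
    most [N k / 8], and [C <= N k / 4] for large [k]. So [B >= 0] throughout that unit interval and
    the exponential is at least 1 there. *)
Lemma bm_expR_not_integrable : {ae P, forall w, forall c : R, 0 < c ->
  ~ (@lebesgue_measure R).-integrable halfline (EFin \o (fun x => expR (c * B x w)))}.
Proof.
have [K K0 HK] := bm_oscillation hB.
have Ngt0 k : 0 < N k by apply: lt_le_trans (N_ge1 k).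
have /choice[U HU] (k : nat) : exists U : set Omega, [/\ measurable U,
    (P U <= (K * (1 ^+ 2 / (N k / 8) ^+ 4))%:E)%E &
    forall w, ~ U w -> {within `[0, +oo[, continuous (B ^~ w)} ->
      forall x, N k.+1 <= x <= N k.+1 + 1 -> `|B x w - B (N k.+1) w| <= N k / 8].
  by apply: HK => //; [exact: ltW|exact: divr_gt0].
have c1 : 0 <= K * 8 ^+ 4 by rewrite mulr_ge0// exprn_ge0.
have c2 : 0 < ((2 ^+ 4)^-1 : R) < 1 by apply/andP; split; lra.
have c3 k : measurable (U k) by have [] := HU k.
have c4 k : (P (U k) <= (K * 8 ^+ 4 * (2 ^+ 4)^-1 ^+ k)%:E)%E.
  have [_ + _] := HU k => /le_trans; apply; rewrite lee_fin -mulrA ler_wpM2l//.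
  rewrite expr1n div1r expr_div_n invf_div ler_wpM2l ?exprn_ge0//.
  rewrite exprVn -exprM mulnC exprM lef_pV2 ?posrE ?exprn_gt0//.
  by rewrite lerXn2r ?nnegrE ?exprn_ge0// ltW.
have := aeI (aeI (bm_continuous hB) (borel_cantelli_geometric c1 c2 c3 c4))
  (aeI bm_sublinear bm_large_increments).
apply: aeS => w [[cw [k0 Hk]] [Sw Iw]] c c0; apply: not_integrable_unit_intervals.
  by move=> x _; exact: expR_ge0.
move=> m; have [C HC] := Sw (1 / 8) (divr_gt0 ltr01 (ltr0Sn _ _)).
have [k mk Xk] := Iw (maxn m (maxn k0 (Num.truncn (4 * C)).+1)).
move: mk; rewrite !geq_max => /and3P[mk k0k Ck].
exists (2 ^ (2 ^ k.+1))%N.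
  apply: leq_trans mk _; apply: leq_trans (leqnSn _) _.
  by apply: leq_trans (ltnW (ltn_expl k.+1 (isT : 1 < 2)%N)) _; exact: (ltnW (ltn_expl _ _)).
move=> x; rewrite -natr1 natrX -[_ ^+ _]/(N k.+1) => xk.
rewrite -expR0 ler_expR; apply: mulr_ge0; first exact: ltW.
have [_ _ /(_ w (Hk k k0k) cw x xk)] := HU k.
have := HC (N k) (ltW (Ngt0 k)); have sd := sd_ge k.
have CN : 4 * C <= N k.
  apply: le_trans (ltW (truncnS_gt _)) _; apply: le_trans (N_ge k).
  by rewrite -natrX ler_nat (leq_trans Ck)// ltnW// ltn_expl.
rewrite !ler_norml => /andP[h1 _] /andP[h2 _]; lra.
Qed.

End brownian_paths.

Theorem theorem30 (R : realType) (d : measure_display)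
    (Omega : measurableType d) (P : probability Omega R) (B : R -> Omega -> R)
    (beta a : R) (hB : brownian_motion P B) (hbeta : 0 < beta) (ha : -1 < a) :
  {ae P, forall w,
    let D := bessel beta a (B ^~ w) in
    let specG := spec (sl_space beta a (B ^~ w)) (sl_op beta a (B ^~ w)) in
    [/\ [/\ condA D, condB D, condC D & u1_admissible D],
        self_adjoint (L2R D) (dirac_op D),
        (a < 0 -> limit_circle_case D) /\ (0 <= a -> limit_point_case D),
        exists2 K, bounded_inverse (L2R D) (dirac_op D) K &
                   hilbert_schmidt (L2R D) K &
        spec (L2R D) (dirac_op D) =
          [set 4 * z | z in sqrt_set specG] `|`
          [set - (4 * z) | z in sqrt_set specG]]}.
Proof.
have c0 : 0 < 2 / Num.sqrt beta by rewrite divr_gt0// sqrtr_gt0.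
have := aeI (aeI (bm_continuous hB) (bm_sublinear hB)) (bm_expR_not_integrable hB).
apply: aeS => w [[cw Sw] /(_ _ c0) Iw]; apply: path_theorem => // e e0.
have [C HC] := Sw (e / (2 / Num.sqrt beta)) (divr_gt0 e0 c0).
exists (2 / Num.sqrt beta * C) => x /HC h.
rewrite normrM (gtr0_norm c0); apply: le_trans (ler_wpM2l (ltW c0) h) _.
by rewrite mulrDr lerD2l mulrA mulrCA divff ?gt_eqF// mulr1.
Qed.
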